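(* Let $f\in C^3(\mathbb R^d)$ be such that all critical points of $f$ are nondegenerate, $\liminf_{|x|\to\infty}|\nabla f(x)|>0$, and $\operatorname{Hess} f$ is bounded on $\mathbb R^d$. Let $N_0\in\mathbb N_0$ be the number of local minima of $f$ (which is finite). Then there exist constants $\varepsilon_0\in(0,1)$ and $C>0$ such that for each $\varepsilon\in(0,\varepsilon_0]$ the following hold. (i) $\operatorname{Spec}_{\mathrm{ess}}(H_\varepsilon)\subset[C,\infty)$. (ii) $|\operatorname{Spec}_{\mathrm{disc}}(H_\varepsilon)\cap[0,C\varepsilon]|\le N_0$. (iii) $H_\varepsilon$ admits at least $N_0$ eigenvalues counting multiplicity. If $N_0\neq 0$, the $N_0$-th eigenvalue $\lambda_{N_0}(\varepsilon)$ (in increasing order and counting multiplicity) satisfies $0\le\lambda_{N_0}(\varepsilon)\le e^{-C/\varepsilon}$.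
   Context: Let $\mathcal N=\{\pm e_1,\dots,\pm e_d\}$ with $(e_k)$ the standard basis of $\mathbb R^d$. For $\varepsilon>0$, $\ell^2(\varepsilon\mathbb Z^d)$ is the Hilbert space of $\psi:\varepsilon\mathbb Z^d\to\mathbb R$ that are square summable, with scalar product $\langle\psi,\psi'\rangle=\varepsilon^d\sum_{x\in\varepsilon\mathbb Z^d}\psi(x)\psi'(x)$. The discrete Laplacian is the bounded operator $\Delta_\varepsilon\psi(x)=\varepsilon^{-2}\sum_{v\in\mathcal N}[\psi(x+\varepsilon v)-\psi(x)]$. The potential is $V_\varepsilon(x)=\sum_{v\in\mathcal N}\big[e^{-\frac{1}{2\varepsilon}[f(x+\varepsilon v)-f(x)]}-1\big]$, identified with the multiplication operator with domain $\mathrm{Dom}(V_\varepsilon)=\{\psi\in\ell^2(\varepsilon\mathbb Z^d):V_\varepsilon\psi\in\ell^2(\varepsilon\mathbb Z^d)\}$. The operator $H_\varepsilon=-\varepsilon^2\Delta_\varepsilon+V_\varepsilon$ with domain $\mathrm{Dom}(V_\varepsilon)$ is selfadjoint and nonnegative. $\operatorname{Spec}_{\mathrm{ess}}$ and $\operatorname{Spec}_{\mathrm{disc}}$ denote essential and discrete spectrum, and $|\cdot|$ of a set denotes its cardinality. *)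

(* Defs.v *)
From HB Require Import structures.
From mathcomp Require Import all_boot all_order all_algebra.
From mathcomp Require Import all_classical all_reals all_analysis.

Set Implicit Arguments.
Unset Strict Implicit.
Unset Printing Implicit Defensive.

Import Order.TTheory GRing.Theory Num.Theory.
Import numFieldNormedType.Exports.

Local Open Scope classical_set_scope.
Local Open Scope ring_scope.

Definition basis_vec (K : nzRingType) (d : nat) (k : 'I_d) : 'rV[K]_d :=
  delta_mx 0 k.

Definition neighbours (K : nzRingType) (d : nat) : seq 'rV[K]_d :=
  [seq basis_vec K k | k <- enum 'I_d] ++
  [seq - basis_vec K k | k <- enum 'I_d].

Section calculus.
Variables (R : realType) (d : nat).
Implicit Types (f : 'rV[R]_d -> R) (x : 'rV[R]_d).

Definition partial (k : 'I_d) f : 'rV[R]_d -> R := 'D_(basis_vec R k) f.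

Fixpoint Ck (m : nat) f : Prop :=
  if m is m'.+1 then
    continuous f /\
    forall k : 'I_d,
      (forall x, derivable f x (basis_vec R k)) /\ Ck m' (partial k f)
  else continuous f.

Definition grad f x : 'rV[R]_d := \row_k partial k f x.

Definition hess f x : 'M[R]_d := \matrix_(i, j) partial i (partial j f) x.

(* The library norm on ['rV[R]_d] is the sup norm. *)
Definition enorm (x : 'rV[R]_d) : R := Num.sqrt (\sum_k x 0 k ^+ 2).

(* The filter of neighbourhoods of infinity, i.e. |x| -> +oo. *)
Definition at_infinity : set_system 'rV[R]_d :=
  filter_from setT (fun M : R => [set x | M < enorm x]).

Definition nondegenerate_critical_points f : Prop :=
  forall x, grad f x = 0 -> \det (hess f x) != 0.

Definition local_minima f : set 'rV[R]_d :=
  [set x | \forall y \near x, f x <= f y].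

End calculus.

(* A function on eps Z^d is represented by psi : Z^d -> R, with psi n its
   value at the lattice point eps n. *)
Definition lattice_fun (R : realType) (d : nat) : lmodType R :=
  'rV[int]_d -> R.

(* Only the values of [op_fun] on [op_dom] are meaningful. *)
Record operator (R : realType) (d : nat) := Operator {
  op_dom : set (lattice_fun R d);
  op_fun : lattice_fun R d -> lattice_fun R d }.

Section l2.
Variables (R : realType) (d : nat).
Implicit Types (psi phi g : lattice_fun R d).

Definition lattice_point (eps : R) (n : 'rV[int]_d) : 'rV[R]_d :=
  eps *: map_mx intr n.

Definition l2 : set (lattice_fun R d) :=
  [set psi | summable setT (fun n => (psi n ^+ 2)%:E)].

(* Sum of an absolutely summable family. *)
Definition lattice_sum g : R :=
  fine (\esum_(n in setT) (EFin \o g)^\+ n)%E -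
  fine (\esum_(n in setT) (EFin \o g)^\- n)%E.

Definition l2_dot (eps : R) psi phi : R :=
  eps ^+ d * lattice_sum (fun n => psi n * phi n).

Definition l2_norm (eps : R) psi : R := Num.sqrt (l2_dot eps psi psi).

End l2.

Section spectral_theory.
Variables (R : realType) (d : nat).
Implicit Types (T : operator R d) (lam : R) (psi : lattice_fun R d).

Definition shift T lam psi : lattice_fun R d := op_fun T psi - lam *: psi.

(* [T - lam] is a bijection from its domain onto l2, with bounded inverse. *)
Definition resolvent_set (eps : R) T : set R :=
  [set lam | set_bij (op_dom T) (@l2 R d) (shift T lam) /\
     exists M : R, forall psi, op_dom T psi ->
       l2_norm eps psi <= M * l2_norm eps (shift T lam psi)].

Definition spectrum (eps : R) T : set R := ~` resolvent_set eps T.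

Definition eigenspace T lam : set (lattice_fun R d) :=
  [set psi | op_dom T psi /\ op_fun T psi = lam *: psi].

Definition eigenvalue T lam : Prop :=
  exists2 psi, eigenspace T lam psi & psi <> 0.

Definition finite_multiplicity T lam : Prop :=
  exists (n : nat) (b : 'I_n -> lattice_fun R d), forall psi,
    eigenspace T lam psi -> exists c : 'I_n -> R, psi = \sum_i c i *: b i.

Definition discrete_spectrum (eps : R) T : set R :=
  [set lam | [/\ isolated (spectrum eps T) lam, eigenvalue T lam &
                 finite_multiplicity T lam]].

Definition essential_spectrum (eps : R) T : set R :=
  spectrum eps T `\` discrete_spectrum eps T.

Definition linearly_independent (n : nat) (psi : 'I_n -> lattice_fun R d) :=
  forall c : 'I_n -> R, \sum_i c i *: psi i = 0 -> forall i, c i = 0.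

(* [T] has at least [n] eigenvalues in [I], counting multiplicity. *)
Definition at_least_eigenvalues T (I : set R) (n : nat) : Prop :=
  exists (lam : 'I_n -> R) (psi : 'I_n -> lattice_fun R d),
    linearly_independent psi /\
    forall i, I (lam i) /\ eigenspace T (lam i) (psi i).

(* [lam] is the [n]-th eigenvalue of [T] (n >= 1), in increasing order and
   counting multiplicity: fewer than [n] eigenvalues lie strictly below [lam]
   and at least [n] of them are at most [lam]. *)
Definition nth_eigenvalue T (n : nat) lam : Prop :=
  [/\ eigenvalue T lam,
      at_least_eigenvalues T [set mu | mu <= lam] n &
      ~ at_least_eigenvalues T [set mu | mu < lam] n].

End spectral_theory.

Section hamiltonian.
Variables (R : realType) (d : nat) (f : 'rV[R]_d -> R) (eps : R).
Implicit Types (psi : lattice_fun R d).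

Definition laplacian psi : lattice_fun R d :=
  fun n => eps ^- 2 * \sum_(v <- neighbours int d) (psi (n + v) - psi n).

Definition potential (x : 'rV[R]_d) : R :=
  \sum_(v <- neighbours R d)
    (expR (- (2 * eps)^-1 * (f (x + eps *: v) - f x)) - 1).

Definition potential_mul psi : lattice_fun R d :=
  fun n => potential (lattice_point eps n) * psi n.

Definition hamiltonian : operator R d := {|
  op_dom := [set psi | @l2 R d psi /\ @l2 R d (potential_mul psi)];
  op_fun := fun psi => - (eps ^+ 2 *: laplacian psi) + potential_mul psi |}.

End hamiltonian.

(* Main.v *)
(* Completing squares along the lattice edges with positive weights t turns <psi, H psi>
   into the sum of W_t psi^2, for an explicit potential W_t, plus nonnegative edge energies.

   - For t = exp(-(f(x + eps e_k) - f(x)) / (2 eps)) the potential W_t vanishes. Hence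
     H >= 0, and cutting off exp(-f / (2 eps)) sharply around each local minimum gives
     quasimodes: only edges where f exceeds its minimal value by a fixed amount
     contribute to their energy, which is therefore exponentially small.
   - For t = exp(-X_k / 2), where X is a field supported around the other critical
     points p, W_t is at least c eps except on balls of radius O(sqrt eps) around the
     minima, where it is at least -O(eps). Indeed V >= |grad f|^2 / 8 - O(eps)
     always, and near p one takes for X the slightly shortened reflection of grad f
     across a direction of negative curvature: its length is smaller, its divergence
     larger. On the balls a Poincare inequality on a lattice box controls psi as soon as
     its weighted mean vanishes. So H >= c eps on a subspace of codimension N0.

   As V >= c > 0 off a finite set, H is a finite-rank perturbation of an operator bounded
   below by c. Below c its spectrum thus consists of finitely many eigenvalues of
   finite multiplicity, which are counted by the two form bounds. *)

From HB Require Import structures.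
Require Import Defs.
From mathcomp Require Import all_boot all_order all_algebra.
From mathcomp Require Import all_classical all_reals all_analysis.
From mathcomp Require Import finmap ring lra zify.

Set Implicit Arguments.
Unset Strict Implicit.
Unset Printing Implicit Defensive.

Import Order.TTheory GRing.Theory Num.Theory.
Import numFieldNormedType.Exports.

Local Open Scope classical_set_scope.
Local Open Scope card_scope.
Local Open Scope ring_scope.

(** * Absolutely summable families and square summable functions on the lattice *)

(** To leading order the edge potential of the weights exp(- X_k / 2) is (|grad f|^2 - |X|^2) / 4 +
    (eps / 2) (div X - Delta f). For X = 0 it is V, which at a saddle can be negative of order eps,
    the very order of the gap. A field there must win twice: |X| < |grad f| away from the saddle,
    where the first term decides, and div X > Delta f at the saddle itself, where that term
    vanishes. The losses are of order eps too, so quadratic coefficients are kept exact and every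
    error is weighed against the gain.

    In a well the scale sqrt eps is right twice over: f varies there by O(eps), so exp(- f / (2
    eps)) is constant up to a bounded factor, and a box with N ~ eps^(-1/2) sites per side has a
    Poincare constant of order N^2 ~ 1 / eps.

    The spectral part rests on solving linear equations. The hopping term preserves positivity, so a
    coercive operator is inverted by a monotone iteration; a finite-rank correction becomes a matrix
    equation, and a failure of injectivity is an eigenvector. *)

(* Locked so that conversion never unfolds the extended sums behind [lattice_sum]. *)
HB.lock Definition lsum (R : realType) (d : nat) (g : 'rV[int]_d -> R) : R :=
  lattice_sum g.

Section lattice_sums.
Variables (R : realType) (d : nat).
Local Notation L := 'rV[int]_d.
Implicit Types (g h : L -> R).

Definition smb g := summable setT (EFin \o g).

(** Reduces summability to finite real sums, so that comparison, translation and finite support need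
    no extended reals. *)
Lemma smb_bound g : smb g <->
  exists M : R, forall s : seq L, uniq s -> \sum_(x <- s) `|g x| <= M.
Proof.
split => [sg|[M gM]].
  have := sg; rewrite /smb summableE => fg.
  exists (fine (\esum_(x in [set: L]) `|(EFin \o g) x|)%E) => s us.
  rewrite -lee_fin fineK// -sumEFin; apply: esum_ge.
  exists [set` s]; first by split => //; exact: finite_seq.
  by rewrite fsbig_seq//=; apply: lee_sum.
rewrite /smb /summable; apply: (@le_lt_trans _ _ M%:E); last by rewrite ltry.
apply: ge_ereal_sup => _ /= [X [finX _] <-].
rewrite fsbig_finite//=.
have := gM (enum_fset (fset_set X)) (fset_uniq _).
rewrite -lee_fin -sumEFin; apply: le_trans.
by apply: lee_sum => i _.
Qed.

Lemma smb_le h g : smb h -> (forall x, `|g x| <= h x) -> smb g.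
Proof.
move=> /smb_bound [M hM] gh; apply/smb_bound; exists M => s us.
apply: le_trans (hM s us); apply: ler_sum => x _.
by apply: (le_trans (gh x)); exact: ler_norm.
Qed.

Lemma smb_abs g : smb (fun x => `|g x|) <-> smb g.
Proof.
split => [/smb_le|]; first exact.
move=> /smb_bound [M gM]; apply/smb_bound; exists M => s us.
by under eq_bigr do rewrite normr_id; exact: gM.
Qed.

Lemma smbD g h : smb g -> smb h -> smb (fun x => g x + h x).
Proof. by move=> sg sh; exact: summableD sg sh. Qed.

Lemma smbZ (a : R) g : smb g -> smb (fun x => a * g x).
Proof.
move=> /smb_bound [M gM]; apply/smb_bound; exists (`|a| * M) => s us.
under eq_bigr do rewrite normrM.
by rewrite -mulr_sumr; apply: ler_wpM2l => //; exact: gM.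
Qed.

Lemma smbN g : smb g -> smb (fun x => - g x).
Proof.
by move=> /(smbZ (-1)); congr smb; apply: funext => x; rewrite mulN1r.
Qed.

Lemma smbB g h : smb g -> smb h -> smb (fun x => g x - h x).
Proof. by move=> sg sh; apply: smbD => //; exact: smbN. Qed.

Lemma smb_finsupp (s : seq L) g : (forall x, x \notin s -> g x = 0) -> smb g.
Proof.
move=> g0; apply/smb_bound; exists (\sum_(x <- undup s) `|g x|) => r ur.
rewrite (bigID (mem s))/= [X in _ + X]big1; last first.
  by move=> x /g0 ->; rewrite normr0.
rewrite addr0 -big_filter.
have := undup_uniq s; have uf : uniq [seq x <- r | x \in s] by exact: filter_uniq.
move=> us; rewrite [leRHS](bigID (mem [seq x <- r | x \in s]))/=.
rewrite -[leLHS]addr0; apply: lerD; last by apply: sumr_ge0.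
rewrite -[leRHS]big_filter le_eqVlt; apply/orP; left; apply/eqP.
apply: perm_big; apply: uniq_perm => //; first exact: filter_uniq.
by move=> x; rewrite !mem_filter mem_undup; case: (x \in s); rewrite ?andbF// andbT.
Qed.

Lemma smb0 : smb (fun=> 0).
Proof. exact: (@smb_finsupp [::]). Qed.

Lemma smb_sum (I : Type) (r : seq I) (P : pred I) (G : I -> L -> R) :
  (forall i, P i -> smb (G i)) -> smb (fun x => \sum_(i <- r | P i) G i x).
Proof.
move=> sG; elim: r => [|i r IH].
  suff -> : (fun x => \sum_(j <- [::] | P j) G j x) = fun=> 0 by exact: smb0.
  by apply: funext => x; rewrite big_nil.
have -> : (fun x => \sum_(j <- i :: r | P j) G j x) = (fun x =>
    if P i then G i x + \sum_(j <- r | P j) G j x else \sum_(j <- r | P j) G j x).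
  by apply: funext => x; rewrite big_cons.
by case: (P i) (sG i) => // sGi; apply: smbD => //; exact: sGi.
Qed.

Lemma smb_shift (v : L) g : smb g -> smb (fun x => g (x + v)).
Proof.
move=> /smb_bound [M gM]; apply/smb_bound; exists M => s us.
have := gM [seq x + v | x <- s]; rewrite big_map; apply.
by rewrite map_inj_uniq//; exact: addIr.
Qed.

Lemma ge0_lsum g : (forall x, 0 <= g x) ->
  lsum g = fine (\esum_(x in [set: L]) (g x)%:E)%E.
Proof.
move=> g0; rewrite unlock /lattice_sum [X in _ - fine X]esum1 ?subr0; last first.
  move=> x _; rewrite funenegE /=.
  by apply/max_idPr; rewrite lee_fin oppr_le0.
congr fine; apply: eq_esum => x _; rewrite funeposE /=.
by apply/max_idPl; rewrite lee_fin.
Qed.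

Lemma smb_esum g : (forall x, 0 <= g x) -> smb g ->
  (\esum_(x in [set: L]) (g x)%:E)%E \is a fin_num.
Proof.
move=> g0; rewrite /smb summableE; congr (_ \is a fin_num).
by apply: eq_esum => x _; rewrite /= ger0_norm.
Qed.

Lemma ge0_lsumB g h : (forall x, 0 <= g x) -> (forall x, 0 <= h x) ->
  smb g -> smb h -> lsum (fun x => g x - h x) = lsum g - lsum h.
Proof.
move=> g0 h0 sg sh; rewrite (ge0_lsum g0) (ge0_lsum h0) -fineB; last 2 first.
- exact: smb_esum.
- exact: smb_esum.
have := @esumB R L setT (EFin \o g) (EFin \o h) sg sh.
move=> /(_ (fun x _ => _)) => H; rewrite lsum.unlock /lattice_sum -fineB.
- by rewrite -[X in _ = fine X]H//= => x _; rewrite lee_fin.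
- have := summable_funepos (summableB sg sh); rewrite summableE.
  by congr (_ \is a fin_num); apply: eq_esum => x _; rewrite gee0_abs.
- have := summable_funeneg (summableB sg sh); rewrite summableE.
  by congr (_ \is a fin_num); apply: eq_esum => x _; rewrite gee0_abs.
Qed.

Lemma ge0_lsumD g h : (forall x, 0 <= g x) -> (forall x, 0 <= h x) ->
  smb g -> smb h -> lsum (fun x => g x + h x) = lsum g + lsum h.
Proof.
move=> g0 h0 sg sh.
rewrite !ge0_lsum//; last by move=> x; rewrite addr_ge0.
rewrite -fineD; [|exact: smb_esum|exact: smb_esum].
by congr fine; under eq_esum do rewrite EFinD; rewrite esumD// => x _; rewrite lee_fin.
Qed.

Lemma lsum_shift (v : L) g : lsum (fun x => g (x + v)) = lsum g.
Proof.
rewrite unlock /lattice_sum.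
have b : set_bij [set: L] [set: L] (fun x => x + v).
  split => //; first by move=> x y _ _; exact: addIr.
  by move=> y _; exists (y - v) => //; rewrite subrK.
by congr (fine _ - fine _); rewrite [RHS](reindex_esum _ _ _ _ b); apply: eq_esum => x _; rewrite ?funeposE ?funenegE.
Qed.

Let pos g x := Num.max (g x) 0.
Let neg g x := Num.max (- g x) 0.

Let posneg g x : g x = pos g x - neg g x.
Proof.
rewrite /pos /neg; case: (lerP 0 (g x)) => g0.
  by rewrite max_r ?subr0// oppr_le0.
by rewrite max_l ?opprK ?add0r// oppr_ge0 ltW.
Qed.

Let pos_ge0 g x : 0 <= pos g x. Proof. by rewrite le_max lexx orbT. Qed.
Let neg_ge0 g x : 0 <= neg g x. Proof. by rewrite le_max lexx orbT. Qed.

Let smb_pos g : smb g -> smb (pos g).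
Proof.
move=> sg; apply: (smb_le ((smb_abs g).2 sg)) => x; rewrite ger0_norm//.
by rewrite ge_max ler_norm normr_ge0.
Qed.

Let smb_neg g : smb g -> smb (neg g).
Proof.
move=> sg; apply: (smb_le ((smb_abs g).2 sg)) => x; rewrite ger0_norm//.
by rewrite ge_max normr_ge0 andbT -normrN ler_norm.
Qed.

Let lsumE g : smb g -> lsum g = lsum (pos g) - lsum (neg g).
Proof.
move=> sg; rewrite -ge0_lsumB//; [|exact: smb_pos|exact: smb_neg].
by congr lsum; apply: funext => x; exact: posneg.
Qed.

(** Positive parts are not additive, so both summands are first written as differences of
    nonnegative families and regrouped. *)
Lemma lsumD g h : smb g -> smb h -> lsum (fun x => g x + h x) = lsum g + lsum h.
Proof.
move=> sg sh.
have -> : (fun x => g x + h x) =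
    (fun x => (pos g x + pos h x) - (neg g x + neg h x)).
  by apply: funext => x; rewrite (posneg g) (posneg h) addrACA opprD.
rewrite ge0_lsumB; last 4 first.
- by move=> x; rewrite addr_ge0.
- by move=> x; rewrite addr_ge0.
- by apply: smbD; exact: smb_pos.
- by apply: smbD; exact: smb_neg.
have sgp := smb_pos sg; have sgn := smb_neg sg.
have shp := smb_pos sh; have shn := smb_neg sh.
rewrite (ge0_lsumD (@pos_ge0 g) (@pos_ge0 h) sgp shp).
rewrite (ge0_lsumD (@neg_ge0 g) (@neg_ge0 h) sgn shn).
by rewrite (lsumE sg) (lsumE sh) addrACA opprD.
Qed.

Lemma lsumN g : smb g -> lsum (fun x => - g x) = - lsum g.
Proof.
move=> sg; rewrite (lsumE sg) opprB -ge0_lsumB//; [|exact: smb_neg|exact: smb_pos].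
by congr lsum; apply: funext => x; rewrite {1}posneg opprB.
Qed.

Lemma lsumB g h : smb g -> smb h -> lsum (fun x => g x - h x) = lsum g - lsum h.
Proof. by move=> sg sh; rewrite lsumD ?lsumN//; exact: smbN. Qed.

Lemma lsum_ge0 g : (forall x, 0 <= g x) -> 0 <= lsum g.
Proof.
by move=> g0; rewrite ge0_lsum//; apply/fine_ge0/esum_ge0 => x _; rewrite lee_fin.
Qed.

Lemma ler_lsum g h : smb g -> smb h -> (forall x, g x <= h x) -> lsum g <= lsum h.
Proof.
move=> sg sh gh; rewrite -subr_ge0 -lsumB//; apply: lsum_ge0 => x.
by rewrite subr_ge0.
Qed.

Lemma sum_le_lsum (s : seq L) g : (forall x, 0 <= g x) -> smb g -> uniq s ->
  \sum_(x <- s) g x <= lsum g.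
Proof.
move=> g0 sg us; rewrite ge0_lsum// -lee_fin fineK ?smb_esum// -sumEFin.
apply: esum_ge; exists [set` s]; first by split => //; exact: finite_seq.
by rewrite fsbig_seq.
Qed.

Lemma term_le_lsum g x : (forall x, 0 <= g x) -> smb g -> g x <= lsum g.
Proof. by move=> g0 sg; have := sum_le_lsum g0 sg (s := [:: x]); rewrite big_seq1; exact. Qed.

Lemma lsum_le (M : R) g : (forall x, 0 <= g x) ->
  (forall s : seq L, uniq s -> \sum_(x <- s) g x <= M) -> smb g /\ lsum g <= M.
Proof.
move=> g0 gM; have sg : smb g.
  by apply/smb_bound; exists M => s us; under eq_bigr do rewrite ger0_norm//; exact: gM.
split=> //; rewrite ge0_lsum// -lee_fin fineK ?smb_esum//.
apply: ge_ereal_sup => _ /= [X [finX _] <-].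
rewrite fsbig_finite//= sumEFin lee_fin.
exact: (gM (enum_fset (fset_set X)) (fset_uniq _)).
Qed.

Lemma lsum0 : lsum (fun _ : L => 0 : R) = 0.
Proof.
have := @lsumD (fun=> 0) (fun=> 0) smb0 smb0.
under eq_fun do rewrite addr0.
by move=> /esym/eqP; rewrite -subr_eq0 addrK => /eqP.
Qed.

Lemma lsum_finsupp (s : seq L) g : uniq s -> (forall x, x \notin s -> g x = 0) ->
  lsum g = \sum_(x <- s) g x.
Proof.
move=> us g0; have sg : smb g by exact: smb_finsupp g0.
suff H h : (forall x, 0 <= h x) -> (forall x, x \notin s -> h x = 0) ->
    lsum h = \sum_(x <- s) h x.
  rewrite (lsumE sg) !H//; last 2 first.
  - by move=> x xs; rewrite /neg g0// oppr0 maxxx.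
  - by move=> x xs; rewrite /pos g0// maxxx.
  by rewrite -sumrB; apply: eq_bigr => x _; rewrite -posneg.
move=> h0 hs; have sh : smb h by exact: smb_finsupp hs.
apply/eqP; rewrite eq_le sum_le_lsum// andbT.
apply: (lsum_le h0 _).2 => r ur.
rewrite (bigID (mem s))/= [X in _ + X]big1 ?addr0//.
rewrite -big_filter [leRHS](bigID (mem r))/= -[leLHS]addr0.
apply: lerD; last exact: sumr_ge0.
rewrite -[leRHS]big_filter le_eqVlt; apply/orP; left; apply/eqP.
apply: perm_big; apply: uniq_perm; rewrite ?filter_uniq//.
by move=> x; rewrite !mem_filter andbC.
Qed.

Lemma lsumZ (a : R) g : smb g -> lsum (fun x => a * g x) = a * lsum g.
Proof.
suff H b h : 0 <= b -> (forall x, 0 <= h x) -> smb h ->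
    lsum (fun x => b * h x) = b * lsum h.
  have P b : 0 <= b -> smb g -> lsum (fun x => b * g x) = b * lsum g.
    move=> b0 sg; rewrite (lsumE sg) mulrBr -!H//; [|exact: smb_neg|exact: smb_pos].
    rewrite -lsumB; [|exact/smbZ/smb_pos|exact/smbZ/smb_neg].
    by congr lsum; apply: funext => x; rewrite {1}posneg mulrBr.
  move=> sg; have [a0|a0] := leP 0 a; first exact: P.
  have := P (- a); rewrite oppr_ge0 ltW// => /(_ isT sg).
  under eq_fun do rewrite mulNr.
  by rewrite lsumN; [rewrite mulNr => /oppr_inj|exact: smbZ].
(* One inequality suffices: the reverse one is the same statement for [b^-1] and the family b h. *)
have le b' h' : 0 <= b' -> (forall x, 0 <= h' x) -> smb h' ->
    lsum (fun x => b' * h' x) <= b' * lsum h'.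
  move=> b0 h0 sh; apply: (lsum_le _ _).2 => [x|s us]; first exact: mulr_ge0.
  by rewrite -mulr_sumr ler_wpM2l//; exact: sum_le_lsum.
move=> b0 h0 sh; apply/eqP; rewrite eq_le le//=.
have [->|bn0] := eqVneq b 0.
  by rewrite mul0r; apply: lsum_ge0 => x; rewrite mul0r.
have bp : 0 < b by rewrite lt_def bn0.
have := le b^-1 (fun x => b * h x); rewrite invr_ge0 => /(_ b0).
under [X in lsum X <= _]eq_fun do rewrite mulKf//.
by rewrite ler_pdivlMl//; apply; [move=> x; exact: mulr_ge0|exact: smbZ].
Qed.

Lemma lsum_sum (I : Type) (r : seq I) (P : pred I) (G : I -> L -> R) :
  (forall i, P i -> smb (G i)) ->
  lsum (fun x => \sum_(i <- r | P i) G i x) = \sum_(i <- r | P i) lsum (G i).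
Proof.
move=> sG; elim: r => [|i r IH].
  rewrite big_nil -[RHS]lsum0; congr lsum.
  by apply: funext => x; rewrite big_nil.
have -> : (fun x => \sum_(j <- i :: r | P j) G j x) = (fun x =>
    if P i then G i x + \sum_(j <- r | P j) G j x else \sum_(j <- r | P j) G j x).
  by apply: funext => x; rewrite big_cons.
rewrite big_cons; case: (P i) (sG i) => // /(_ isT) sGi.
by rewrite lsumD ?IH//; exact: smb_sum.
Qed.

End lattice_sums.

Section hilbert.
Variables (R : realType) (d : nat).
Local Notation L := 'rV[int]_d.
Implicit Types (psi phi g : L -> R).

Lemma l2P psi : l2 psi <-> smb (fun n => psi n ^+ 2).
Proof. by []. Qed.

Lemma smbM psi phi : l2 psi -> l2 phi -> smb (fun n => psi n * phi n).
Proof.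
move=> /l2P spsi /l2P sphi; apply: smb_le (smbD spsi sphi) _ => n.
by rewrite ler_norml; apply/andP; split; nra.
Qed.

Lemma l2_le psi phi : l2 phi -> (forall n, `|psi n| <= `|phi n|) -> l2 psi.
Proof.
move=> /l2P sphi le; apply/l2P; apply: smb_le sphi _ => n.
by rewrite normrX -[leRHS]real_normK ?num_real// lerXn2r ?nnegrE.
Qed.

Lemma l2D psi phi : l2 psi -> l2 phi -> l2 (fun n => psi n + phi n).
Proof.
move=> spsi sphi; apply/l2P.
have := smbD (smbD (spsi : smb _) (sphi : smb _)) (smbZ 2 (smbM spsi sphi)).
by congr smb; apply: funext => n; ring.
Qed.

Lemma l2Z (a : R) psi : l2 psi -> l2 (fun n => a * psi n).
Proof.
move=> spsi; have := smbZ (a ^+ 2) (spsi : smb _).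
by congr smb; apply: funext => n; ring.
Qed.

Lemma l2B psi phi : l2 psi -> l2 phi -> l2 (fun n => psi n - phi n).
Proof.
move=> spsi sphi; have := l2D spsi (l2Z (-1) sphi).
by congr l2; apply: funext => n; ring.
Qed.

Lemma l2_0 : l2 (fun _ : L => 0 : R).
Proof.
apply/l2P; rewrite (_ : (fun _ => _) = fun=> 0); first exact: smb0.
by apply: funext => n; rewrite expr0n.
Qed.

Lemma l2_sum (I : Type) (r : seq I) (P : pred I) (G : I -> L -> R) :
  (forall i, P i -> l2 (G i)) -> l2 (fun x => \sum_(i <- r | P i) G i x).
Proof.
move=> sG; elim: r => [|i r IH].
  suff -> : (fun x => \sum_(j <- [::] | P j) G j x) = fun=> 0 by exact: l2_0.
  by apply: funext => x; rewrite big_nil.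
have -> : (fun x => \sum_(j <- i :: r | P j) G j x) = (fun x =>
    if P i then G i x + \sum_(j <- r | P j) G j x else \sum_(j <- r | P j) G j x).
  by apply: funext => x; rewrite big_cons.
by case: (P i) (sG i) => // sGi; apply: l2D => //; exact: sGi.
Qed.

Lemma l2_shift (v : L) psi : l2 psi -> l2 (fun n => psi (n + v)).
Proof. exact: (@smb_shift _ _ v (fun n => psi n ^+ 2)). Qed.

Lemma l2_finsupp (s : seq L) psi : (forall n, n \notin s -> psi n = 0) -> l2 psi.
Proof.
by move=> s0; apply/l2P/(@smb_finsupp _ _ s) => n /s0 ->; rewrite expr0n.
Qed.

Lemma l2_fin (M : R) psi :
  (forall s : seq L, uniq s -> \sum_(x <- s) psi x ^+ 2 <= M) -> l2 psi.
Proof. by move=> H; apply: (lsum_le _ H).1 => x; exact: sqr_ge0. Qed.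

(** The factor [eps ^+ d] of [l2_dot] is dropped: it multiplies both sides of every form inequality
    and matters only in the resolvent bound, where [l2_normE] restores it. *)
Definition dot psi phi : R := lsum (fun n => psi n * phi n).

Lemma dotC psi phi : dot psi phi = dot phi psi.
Proof. by congr lsum; apply: funext => n; rewrite mulrC. Qed.

Lemma dotDl psi1 psi2 phi : l2 psi1 -> l2 psi2 -> l2 phi ->
  dot (fun n => psi1 n + psi2 n) phi = dot psi1 phi + dot psi2 phi.
Proof.
move=> h1 h2 h; rewrite /dot -lsumD; [|exact: smbM|exact: smbM].
by congr lsum; apply: funext => n; rewrite mulrDl.
Qed.

Lemma dotZl a psi phi : l2 psi -> l2 phi ->
  dot (fun n => a * psi n) phi = a * dot psi phi.
Proof.
move=> h1 h; rewrite /dot -lsumZ; last exact: smbM.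
by congr lsum; apply: funext => n; rewrite mulrA.
Qed.

Lemma dotBl psi1 psi2 phi : l2 psi1 -> l2 psi2 -> l2 phi ->
  dot (fun n => psi1 n - psi2 n) phi = dot psi1 phi - dot psi2 phi.
Proof.
move=> h1 h2 h; rewrite /dot -lsumB; [|exact: smbM|exact: smbM].
by congr lsum; apply: funext => n; rewrite mulrBl.
Qed.

Lemma dot_suml (I : Type) (r : seq I) (P : pred I) (G : I -> L -> R) phi :
  (forall i, P i -> l2 (G i)) -> l2 phi ->
  dot (fun n => \sum_(i <- r | P i) G i n) phi = \sum_(i <- r | P i) dot (G i) phi.
Proof.
move=> sG sphi; rewrite /dot -lsum_sum; last by move=> i Pi; apply: smbM => //; exact: sG.
by congr lsum; apply: funext => n; rewrite mulr_suml.
Qed.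

Lemma dotDr psi1 psi2 phi : l2 psi1 -> l2 psi2 -> l2 phi ->
  dot phi (fun n => psi1 n + psi2 n) = dot phi psi1 + dot phi psi2.
Proof. by move=> *; rewrite dotC dotDl// !(dotC phi). Qed.

Lemma dotZr a psi phi : l2 psi -> l2 phi ->
  dot phi (fun n => a * psi n) = a * dot phi psi.
Proof. by move=> *; rewrite dotC dotZl// (dotC phi). Qed.

Lemma dotBr psi1 psi2 phi : l2 psi1 -> l2 psi2 -> l2 phi ->
  dot phi (fun n => psi1 n - psi2 n) = dot phi psi1 - dot phi psi2.
Proof. by move=> *; rewrite dotC dotBl// !(dotC phi). Qed.

Lemma dot_sumr (I : Type) (r : seq I) (P : pred I) (G : I -> L -> R) phi :
  (forall i, P i -> l2 (G i)) -> l2 phi ->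
  dot phi (fun n => \sum_(i <- r | P i) G i n) = \sum_(i <- r | P i) dot phi (G i).
Proof.
move=> sG sphi; rewrite dotC dot_suml//.
by apply: eq_bigr => i _; rewrite dotC.
Qed.

Definition nrm2 psi : R := dot psi psi.

Lemma nrm2_ge0 psi : 0 <= nrm2 psi.
Proof. by apply: lsum_ge0 => n; rewrite -expr2 sqr_ge0. Qed.

Lemma sqr_le_nrm2 psi n : l2 psi -> psi n ^+ 2 <= nrm2 psi.
Proof.
move=> spsi; have := @term_le_lsum _ _ (fun n => psi n * psi n) n.
by rewrite -expr2; apply => [x|]; [rewrite -expr2 sqr_ge0|exact: smbM].
Qed.

Lemma nrm2_eq0 psi : l2 psi -> nrm2 psi <= 0 -> forall n, psi n = 0.
Proof.
move=> spsi le0 n; apply/eqP; rewrite -sqrf_eq0 eq_le sqr_ge0 andbT.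
exact: le_trans (sqr_le_nrm2 n spsi) le0.
Qed.

Lemma nrm2Z a psi : l2 psi -> nrm2 (fun n => a * psi n) = a ^+ 2 * nrm2 psi.
Proof.
by move=> s; rewrite /nrm2 dotZl ?dotZr// ?expr2 ?mulrA//; exact: l2Z.
Qed.

Lemma cauchy_schwarz psi phi : l2 psi -> l2 phi ->
  dot psi phi ^+ 2 <= nrm2 psi * nrm2 phi.
Proof.
move=> spsi sphi; have [n0|np] := leP (nrm2 phi) 0.
  suff -> : dot psi phi = 0 by rewrite expr0n mulr_ge0 ?nrm2_ge0.
  rewrite /dot (_ : (fun n => _) = fun=> 0) ?lsum0//.
  by apply: funext => n; rewrite (nrm2_eq0 sphi n0) mulr0.
set D := dot psi phi.
have := nrm2_ge0 (fun n => nrm2 phi * psi n - D * phi n).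
have s1 := l2Z (nrm2 phi) spsi; have s2 := l2Z D sphi.
rewrite {1}/nrm2 dotBl//; last exact: l2B.
rewrite !dotBr// !dotZl// !dotZr// (dotC phi psi) -/D -/(nrm2 psi) -/(nrm2 phi).
by nra.
Qed.

Lemma sqr_sum_le (I : finType) (a : I -> R) :
  (\sum_i a i) ^+ 2 <= #|I|%:R * \sum_i a i ^+ 2.
Proof.
have : 0 <= \sum_i \sum_j (a i - a j) ^+ 2.
  by apply: sumr_ge0 => i _; apply: sumr_ge0 => j _; exact: sqr_ge0.
suff -> : \sum_i \sum_j (a i - a j) ^+ 2 =
    2 * (#|I|%:R * \sum_i a i ^+ 2 - (\sum_i a i) ^+ 2).
  by rewrite pmulr_rge0// subr_ge0.
transitivity (\sum_i (#|I|%:R * a i ^+ 2 + \sum_j a j ^+ 2 - 2 * (a i * \sum_j a j))).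
  apply: eq_bigr => i _.
  transitivity (\sum_j (a i ^+ 2 + (a j ^+ 2 - 2 * (a i * a j)))).
    by apply: eq_bigr => j _; ring.
  by rewrite big_split/= sumr_const sumrB -addrA mulr_natl -!mulr_sumr.
rewrite sumrB big_split/= sumr_const -!mulr_sumr -mulr_suml -mulr_natl.
by rewrite expr2; ring.
Qed.

Lemma nrm2_sum (I : finType) (G : I -> L -> R) : (forall i, l2 (G i)) ->
  nrm2 (fun n => \sum_i G i n) <= #|I|%:R * \sum_i nrm2 (G i).
Proof.
move=> sG; rewrite /nrm2 /dot -lsum_sum; last by move=> i _; exact: smbM.
have s : smb (fun n => \sum_i G i n * G i n).
  by apply: smb_sum => i _; exact: smbM.
rewrite -lsumZ//; apply: ler_lsum; [|exact: smbZ|move=> n].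
  by apply: smbM; exact: l2_sum.
by rewrite -expr2; exact: sqr_sum_le.
Qed.

End hilbert.

(** * Discrete Schroedinger operators and their low-lying spectrum *)

Lemma cvg_sumr (R : realType) (T I : Type) (F : set_system T) (FF : Filter F)
    (r : seq I) (u : I -> T -> R) (l : I -> R) :
  (forall i, u i @ F --> l i) ->
  (fun x => \sum_(i <- r) u i x) @ F --> \sum_(i <- r) l i.
Proof. by move=> ul; apply: cvg_big => //; exact: add_continuous. Qed.

Section schrodinger.
Variables (R : realType) (d : nat).
Local Notation L := 'rV[int]_d.
Local Notation e := (basis_vec int).
Implicit Types (W psi phi g : L -> R).

Definition adj psi (n : L) : R := \sum_k (psi (n + e k) + psi (n - e k)).

(** The diagonal 2 d of the Laplacian is absorbed in [W], which leaves the positivity preserving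
    operator [adj] with a minus sign. *)
Definition schr W psi (n : L) : R := W n * psi n - adj psi n.

Definition schr_dom W : set (L -> R) :=
  [set psi | l2 psi /\ l2 (fun n => W n * psi n)].

Lemma l2_adj psi : l2 psi -> l2 (adj psi).
Proof. by move=> s; apply: l2_sum => k _; apply: l2D; exact: l2_shift. Qed.

Lemma l2_schr W psi : schr_dom W psi -> l2 (schr W psi).
Proof. by move=> [s1 s2]; apply: l2B => //; exact: l2_adj. Qed.

Lemma schr_domD W psi phi : schr_dom W psi -> schr_dom W phi ->
  schr_dom W (fun n => psi n + phi n).
Proof.
move=> [s1 s2] [s3 s4]; split; first exact: l2D.
by have := l2D s2 s4; congr l2; apply: funext => n; ring.
Qed.

Lemma schr_domZ W a psi : schr_dom W psi -> schr_dom W (fun n => a * psi n).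
Proof.
move=> [s1 s2]; split; first exact: l2Z.
by have := l2Z a s2; congr l2; apply: funext => n; ring.
Qed.

Lemma schr_domB W psi phi : schr_dom W psi -> schr_dom W phi ->
  schr_dom W (fun n => psi n - phi n).
Proof.
move=> h1 h2; have := schr_domD h1 (schr_domZ (-1) h2).
by congr schr_dom; apply: funext => n; ring.
Qed.

Lemma schr_dom_sum W (I : Type) (r : seq I) (P : pred I) (G : I -> L -> R) :
  (forall i, P i -> schr_dom W (G i)) ->
  schr_dom W (fun x => \sum_(i <- r | P i) G i x).
Proof.
move=> sG; split; first by apply: l2_sum => i /sG [].
suff -> : (fun n => W n * \sum_(i <- r | P i) G i n) =
    (fun n => \sum_(i <- r | P i) W n * G i n).
  by apply: (@l2_sum _ _ _ _ _ (fun i n => W n * G i n)) => i /sG [].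
by apply: funext => n; rewrite mulr_sumr.
Qed.

Lemma schr_dom_finsupp W (s : seq L) psi :
  (forall n, n \notin s -> psi n = 0) -> schr_dom W psi.
Proof.
move=> s0; split; first exact: l2_finsupp s0.
by apply: (@l2_finsupp _ _ s) => n /s0 ->; rewrite mulr0.
Qed.

Lemma adjD psi phi n : adj (fun n => psi n + phi n) n = adj psi n + adj phi n.
Proof. by rewrite /adj -big_split/=; apply: eq_bigr => k _; ring. Qed.

Lemma adjZ a psi n : adj (fun n => a * psi n) n = a * adj psi n.
Proof. by rewrite /adj mulr_sumr; apply: eq_bigr => k _; ring. Qed.

Lemma adj_sum (I : Type) (r : seq I) (P : pred I) (G : I -> L -> R) n :
  adj (fun x => \sum_(i <- r | P i) G i x) n = \sum_(i <- r | P i) adj (G i) n.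
Proof. by rewrite /adj exchange_big/=; apply: eq_bigr => k _; rewrite big_split. Qed.

Lemma schrD W psi phi n :
  schr W (fun n => psi n + phi n) n = schr W psi n + schr W phi n.
Proof. by rewrite /schr adjD; ring. Qed.

Lemma schrZ W a psi n : schr W (fun n => a * psi n) n = a * schr W psi n.
Proof. by rewrite /schr adjZ; ring. Qed.

Lemma schrB W psi phi n :
  schr W (fun n => psi n - phi n) n = schr W psi n - schr W phi n.
Proof.
have -> : (fun n => psi n - phi n) = (fun n => psi n + (-1) * phi n).
  by apply: funext => m; ring.
by rewrite schrD schrZ; ring.
Qed.

Lemma schr_sum W (I : Type) (r : seq I) (P : pred I) (G : I -> L -> R) n :
  schr W (fun x => \sum_(i <- r | P i) G i x) n =
  \sum_(i <- r | P i) schr W (G i) n.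
Proof. by rewrite /schr adj_sum mulr_sumr sumrB. Qed.

Lemma adj_sym psi phi : l2 psi -> l2 phi -> dot (adj psi) phi = dot psi (adj phi).
Proof.
move=> s1 s2.
rewrite dot_suml//; last by move=> k _; apply: l2D; exact: l2_shift.
rewrite dot_sumr//; last by move=> k _; apply: l2D; exact: l2_shift.
apply: eq_bigr => k _.
rewrite dotDl ?dotDr//; try exact: l2_shift.
rewrite addrC; congr (_ + _).
- rewrite /dot -(lsum_shift (e k)); congr lsum; apply: funext => n.
  by rewrite addrK.
- rewrite /dot -(lsum_shift (- e k)); congr lsum; apply: funext => n.
  by rewrite subrK.
Qed.

Lemma schr_sym W psi phi : schr_dom W psi -> schr_dom W phi ->
  dot (schr W psi) phi = dot psi (schr W phi).
Proof.
move=> [s1 s2] [s3 s4].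
rewrite dotBl//; last exact: l2_adj.
rewrite dotBr//; last exact: l2_adj.
rewrite adj_sym//; congr (_ - _); rewrite /dot; congr lsum.
by apply: funext => n; ring.
Qed.

Lemma dot_adj_le psi : l2 psi -> dot psi (adj psi) <= (2 * d)%:R * nrm2 psi.
Proof.
move=> s; rewrite dot_sumr//; last by move=> k _; apply: l2D; exact: l2_shift.
rewrite -[leLHS]mulr1 natrM.
have le k : dot psi (fun n => psi (n + e k) + psi (n - e k)) <= 2 * nrm2 psi.
  have sp := l2_shift (e k) s; have sm := l2_shift (- e k) s.
  rewrite /dot; apply: (@le_trans _ _ (lsum (fun n => psi n * psi n
    + 2^-1 * (psi (n + e k) * psi (n + e k)) + 2^-1 * (psi (n - e k) * psi (n - e k))))).
    apply: ler_lsum => [||n]; last first.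
    - have := sqr_ge0 (psi n - psi (n + e k)).
      by have := sqr_ge0 (psi n - psi (n - e k)); nra.
    - exact: smbD (smbD (smbM s s) (smbZ _ (smbM sp sp))) (smbZ _ (smbM sm sm)).
    - exact: smbM s (l2D sp sm).
  rewrite lsumD; [|exact: smbD (smbM s s) (smbZ _ (smbM sp sp))|exact: smbZ _ (smbM sm sm)].
  rewrite lsumD; [|exact: (smbM s s)|exact: smbZ _ (smbM sp sp)].
  rewrite lsumZ; last exact: (smbM sp sp).
  rewrite lsumZ; last exact: (smbM sm sm).
  rewrite (lsum_shift _ (fun n => psi n * psi n)).
  by rewrite (lsum_shift _ (fun n => psi n * psi n)) /nrm2 /dot; lra.
apply: (@le_trans _ _ (\sum_(k < d) 2 * nrm2 psi)).
  by rewrite mulr1; apply: ler_sum => k _; exact: le.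
by rewrite sumr_const card_ord -[_ *+ d]mulr_natl mulrA (mulrC d%:R).
Qed.

(** The bound on [W] is only asked on the support of psi, so that functions vanishing on a finite
    exceptional set are covered too. *)
Lemma schr_ge W c psi : schr_dom W psi -> (forall n, psi n != 0 -> (2 * d)%:R + c <= W n) ->
  c * nrm2 psi <= dot psi (schr W psi).
Proof.
move=> [s1 s2] Wc; rewrite dotBr//; last exact: l2_adj.
have := dot_adj_le s1.
suff : ((2 * d)%:R + c) * nrm2 psi <= dot psi (fun n => W n * psi n) by lra.
rewrite /nrm2 /dot -lsumZ; last exact: smbM.
apply: ler_lsum; [exact/smbZ/smbM|exact: smbM|move=> n].
have [->|n0] := eqVneq (psi n) 0; first by rewrite !mul0r mulr0.
rewrite [leRHS]mulrCA; apply: ler_wpM2r; first by rewrite -expr2 sqr_ge0.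
exact: Wc.
Qed.

(** * Inverting W - adj when W exceeds 2 d by a positive constant *)

Section neumann.
Variables (W : L -> R) (c : R).
Hypothesis c0 : 0 < c.
Hypothesis Wc : forall n, (2 * d)%:R + c <= W n.

Lemma coercive_bound psi : schr_dom W psi ->
  c ^+ 2 * nrm2 psi <= nrm2 (schr W psi).
Proof.
move=> s; have s1 := s.1; have := schr_ge s (fun n _ => Wc n).
have sA := l2_schr s.
have := cauchy_schwarz s1 sA; set D := dot _ _; set A := nrm2 (schr _ _).
have := nrm2_ge0 psi; set P := nrm2 psi => P0 DA cP.
have [P1|P1] := leP P 0.
  by apply: (@le_trans _ _ 0); [nra|exact: nrm2_ge0].
have cP0 : 0 <= c * P by rewrite mulr_ge0// ltW.
have : (c * P) ^+ 2 <= D ^+ 2.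
  by rewrite lerXn2r// nnegrE// (le_trans cP0).
by move=> h; rewrite -(ler_pM2l P1); nra.
Qed.

(** Fixed point iteration for W psi = g + adj psi. Started at 0 with g >= 0 it increases, because
    [adj] is monotone. *)
Let it g (m : nat) : L -> R := iter m (fun psi n => (W n)^-1 * (g n + adj psi n)) (fun=> 0).

Let W0 n : 0 < W n.
Proof. by apply: lt_le_trans (Wc n); rewrite ltr_wpDl. Qed.

Let itS g m n : W n * it g m.+1 n = g n + adj (it g m) n.
Proof. by rewrite /it iterS mulVKf// gt_eqF. Qed.

Let l2_it g m : l2 g -> l2 (it g m).
Proof.
move=> sg; elim: m => [|m IH]; first exact: l2_0.
have := l2Z c^-1 (l2D sg (l2_adj IH)).
move=> /l2_le; apply => n; rewrite /it iterS !normrM; apply: ler_wpM2r => //.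
have := W0 n => Wn; rewrite !gtr0_norm ?invr_gt0// lef_pV2 ?posrE//.
by apply: le_trans (Wc n); rewrite lerDr.
Qed.

Let it_mono g m n : (forall n, 0 <= g n) -> it g m n <= it g m.+1 n.
Proof.
move=> g0; elim: m n => [|m IH] n.
  rewrite /it /= mulr_ge0 ?invr_ge0 ?(ltW (W0 n))//.
  by rewrite addr_ge0//; apply: sumr_ge0.
rewrite -(ler_pM2l (W0 n)) !itS lerD2l.
by apply: ler_sum => k _; apply: lerD.
Qed.

Let it_ge0 g m n : (forall n, 0 <= g n) -> 0 <= it g m n.
Proof.
by move=> g0; elim: m => // m IH; apply: le_trans IH _; exact: it_mono.
Qed.

(** By monotonicity an iterate u is a subsolution, [schr W u] <= g pointwise. Testing with u >= 0
    turns coercivity into c |u|^2 <= <g, u>, a bound that does not depend on m. *)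
Let it_bound g m : (forall n, 0 <= g n) -> l2 g ->
  nrm2 (it g m) <= nrm2 g / c ^+ 2.
Proof.
move=> g0 sg; rewrite ler_pdivlMr ?exprn_gt0// mulrC.
case: m => [|m].
  by rewrite /nrm2 {1}/dot /it/= (_ : (fun n => _) = fun=> 0) ?lsum0 ?mulr0 ?nrm2_ge0//;
     apply: funext => n; rewrite mul0r.
set u := it g m.+1; have su : l2 u by exact: l2_it.
have sW : l2 (fun n => W n * u n).
  suff -> : (fun n => W n * u n) = (fun n => g n + adj (it g m) n).
    by apply: l2D => //; apply/l2_adj/l2_it.
  by apply: funext => n; exact: itS.
have h1 : c * nrm2 u <= dot g u.
  have := dot_adj_le su.
  have := schr_ge (conj su sW) (fun n _ => Wc n).
  suff : dot u (schr W u) <= dot g u by lra.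
  rewrite dotC; apply: ler_lsum => [||n].
  - by apply: smbM => //; apply: l2B => //; exact: l2_adj.
  - exact: smbM.
  - apply: ler_wpM2r; first exact: it_ge0.
    rewrite /schr itS -addrA -[leRHS]addr0 lerD2l subr_le0.
    by apply: ler_sum => k _; apply: lerD; exact: it_mono.
have := cauchy_schwarz sg su; have := nrm2_ge0 u; have := nrm2_ge0 g.
set P := nrm2 u in h1 *; set G := nrm2 g; set D := dot g u in h1 * => G0 P0 DA.
have [P1|P1] := leP P 0; first by nra.
have cP0 : 0 <= c * P by rewrite mulr_ge0// ltW.
have : (c * P) ^+ 2 <= D ^+ 2.
  by rewrite lerXn2r// nnegrE// (le_trans cP0).
by move=> h; rewrite -(ler_pM2l P1); nra.
Qed.

Let solve_ge0 g : (forall n, 0 <= g n) -> l2 g ->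
  exists2 psi, schr_dom W psi & forall n, schr W psi n = g n.
Proof.
move=> g0 sg; set B := nrm2 g / c ^+ 2.
have cv n : cvgn (fun m => it g m n).
  apply: nondecreasing_is_cvgn.
    by apply/nondecreasing_seqP => m; exact: it_mono.
  exists (1 + B) => _ [m _ <-].
  have := sqr_le_nrm2 n (l2_it m sg); have := it_bound m g0 sg.
  by have := it_ge0 m n g0; rewrite -/B; nra.
pose psi n := limn (fun m => it g m n).
have cpsi n : (fun m => it g m n) @ \oo --> psi n by exact: cv.
(* Fatou's argument: each finite sum of squares passes to the limit under the uniform bound B. *)
have spsi : l2 psi.
  apply: (@l2_fin _ _ B) => s us.
  have cs : (fun m => \sum_(x <- s) it g m x ^+ 2) @ \oo --> \sum_(x <- s) psi x ^+ 2.
    apply: cvg_sumr => x; rewrite expr2.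
    by under eq_fun do rewrite expr2; apply: cvgM.
  apply: (closed_cvg (fun y => y <= B) _ _ _ cs); first exact: closed_le.
  apply: nearW => m; apply: le_trans (it_bound m g0 sg).
  have := @sum_le_lsum _ _ s (fun n => it g m n * it g m n).
  under eq_bigr do rewrite -expr2.
  apply => //; first by move=> x; rewrite -expr2 sqr_ge0.
  by apply: smbM; exact: l2_it.
have eq n : W n * psi n = g n + adj psi n.
  have c1 : (fun m => W n * it g m.+1 n) @ \oo --> W n * psi n.
    by apply: cvgMr; rewrite (cvg_shiftS (fun m => it g m n)); exact: cpsi.
  have c2 : (fun m => g n + adj (it g m) n) @ \oo --> g n + adj psi n.
    apply: cvgD; first exact: cvg_cst.
    by apply: cvg_sumr => k; apply: cvgD; exact: cpsi.
  have e12 : (fun m => W n * it g m.+1 n) = (fun m => g n + adj (it g m) n).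
    by apply: funext => m; exact: itS.
  rewrite e12 in c1.
  exact: (cvg_unique _ c1 c2).
exists psi; last by move=> n; rewrite /schr eq addrK.
split=> //; suff -> : (fun n => W n * psi n) = (fun n => g n + adj psi n).
  by apply: l2D => //; exact: l2_adj.
by apply: funext => n; exact: eq.
Qed.

(** The monotone iteration needs a nonnegative right-hand side, hence the splitting of g into its
    positive and negative parts. *)
Lemma coercive_solve g : l2 g ->
  exists2 psi, schr_dom W psi & forall n, schr W psi n = g n.
Proof.
move=> sg.
have [||p sp ep] := @solve_ge0 (fun n => Num.max (g n) 0).
- by move=> n; rewrite le_max lexx orbT.
- apply: (l2_le sg) => n; rewrite ger0_norm ?le_max ?lexx ?orbT//.
  by rewrite ge_max ler_norm normr_ge0.
have [||q sq eq] := @solve_ge0 (fun n => Num.max (- g n) 0).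
- by move=> n; rewrite le_max lexx orbT.
- apply: (l2_le sg) => n; rewrite ger0_norm ?le_max ?lexx ?orbT//.
  by rewrite ge_max normr_ge0 andbT -normrN ler_norm.
exists (fun n => p n - q n); first exact: schr_domB.
move=> n; rewrite schrB ep eq; case: (lerP 0 (g n)) => g0.
  by rewrite max_r ?subr0// oppr_le0.
by rewrite max_l ?opprK ?add0r// oppr_ge0 ltW.
Qed.

End neumann.

End schrodinger.

(** * Finite-rank perturbations of a coercive operator *)

Lemma kernel_comb (F : fieldType) (k p : nat) (M : 'M[F]_(k, p)) : (p < k)%N ->
  exists2 c : 'rV[F]_k, c != 0 & c *m M = 0.
Proof.
move=> pk; have : kermx M != 0.
  rewrite kermx_eq0 /row_free; apply: contraL pk => /eqP <-.
  by rewrite -leqNgt rank_leq_col.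
move=> nz; exists (nz_row (kermx M)); first by rewrite nz_row_eq0.
by apply/sub_kermxP; exact: nz_row_sub.
Qed.

Lemma unitmx_of_ker0 (F : fieldType) (k : nat) (M : 'M[F]_k) :
  (forall x : 'rV[F]_k, x *m M = 0 -> x = 0) -> M \in unitmx.
Proof.
move=> H; rewrite -row_free_unit -kermx_eq0; apply/rowV0P => v /sub_kermxP.
exact: H.
Qed.

Section finite_rank.
Variables (R : realType) (d : nat).
Local Notation L := 'rV[int]_d.
Implicit Types (W psi phi g : L -> R).

Variables (W : L -> R) (c : R).
Hypothesis c0 : 0 < c.
Hypothesis Wc : forall n, (2 * d)%:R + c <= W n.
Variables (p : nat) (b : 'I_p -> L -> R) (kap : 'I_p -> R).
Hypothesis l2b : forall i, l2 (b i).

Definition rank_pert psi n : R :=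
  schr W psi n - \sum_i kap i * dot (b i) psi * b i n.

Hypothesis inj : forall psi, schr_dom W psi ->
  (forall n, rank_pert psi n = 0) -> forall n, psi n = 0.

(** Let a_i and h solve the unperturbed equation with right-hand sides b_i and g. The ansatz h +
    sum_i x_i a_i reduces the problem to the matrix equation x (1 - P) = y, and injectivity of the
    perturbed operator makes 1 - P invertible. The norm bound follows since x depends linearly on h
    through finitely many scalar products. *)
Lemma rank_pert_solve : exists M : R, forall g, l2 g ->
  exists psi, [/\ schr_dom W psi, forall n, rank_pert psi n = g n &
    nrm2 psi <= M * nrm2 g].
Proof.
have /choice [a Ha] : forall i, exists psi, schr_dom W psi /\
    forall n, schr W psi n = b i n.
  by move=> i; have [psi] := coercive_solve c0 Wc (l2b i); exists psi.
have l2a i : l2 (a i) by have [[]] := Ha i.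
pose P := \matrix_(i, j) (kap j * dot (b j) (a i)).
have comb (x : 'rV[R]_p) h : schr_dom W h ->
    (forall j, x 0 j = kap j * dot (b j) h + (x *m P) 0 j) ->
    schr_dom W (fun n => h n + \sum_i x 0 i * a i n) /\
    forall n, rank_pert (fun n => h n + \sum_i x 0 i * a i n) n = schr W h n.
  move=> sh xE.
  have sa : schr_dom W (fun n => \sum_i x 0 i * a i n).
    by apply: schr_dom_sum => i _; apply: schr_domZ; have [] := Ha i.
  split; first exact: schr_domD.
  have Lsum i : kap i * dot (b i) (fun n => h n + \sum_i x 0 i * a i n) = x 0 i.
    rewrite dotDr//; [|exact: sh.1|exact: sa.1].
    rewrite dot_sumr//; last by move=> j _; exact: l2Z.
    rewrite mulrDr xE mxE; congr (_ + _); rewrite mulr_sumr.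
    by apply: eq_bigr => j _; rewrite mxE dotZr//; ring.
  move=> n; rewrite /rank_pert schrD schr_sum.
  under [X in _ - X]eq_bigr do rewrite Lsum.
  rewrite -addrA -sumrB big1 ?addr0// => i _.
  by rewrite schrZ (Ha i).2 subrr.
have ua : (1%:M - P) \in unitmx.
  apply: unitmx_of_ker0 => x; rewrite mulmxBr mulmx1 => /eqP.
  rewrite subr_eq0 => /eqP xP.
  have z0 : schr_dom W (fun _ : L => 0 : R).
    by apply: (@schr_dom_finsupp _ _ _ [::]).
  have [|s e] := comb x (fun _ => 0) z0.
    by move=> j; rewrite -xP dotC /dot (_ : (fun n => _) = fun=> 0) ?lsum0 ?mulr0 ?add0r//;
      apply: funext => n; rewrite mul0r.
  have sch0 n : schr W (fun _ : L => 0 : R) n = 0.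
    by rewrite /schr /adj big1 ?mulr0 ?subr0// => k _; rewrite addr0.
  have v0 := inj s (fun n => etrans (e n) (sch0 n)).
  apply/rowP => i; rewrite mxE.
  have -> : x 0 i = kap i * dot (b i) (fun n => 0 + \sum_i x 0 i * a i n).
    have -> : (fun n => 0 + \sum_i x 0 i * a i n) = (fun n => \sum_i x 0 i * a i n).
      by apply: funext => n; rewrite add0r.
    rewrite dot_sumr//; last by move=> j _; exact: l2Z.
    rewrite {1}xP mxE mulr_sumr.
    by apply: eq_bigr => j _; rewrite mxE dotZr//; ring.
  rewrite /dot (_ : (fun n => _) = fun=> 0) ?lsum0 ?mulr0//.
  by apply: funext => n; rewrite v0 mulr0.
pose B := invmx (1%:M - P).
pose Mi i := p%:R * \sum_j B j i ^+ 2 * (kap j ^+ 2 * nrm2 (b j)).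
pose M := 2 * (c ^- 2 + p%:R * \sum_i Mi i * c ^- 2 * nrm2 (a i)).
exists M => g sg; have [h sh eh] := coercive_solve c0 Wc sg.
pose y : 'rV[R]_p := \row_j (kap j * dot (b j) h).
pose x := y *m B.
have hb : nrm2 h <= c ^- 2 * nrm2 g.
  rewrite mulrC ler_pdivlMr ?exprn_gt0// mulrC.
  have := coercive_bound c0 Wc sh; congr (_ <= nrm2 _).
  by apply: funext => n; exact: eh.
have [|s e] := comb x h sh.
  move=> j; have : x *m (1%:M - P) = y by rewrite -mulmxA mulVmx// mulmx1.
  rewrite mulmxBr mulmx1 => /eqP; rewrite subr_eq => /eqP {1}->.
  by rewrite mxE mxE.
exists (fun n => h n + \sum_i x 0 i * a i n); split => // [n|].
  by rewrite e eh.
have xb i : x 0 i ^+ 2 <= Mi i * nrm2 h.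
  rewrite mxE; apply: le_trans (sqr_sum_le _) _.
  rewrite card_ord -mulrA ler_wpM2l// mulr_suml; apply: ler_sum => j _.
  rewrite mxE; have := cauchy_schwarz (l2b j) sh.1.
  set D := dot _ _; set N := nrm2 h; set N' := nrm2 (b j) => DN.
  have -> : (kap j * D * B j i) ^+ 2 = (B j i ^+ 2 * kap j ^+ 2) * D ^+ 2 by ring.
  have -> : B j i ^+ 2 * (kap j ^+ 2 * N') * N = (B j i ^+ 2 * kap j ^+ 2) * (N' * N).
    by ring.
  by apply: ler_wpM2l => //; rewrite mulr_ge0 ?sqr_ge0.
have l2s : l2 (fun n => \sum_i x 0 i * a i n).
  by apply: l2_sum => i _; exact: l2Z.
apply: (@le_trans _ _ (2 * (nrm2 h + nrm2 (fun n => \sum_i x 0 i * a i n)))).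
  have := nrm2_ge0 (fun n => h n - \sum_i x 0 i * a i n).
  rewrite /nrm2 dotBl ?dotDl//; try solve [exact: sh.1|exact: l2B sh.1 l2s|exact: l2D sh.1 l2s].
  by rewrite !dotBr ?dotDr//; try exact: sh.1; lra.
rewrite -mulrA ler_wpM2l// mulrDl lerD//.
apply: le_trans (nrm2_sum _) _; first by move=> i; exact: l2Z.
rewrite card_ord -mulrA ler_wpM2l// mulr_suml; apply: ler_sum => i _.
rewrite nrm2Z//; have := xb i.
have Mi0 : 0 <= Mi i.
  apply: mulr_ge0 => //; apply: sumr_ge0 => j _.
  by rewrite mulr_ge0 ?sqr_ge0// mulr_ge0 ?sqr_ge0 ?nrm2_ge0.
move=> h1; have -> : Mi i / c ^+ 2 * nrm2 (a i) * nrm2 g =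
   Mi i * (c ^- 2 * nrm2 g) * nrm2 (a i) by ring.
apply: ler_wpM2r; first exact: nrm2_ge0.
by apply: le_trans h1 _; exact: ler_wpM2l.
Qed.

End finite_rank.

(** * Spectrum below c when W is at least 2 d + c off a finite set *)

Section spectral_alternative.
Variables (R : realType) (d : nat).
Local Notation L := 'rV[int]_d.
Implicit Types (psi phi g : L -> R) (lam : R).

Variables (W : L -> R) (c : R) (F : seq L).
Hypothesis uniqF : uniq F.
Hypothesis WF : forall n, n \notin F -> (2 * d)%:R + c <= W n.

Definition schr_op : operator R d := Operator (schr_dom W) (schr W).

Lemma schr_eigenspaceP lam psi : Defs.eigenspace schr_op lam psi <->
  schr_dom W psi /\ forall n, schr W psi n = lam * psi n.
Proof.
by split => -[h1 h2]; split => //; [move=> n; rewrite [schr W psi]h2|apply: funext => n; rewrite [LHS]h2].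
Qed.

Lemma dot_dirac (x : L) psi : dot (fun n => (n == x)%:R) psi = psi x.
Proof.
rewrite /dot (@lsum_finsupp _ _ [:: x])//; last first.
  by move=> n; rewrite inE => /negbTE ->; rewrite mul0r.
by rewrite big_seq1 eqxx mul1r.
Qed.

(** With an empty family this is H - lam. A family of eigenvectors [v] allows them to be penalized
    when the next eigenvector is sought. *)
Definition spec_pert lam (m : nat) (v : 'I_m -> L -> R) (k : R) psi n : R :=
  schr W psi n - lam * psi n + k * \sum_j dot (v j) psi * v j n.

(** Raising [W] to 2 d + c on [F] and subtracting lam gives an operator coercive with constant c -
    lam. What was added is a combination of Dirac projections at the points of [F]; together with
    the terms in [v] it forms a perturbation of rank at most size F + m. *)
Lemma spec_pert_solve lam (m : nat) (v : 'I_m -> L -> R) (k : R) :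
  lam < c -> (forall j, l2 (v j)) ->
  (forall psi, schr_dom W psi -> (forall n, spec_pert lam v k psi n = 0) ->
     forall n, psi n = 0) ->
  exists M : R, forall g, l2 g -> exists psi, [/\ schr_dom W psi,
    forall n, spec_pert lam v k psi n = g n & nrm2 psi <= M * nrm2 g].
Proof.
move=> lamc l2v inj.
pose W' (n : L) := if n \in F then (2 * d)%:R + (c - lam) else W n - lam.
have W'c n : (2 * d)%:R + (c - lam) <= W' n.
  by rewrite /W'; case: ifPn => // /WF; lra.
have c'0 : 0 < c - lam by rewrite subr_gt0.
pose b (i : 'I_(size F + m)) : L -> R := match fintype.split i with
  | inl i => fun n => (n == F`_i)%:R | inr j => v j end.
pose kap (i : 'I_(size F + m)) : R := match fintype.split i with
  | inl i => (2 * d)%:R + c - W F`_i | inr j => - k end.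
have l2b i : l2 (b i).
  rewrite /b; case: (fintype.split i) => // j.
  by apply: (@l2_finsupp _ _ [:: F`_j]) => n; rewrite inE => /negbTE ->.
have Fsum psi n : \sum_(i < size F)
      ((2 * d)%:R + c - W F`_i) * psi F`_i * (n == F`_i)%:R =
    if n \in F then ((2 * d)%:R + c - W n) * psi n else 0.
  rewrite -(big_mkord xpredT (fun i => ((2 * d)%:R + c - W F`_i) * psi F`_i * (n == F`_i)%:R)).
  rewrite -(big_nth 0 xpredT (fun x => ((2 * d)%:R + c - W x) * psi x * (n == x)%:R)).
  case: ifPn => nF.
    rewrite (bigD1_seq n)//= eqxx mulr1 big1 ?addr0// => x.
    by rewrite eq_sym => /negbTE ->; rewrite mulr0.
  rewrite big_seq big1// => x xF; case: eqP => [e|]; last by rewrite mulr0.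
  by rewrite e xF in nF.
have pertE psi n : rank_pert W' b kap psi n = spec_pert lam v k psi n.
  rewrite /rank_pert big_split_ord/=.
  have -> : \sum_(i < size F) kap (lshift m i) * dot (b (lshift m i)) psi
      * b (lshift m i) n = if n \in F then ((2 * d)%:R + c - W n) * psi n else 0.
    rewrite -Fsum; apply: eq_bigr => i _.
    by rewrite /kap /b (unsplitK (inl i)) dot_dirac.
  have -> : \sum_(i < m) kap (rshift (size F) i) * dot (b (rshift (size F) i)) psi
      * b (rshift (size F) i) n = - (k * \sum_j dot (v j) psi * v j n).
    rewrite mulr_sumr -sumrN; apply: eq_bigr => i _.
    by rewrite /kap /b (unsplitK (inr i)) -mulrA mulNr.
  by rewrite /spec_pert /schr /W'; case: ifPn => nF; ring.
have domE psi : schr_dom W' psi <-> schr_dom W psi.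
  have fs : l2 (fun n => if n \in F then ((2 * d)%:R + c - W n) * psi n else 0).
    by apply: (@l2_finsupp _ _ F) => n /negbTE ->.
  split=> -[s1 s2]; split => //.
  - have := l2B (l2D s2 (l2Z lam s1)) fs; congr l2; apply: funext => n.
    by rewrite /W'; case: ifPn => nF; ring.
  - have := l2D (l2B s2 (l2Z lam s1)) fs; congr l2; apply: funext => n.
    by rewrite /W'; case: ifPn => nF; ring.
have [|M HM] := @rank_pert_solve R d W' _ c'0 W'c _ b kap l2b.
  move=> psi /domE s e; apply: inj s _ => n.
  by rewrite -pertE.
exists M => g sg; have [psi [s e le]] := HM g sg.
by exists psi; split => //; [exact/domE|move=> n; rewrite -pertE].
Qed.

Lemma l2_normE (eps : R) psi : l2_norm eps psi = Num.sqrt (eps ^+ d * nrm2 psi).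
Proof. by rewrite /l2_norm /l2_dot /nrm2 /dot lsum.unlock. Qed.

(** Fredholm alternative: without an eigenvector, [spec_pert_solve] with an empty family solves (H -
    lam) psi = g with a norm bound, which puts lam in the resolvent set. *)
Lemma spectrum_eigenvalue (eps : R) lam : 0 <= eps -> lam < c ->
  spectrum eps schr_op lam -> Defs.eigenvalue schr_op lam.
Proof.
move=> e0 lamc sp; apply: contrapT => /forall2NP nev; apply: sp.
have inj psi : schr_dom W psi -> (forall n, schr W psi n = lam * psi n) ->
    forall n, psi n = 0.
  move=> s e n; case: (nev psi) => [|/notP ->//].
  by case; apply/schr_eigenspaceP.
pose v (j : 'I_0) (n : L) : R := 0.
have vE psi n : spec_pert lam v 0 psi n = Defs.shift schr_op lam psi n.
  by rewrite /spec_pert mul0r addr0.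
have [||M HM] := @spec_pert_solve lam 0 v 0 lamc; first by case.
  move=> psi s e; apply: inj => // n.
  by have := e n; rewrite /spec_pert mul0r addr0 => /eqP; rewrite subr_eq0 => /eqP.
have uniq_psi psi phi : schr_dom W psi -> schr_dom W phi ->
    Defs.shift schr_op lam psi = Defs.shift schr_op lam phi -> psi = phi.
  move=> s1 s2 E; apply: funext => n; apply/eqP; rewrite -subr_eq0; apply/eqP.
  apply: (inj (fun n => psi n - phi n)) => [|m]; first exact: schr_domB.
  have : Defs.shift schr_op lam psi m = Defs.shift schr_op lam phi m by rewrite E.
  change (schr W psi m - lam * psi m = schr W phi m - lam * phi m ->
    schr W (fun n0 => psi n0 - phi n0) m = lam * (psi m - phi m)).
  by rewrite schrB; lra.
have l2s psi : schr_dom W psi -> l2 (Defs.shift schr_op lam psi).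
  by move=> s; apply: l2B; [exact: l2_schr|apply: l2Z; exact: s.1].
split.
  split.
  - by move=> psi s; exact: l2s.
  - by move=> psi phi /set_mem s1 /set_mem s2; exact: uniq_psi.
  - move=> g /= sg; have [psi [s e _]] := HM g sg; exists psi => //.
    by apply: funext => n; rewrite -vE e.
(* [M] comes without a sign, hence the maximum with 0 under the root. *)
exists (Num.sqrt (Num.max 0 M)) => psi s.
have [phi [s' e le]] := HM _ (l2s _ s).
have <- : phi = psi.
  by apply: uniq_psi => //; apply: funext => n; rewrite -vE.
rewrite !l2_normE -sqrtrM ?le_max ?lexx// ler_sqrt.
  rewrite mulrCA ler_wpM2l ?exprn_ge0//.
  have -> : Defs.shift schr_op lam phi = Defs.shift schr_op lam psi.
    by apply: funext => n; rewrite -vE.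
  apply: le_trans le _; apply: ler_wpM2r; first exact: nrm2_ge0.
  by rewrite le_max lexx orbT.
by rewrite mulr_ge0 ?le_max ?lexx// mulr_ge0 ?exprn_ge0 ?nrm2_ge0.
Qed.

Lemma eigen_orth lam mu psi phi : schr_dom W psi -> schr_dom W phi ->
  (forall n, schr W psi n = lam * psi n) -> (forall n, schr W phi n = mu * phi n) ->
  lam != mu -> dot psi phi = 0.
Proof.
move=> s1 s2 e1 e2 ne; have := schr_sym s1 s2.
rewrite (funext e1) (funext e2) dotZl ?dotZr; try solve [exact: s1.1|exact: s2.1].
move=> /eqP; rewrite -subr_eq0 -mulrBl mulf_eq0 subr_eq0 (negbTE ne) => /eqP.
by [].
Qed.

Lemma orth_comb (k : nat) (psi : 'I_k -> L -> R) (lam : 'I_k -> R) (a : 'I_k -> R) :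
  (forall i, schr_dom W (psi i)) ->
  (forall i n, schr W (psi i) n = lam i * psi i n) ->
  (forall i j, i != j -> dot (psi i) (psi j) = 0) ->
  let u n := \sum_i a i * psi i n in
  nrm2 u = \sum_i a i ^+ 2 * nrm2 (psi i) /\
  dot u (schr W u) = \sum_i lam i * a i ^+ 2 * nrm2 (psi i).
Proof.
move=> s e o u.
have l2p i : l2 (psi i) by have [] := s i.
have l2ap i : l2 (fun n => a i * psi i n) by exact: l2Z.
have H (b : 'I_k -> R) : dot u (fun n => \sum_i b i * psi i n) =
    \sum_i a i * b i * nrm2 (psi i).
  rewrite /u dot_suml//; last by apply: l2_sum => i _; exact: l2Z.
  apply: eq_bigr => i _; rewrite dot_sumr//; last by move=> j _; exact: l2Z.
  rewrite (bigD1 i)//= big1 ?addr0.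
    by rewrite dotZl ?dotZr//; [rewrite mulrA|exact: l2Z].
  by move=> j ji; rewrite dotZl ?dotZr ?o ?mulr0//; [rewrite eq_sym|exact: l2Z].
split; first by rewrite /nrm2 H; apply: eq_bigr => i _; rewrite expr2.
have -> : schr W u = fun n => \sum_i (a i * lam i) * psi i n.
  apply: funext => n; rewrite schr_sum; apply: eq_bigr => i _.
  by rewrite schrZ e mulrA.
by rewrite H; apply: eq_bigr => i _; ring.
Qed.

(** Among k > p eigenvectors some nonzero combination is annihilated by all [l i]. Eigenvectors of
    distinct eigenvalues being orthogonal, its form is a weighted sum of the [lam i] and lies
    strictly below gam times its squared norm. Used with the values on [F] and with the weighted
    means over the wells. *)
Lemma codim_bound (gam : R) (p : nat) (l : 'I_p -> (L -> R) -> R) :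
  (forall i k (a : 'I_k -> R) (G : 'I_k -> L -> R),
     l i (fun n => \sum_j a j * G j n) = \sum_j a j * l i (G j)) ->
  (forall psi, schr_dom W psi -> (forall i, l i psi = 0) ->
     gam * nrm2 psi <= dot psi (schr W psi)) ->
  forall (k : nat) (lam : 'I_k -> R), injective lam ->
    (forall i, lam i < gam /\ Defs.eigenvalue schr_op (lam i)) -> (k <= p)%N.
Proof.
move=> llin lQ k lam inj ev; rewrite leqNgt; apply/negP => pk.
have /choice [psi Hpsi] : forall i, exists psi, [/\ schr_dom W psi,
    forall n, schr W psi n = lam i * psi n & psi <> 0].
  by move=> i; have [_ [psi /schr_eigenspaceP [s e] n0]] := ev i; exists psi.
pose M := \matrix_(i, j) l j (psi i).
have [a a0 aM] := kernel_comb M pk.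
have s i : schr_dom W (psi i) by have [] := Hpsi i.
have e i n : schr W (psi i) n = lam i * psi i n by have [_ ->] := Hpsi i.
have o i j : i != j -> dot (psi i) (psi j) = 0.
  move=> ij; apply: (eigen_orth (s i) (s j) (e i) (e j)).
  by apply: contraNneq ij => /inj ->.
pose u n := \sum_i a 0 i * psi i n.
have [nu Qu] := orth_comb (a 0) s e o.
have su : schr_dom W u by apply: schr_dom_sum => i _; exact: schr_domZ.
have := lQ u su; rewrite Qu nu => H.
have {}H := H (fun j => _).
have {H} : gam * (\sum_i a 0 i ^+ 2 * nrm2 (psi i)) <=
    \sum_i lam i * a 0 i ^+ 2 * nrm2 (psi i).
  apply: H => j; rewrite llin; have /rowP/(_ j) := aM; rewrite !mxE => aM0.
  by rewrite -[RHS]aM0; apply: eq_bigr => i _; rewrite mxE.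
rewrite mulr_sumr -subr_le0 -sumrB => le0.
have ge0 i : 0 <= gam * (a 0 i ^+ 2 * nrm2 (psi i)) - lam i * a 0 i ^+ 2 * nrm2 (psi i).
  have -> : gam * (a 0 i ^+ 2 * nrm2 (psi i)) - lam i * a 0 i ^+ 2 * nrm2 (psi i)
    = (gam - lam i) * (a 0 i ^+ 2 * nrm2 (psi i)) by ring.
  apply: mulr_ge0; first by rewrite subr_ge0 ltW//; have [] := ev i.
  by apply: mulr_ge0; [exact: sqr_ge0|exact: nrm2_ge0].
move/negP: a0; apply; apply/eqP/rowP => i; rewrite mxE.
have sum0 : \sum_i (gam * (a 0 i ^+ 2 * nrm2 (psi i)) - lam i * a 0 i ^+ 2 * nrm2 (psi i)) = 0.
  by apply/eqP; rewrite eq_le le0 sumr_ge0.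
have : gam * (a 0 i ^+ 2 * nrm2 (psi i)) - lam i * a 0 i ^+ 2 * nrm2 (psi i) = 0.
  exact: (psumr_eq0P (fun i _ => ge0 i) sum0).
have -> : gam * (a 0 i ^+ 2 * nrm2 (psi i)) - lam i * a 0 i ^+ 2 * nrm2 (psi i)
  = (gam - lam i) * (a 0 i ^+ 2 * nrm2 (psi i)) by ring.
have [lg _] := ev i.
move=> /eqP; rewrite !mulf_eq0 subr_eq0 gt_eqF//= orbb => /orP[/eqP//|/eqP n0].
have [_ _] := Hpsi i; case; apply: funext => n.
by apply: nrm2_eq0; [exact: (s i).1|rewrite n0].
Qed.

Lemma vanish_ge psi : schr_dom W psi -> (forall i : 'I_(size F), psi F`_i = 0) ->
  c * nrm2 psi <= dot psi (schr W psi).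
Proof.
move=> s F0; apply: schr_ge => // n n0; apply: WF; apply: contra n0 => nF.
have iF : (index n F < size F)%N by rewrite index_mem.
by have := F0 (Ordinal iF); rewrite /= nth_index// => ->.
Qed.

Lemma count_low_eigenvalues (k : nat) (lam : 'I_k -> R) : injective lam ->
  (forall i, lam i < c /\ Defs.eigenvalue schr_op (lam i)) -> (k <= size F)%N.
Proof.
by apply: (@codim_bound c (size F) (fun i psi => psi F`_i)) => //; exact: vanish_ge.
Qed.

(** An infinite set would contain N + 1 points, so the bound on injective families yields finiteness
    as well. *)
Lemma card_le_of_inj (A : set R) (N : nat) :
  (forall k (x : 'I_k -> R), injective x -> (forall i, A (x i)) -> (k <= N)%N) ->
  A #<= `I_N.
Proof.
move=> H.
have Hf (B : {fset R}) : [set` B] `<=` A -> (#|` B| <= N)%N.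
  move=> BA; apply: (H _ (fun i : 'I_(size B) => B`_i)) => [i j /eqP|i].
    by rewrite nth_uniq ?fset_uniq// => /eqP/val_inj.
  by apply: BA => /=; exact: mem_nth.
have finA : finite_set A.
  apply: contrapT => /(infinite_set_fset N.+1) [B BA].
  by have := Hf B BA; rewrite leqNgt => /negP.
have /finite_setP [n An] := finA.
have nA : [set: 'I_n] #= A.
  by rewrite card_eq_sym; apply: card_eq_trans An _; exact: card_II.
have /card_set_bijP [x [xA xi _]] := nA.
have nN : (n <= N)%N.
  by apply: (H n x) => [i j|i]; [apply: xi; exact: mem_set|exact: xA].
by rewrite (card_le_eql An) card_le_II.
Qed.
End spectral_alternative.

(** * Multiplicities, essential spectrum and existence of low eigenvalues *)

Section low_spectrum.
Variables (R : realType) (d : nat).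
Local Notation L := 'rV[int]_d.
Implicit Types (psi phi g : L -> R) (lam : R).

Lemma lattice_fun_sumE (k : nat) (a : 'I_k -> R) (b : 'I_k -> lattice_fun R d) (n : L) :
  (\sum_i a i *: b i) n = \sum_i a i * b i n.
Proof.
by rewrite (big_morph (fun g : lattice_fun R d => g n)
  (id1 := 0) (op1 := +%R)).
Qed.

Variables (W : L -> R) (c : R) (F : seq L).
Hypothesis uniqF : uniq F.
Hypothesis WF : forall n, n \notin F -> (2 * d)%:R + c <= W n.

Local Notation H := (schr_op W).

(** Restriction to [F] is injective on the eigenspace: an eigenvector vanishing on [F] has form at
    least c times its squared norm, and lam < c. *)
Lemma low_independent_le lam (k : nat) (b : 'I_k -> lattice_fun R d) : lam < c ->
  (forall i, Defs.eigenspace H lam (b i)) -> linearly_independent b ->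
  (k <= size F)%N.
Proof.
move=> lamc eb ib; rewrite leqNgt; apply/negP => Fk.
have [a a0 aM] := kernel_comb (\matrix_(i < k, j < size F) b i F`_j) Fk.
have s i : schr_dom W (b i) by have /schr_eigenspaceP [] := eb i.
have e i n : schr W (b i) n = lam * b i n by have /schr_eigenspaceP [_ ->] := eb i.
pose u n := \sum_i a 0 i * b i n.
have su : schr_dom W u by apply: schr_dom_sum => i _; exact: schr_domZ.
have eu : schr W u = fun n => lam * u n.
  apply: funext => n; rewrite schr_sum mulr_sumr; apply: eq_bigr => i _.
  by rewrite schrZ e mulrCA.
have := vanish_ge WF su; rewrite eu dotZr; [|exact: su.1|exact: su.1].
rewrite -/(nrm2 u) => h.
have nu : nrm2 u <= 0.
  have : (c - lam) * nrm2 u <= 0.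
    rewrite mulrBl subr_le0; apply: h => j.
    have /rowP/(_ j) := aM; rewrite !mxE => aM0.
    by rewrite -[RHS]aM0; apply: eq_bigr => i _; rewrite mxE.
  by rewrite pmulr_rle0// subr_gt0.
move/negP: a0; apply; apply/eqP/rowP => i; rewrite mxE.
apply: (ib (a 0)); apply: funext => n.
by rewrite lattice_fun_sumE; exact: (nrm2_eq0 su.1 nu).
Qed.

(** A largest independent family of eigenvectors exists by the previous bound, and it spans:
    otherwise it could be extended. *)
Lemma low_finite_multiplicity lam : lam < c -> finite_multiplicity H lam.
Proof.
move=> lamc.
pose P k := `[< exists b : 'I_k -> lattice_fun R d,
  (forall i, Defs.eigenspace H lam (b i)) /\ linearly_independent b >].
have P0 : exists k, P k.
  exists 0%N; apply/asboolP; exists (fun _ => 0); split; first by case.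
  by move=> a _; case.
have Pb k : P k -> (k <= size F)%N.
  by move=> /asboolP [b [eb ib]]; exact: low_independent_le lamc eb ib.
have [k /asboolP [b [eb ib]] kmax] := ex_maxnP P0 Pb.
exists k, b => psi epsi; apply: contrapT => nspan.
have : P k.+1.
  apply/asboolP; exists (fun i => oapp b psi (unlift ord_max i)); split.
    by move=> i; case: (unlift ord_max i) => /=.
  move=> a; rewrite big_ord_recr/= unlift_none/= => e0.
  have wid i : unlift ord_max (widen_ord (leqnSn k) i) = Some i.
    rewrite -(liftK ord_max i); congr unlift; apply: val_inj => /=.
    by rewrite /bump leqNgt ltn_ord.
  have e1 : \sum_i a (widen_ord (leqnSn k) i) *: b i + a ord_max *: psi = 0.
    by rewrite -[RHS]e0; congr (_ + _); apply: eq_bigr => i _; rewrite wid.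
  have am0 : a ord_max = 0.
    apply: contrapT => /eqP am0; apply: nspan.
    exists (fun i => - (a ord_max)^-1 * a (widen_ord (leqnSn k) i)).
    move/eqP: e1; rewrite addrC addr_eq0 => /eqP e1.
    rewrite -[psi](scalerK am0) e1 scalerN -scaleNr scaler_sumr.
    by apply: eq_bigr => i _; rewrite scalerA.
  rewrite am0 scale0r addr0 in e1.
  have aw := ib _ e1; move=> i.
  case: (unliftP ord_max i) => [j ->|->//].
  have <- := aw j; congr a; apply: val_inj => /=.
  by rewrite /bump leqNgt ltn_ord.
by move=> /kmax; rewrite ltnn.
Qed.

Lemma finite_low_eigenvalues : finite_set [set lam | lam < c /\ Defs.eigenvalue H lam].
Proof.
have : [set lam | lam < c /\ Defs.eigenvalue H lam] #<= `I_(size F).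
  by apply: card_le_of_inj => k x xi Ax; exact: (count_low_eigenvalues WF xi Ax).
by move=> /card_le_finite; apply; exact: finite_II.
Qed.

Lemma essential_spectrum_ge (eps : R) : 0 <= eps ->
  essential_spectrum eps H `<=` [set lam | c <= lam].
Proof.
move=> e0 lam [sp nd] /=; rewrite leNgt; apply/negP => lamc; apply: nd.
have ev := spectrum_eigenvalue uniqF WF e0 lamc sp.
split => //; last exact: low_finite_multiplicity.
split; first exact/mem_set.
(* The other eigenvalues below c form a finite, hence closed set; its complement isolates lam, as
   the spectrum below c consists of eigenvalues. *)
pose E := [set mu | mu < c /\ Defs.eigenvalue H mu] `\ lam.
have cE : closed E.
  have /accessible_finite_set_closed := @hausdorff_accessible R (@Rhausdorff R).
  by apply; apply: finite_setD; exact: finite_low_eigenvalues.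
exists ([set mu | mu < c] `&` ~` E).
  apply: open_nbhs_nbhs; split; last by split => // -[_]; apply.
  by apply: openI; [exact: open_lt|exact: closed_openC].
apply/seteqP; split => mu /=.
  move=> [[muc nE] smu]; apply: contrapT => ne; apply: nE; split => //.
  split => //; exact: (spectrum_eigenvalue uniqF WF e0 muc smu).
by move=> ->; split => //; split => // -[_]; apply.
Qed.

(** * Eigenvalues from an N-dimensional trial space *)

Section existence.
Variables (mu : R) (N : nat) (phi : 'I_N -> L -> R).
Hypothesis muc : mu < c.
Hypothesis W_ge0 : forall psi, schr_dom W psi -> 0 <= dot psi (schr W psi).
Hypothesis phi_dom : forall i, schr_dom W (phi i).
Hypothesis phi_free : forall a : 'I_N -> R,
  (forall n, \sum_i a i * phi i n = 0) -> forall i, a i = 0.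
Hypothesis phi_mu : forall a : 'I_N -> R, let u n := \sum_i a i * phi i n in
  dot u (schr W u) <= mu * nrm2 u.

Let eigen_family (m : nat) (lam : 'I_m -> R) (v : 'I_m -> L -> R) :=
  [/\ forall i, schr_dom W (v i), forall i n, schr W (v i) n = lam i * v i n,
     forall i j, dot (v i) (v j) = (i == j)%:R & forall i, lam i <= mu].

(* If the infimum [ls] of the form on the orthogonal complement of the eigenvectors
   already found were not an eigenvalue, then [H - ls], made positive by a finite-rank
   term on these eigenvectors, would have a bounded inverse, contradicting a
   minimizing sequence. *)
Lemma next_eigenvector (m : nat) (lam : 'I_m -> R) (v : 'I_m -> L -> R) :
  (m < N)%N -> eigen_family lam v ->
  exists lam' psi, [/\ schr_dom W psi, forall n, schr W psi n = lam' * psi n,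
    forall j, dot (v j) psi = 0, nrm2 psi = 1 & lam' <= mu].
Proof.
move=> mN [vd ve vo vmu].
have vl2 j : l2 (v j) by exact: (vd j).1.
pose S := [set q | exists psi, [/\ schr_dom W psi, forall j, dot (v j) psi = 0,
  nrm2 psi = 1 & dot psi (schr W psi) = q]].
have normalize psi : schr_dom W psi -> 0 < nrm2 psi ->
    nrm2 (fun n => (Num.sqrt (nrm2 psi))^-1 * psi n) = 1 /\
    dot (fun n => (Num.sqrt (nrm2 psi))^-1 * psi n)
      (schr W (fun n => (Num.sqrt (nrm2 psi))^-1 * psi n)) =
    (nrm2 psi)^-1 * dot psi (schr W psi).
  move=> s p0; have sp := s.1; have sH := l2_schr s.
  have -> : schr W (fun n => (Num.sqrt (nrm2 psi))^-1 * psi n) =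
      fun n => (Num.sqrt (nrm2 psi))^-1 * schr W psi n.
    by apply: funext => n; rewrite schrZ.
  rewrite nrm2Z// dotZl//; last exact: l2Z.
  rewrite dotZr// mulrA -expr2 exprVn sqr_sqrtr ?ltW//.
  by rewrite mulVf// gt_eqF.
have S_ge0 q : S q -> 0 <= q by move=> [psi [s _ _ <-]]; exact: W_ge0.
(* As m < N, some nonzero trial function is orthogonal to the m eigenvectors already found; hence
   the infimum is at most mu. *)
have [q0 Sq0 q0mu] : exists2 q, S q & q <= mu.
  have [a a0 aM] := kernel_comb (\matrix_(i < N, j < m) dot (v j) (phi i)) mN.
  pose u n := \sum_i a 0 i * phi i n.
  have su : schr_dom W u by apply: schr_dom_sum => i _; exact: schr_domZ.
  have nu : 0 < nrm2 u.
    rewrite ltNge; apply: contra a0 => nu; apply/eqP/rowP => i; rewrite mxE.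
    by apply: (phi_free (a := a 0)) => n; exact: (nrm2_eq0 su.1 nu).
  have [n1 n2] := normalize u su nu.
  eexists; last first.
    rewrite -(ler_pM2l nu) [leRHS]mulrC.
    apply: (le_trans _ (phi_mu (a 0))).
    rewrite [X in X <= _](_ : _ = nrm2 u * ((nrm2 u)^-1 * dot u (schr W u))); last by [].
    by rewrite mulVKf// gt_eqF.
  exists (fun n => (Num.sqrt (nrm2 u))^-1 * u n).
  split => //; first exact: schr_domZ.
  move=> j; rewrite dotZr//; last exact: su.1.
  rewrite dot_sumr//; last by move=> i _; apply: l2Z; exact: (phi_dom i).1.
  apply/eqP; rewrite mulf_eq0; apply/orP; right; apply/eqP.
  have /rowP/(_ j) := aM; rewrite !mxE => aM0; rewrite -[RHS]aM0.
  by apply: eq_bigr => i _; rewrite mxE dotZr//; exact: (phi_dom i).1.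
have hS : has_inf S by split; [exists q0|exists 0 => q; exact: S_ge0].
pose ls := inf S.
have ls0 : 0 <= ls by apply: lb_le_inf => [|q]; [exists q0|exact: S_ge0].
have lsmu : ls <= mu by apply: le_trans q0mu; apply: ge_inf => //; exact: hS.2.
have lsc : ls < c by exact: le_lt_trans lsmu muc.
have lam0 i : 0 <= lam i.
  have := W_ge0 (vd i); rewrite (funext (ve i)) dotZr// vo eqxx mulr1.
  exact.
(* The coefficient ls + 1 gives T v_j = (lam_j + 1) v_j: T is bounded below by 1 on the eigenvectors
   found and equals H - ls on their orthogonal complement. *)
pose T := spec_pert W ls v (ls + 1).
pose P psi n := \sum_j dot (v j) psi * v j n.
have Pdom psi : schr_dom W (P psi).
  by apply: schr_dom_sum => j _; exact: schr_domZ.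
have PE psi : schr_dom W psi -> [/\ dot psi (P psi) = \sum_j dot (v j) psi ^+ 2,
    forall j, dot (v j) (P psi) = dot (v j) psi,
    nrm2 (P psi) = \sum_j dot (v j) psi ^+ 2,
    dot psi (schr W (P psi)) = \sum_j lam j * dot (v j) psi ^+ 2 &
    dot (P psi) (schr W (P psi)) = \sum_j lam j * dot (v j) psi ^+ 2].
  move=> s; have sp := s.1.
  have vo' i j : i != j -> dot (v i) (v j) = 0 by rewrite vo => /negbTE ->.
  have [e1 e2] := orth_comb (fun j => dot (v j) psi) vd ve vo'.
  have cm : dot psi (schr W (P psi)) = \sum_j lam j * dot (v j) psi ^+ 2.
    have -> : schr W (P psi) = fun n => \sum_j (lam j * dot (v j) psi) * v j n.
      apply: funext => n; rewrite schr_sum; apply: eq_bigr => j _.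
      by rewrite schrZ ve mulrCA mulrA.
    rewrite dot_sumr//; last by move=> j _; exact: l2Z.
    by apply: eq_bigr => j _; rewrite dotZr// (dotC psi) expr2 mulrA.
  split => //.
  - rewrite dot_sumr//; last by move=> j _; exact: l2Z.
    by apply: eq_bigr => j _; rewrite dotZr// (dotC psi).
  - move=> j; rewrite dot_sumr//; last by move=> i _; exact: l2Z.
    rewrite (bigD1 j)//= dotZr// vo eqxx mulr1 big1 ?addr0// => i ij.
    by rewrite dotZr// vo eq_sym (negbTE ij) mulr0.
  - by rewrite e1; apply: eq_bigr => j _; rewrite /nrm2 vo eqxx mulr1.
  - by rewrite e2; apply: eq_bigr => j _; rewrite /nrm2 vo eqxx mulr1.
have TE psi : T psi = fun n => (schr W psi n - ls * psi n) + (ls + 1) * P psi n by [].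
have l2T psi : schr_dom W psi -> l2 (T psi).
  move=> s; rewrite TE; apply: l2D; last by apply: l2Z; exact: (Pdom psi).1.
  by apply: l2B; [exact: l2_schr|apply: l2Z; exact: s.1].
have dotT psi ph : schr_dom W psi -> schr_dom W ph -> dot ph (T psi) =
    dot ph (schr W psi) - ls * dot ph psi + (ls + 1) * dot ph (P psi).
  move=> s s'; have sp := s.1; have sP := (Pdom psi).1; have sH := l2_schr s.
  have sp' := s'.1.
  rewrite TE dotDr//; [|by apply: l2B => //; exact: l2Z|exact: l2Z].
  by rewrite dotBr// ?dotZr//; exact: l2Z.
(* With psi' = psi - P psi, the form of T is the form of H - ls at psi', nonnegative by the choice
   of ls, plus the sum of (lam_j + 1) <v_j, psi>^2. *)
have T_ge0 psi : schr_dom W psi -> 0 <= dot psi (T psi).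
  move=> s; have sp := s.1; have sP := (Pdom psi).1; have sH := l2_schr s.
  have sHP := l2_schr (Pdom psi).
  have [e1 e2 e3 e4 e5] := PE psi s.
  pose psi' n := psi n - P psi n.
  have s' : schr_dom W psi' by exact: schr_domB.
  have o' j : dot (v j) psi' = 0 by rewrite dotBr// e2 subrr.
  have n' : nrm2 psi' = nrm2 psi - \sum_j dot (v j) psi ^+ 2.
    rewrite {1}/nrm2 dotBl//; last exact: s'.1.
    rewrite !dotBr// (dotC (P psi)) e1 -/(nrm2 (P psi)) e3 /nrm2; lra.
  have Q' : dot psi' (schr W psi') = dot psi (schr W psi)
       - \sum_j lam j * dot (v j) psi ^+ 2.
    have -> : schr W psi' = fun n => schr W psi n - schr W (P psi) n.
      by apply: funext => n; exact: schrB.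
    rewrite (dotBl sp sP (l2B sH sHP)) (dotBr sH sHP sp) (dotBr sH sHP sP).
    rewrite e4 e5 (dotC (P psi)) (schr_sym s (Pdom psi)) e4; lra.
  have key : ls * nrm2 psi' <= dot psi' (schr W psi').
    have [n0|n0] := leP (nrm2 psi') 0.
      by apply: le_trans (W_ge0 s'); rewrite mulr_ge0_le0.
    have [n1 n2] := normalize psi' s' n0.
    have : ls <= (nrm2 psi')^-1 * dot psi' (schr W psi').
      apply: ge_inf; first exact: hS.2.
      exists (fun n => (Num.sqrt (nrm2 psi'))^-1 * psi' n); split => //.
        exact: schr_domZ.
      by move=> j; rewrite dotZr// ?o' ?mulr0//; exact: s'.1.
    by rewrite mulrC ler_pdivlMr.
  have lsum0 : 0 <= \sum_j lam j * dot (v j) psi ^+ 2.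
    by apply: sumr_ge0 => j _; rewrite mulr_ge0 ?sqr_ge0.
  have s0 : 0 <= \sum_j dot (v j) psi ^+ 2.
    by apply: sumr_ge0 => j _; rewrite sqr_ge0.
  rewrite dotT// e1 -/(nrm2 psi); move: key; rewrite n' Q'.
  by move: lsum0 s0; set A := \sum_j _; set B := \sum_j _; lra.
have T_sym psi ph : schr_dom W psi -> schr_dom W ph ->
    dot (T psi) ph = dot psi (T ph).
  move=> s s'; have sp := s.1; have sp' := s'.1.
  rewrite dotC !dotT// (dotC ph (schr W psi)) (schr_sym s s') (dotC ph psi).
  congr (_ + _ * _); rewrite !dot_sumr//; try by move=> j _; exact: l2Z.
  by apply: eq_bigr => j _; rewrite !dotZr// !(dotC (v j)) mulrC.
have [psi [s Tpsi0 [n1 psin0]]] : exists psi, [/\ schr_dom W psi,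
    forall n, T psi n = 0 & exists n, psi n <> 0].
  apply: contrapT => noker.
  have [|M HM] := @spec_pert_solve R d W c F uniqF WF ls m v (ls + 1) lsc vl2.
    move=> psi s e n; apply: contrapT => pn; apply: noker.
    by exists psi; split => //; exists n.
  have M1 : 0 < 1 + `|M| by rewrite ltr_wpDr.
  have [q [psi [s o n1 <-]] qls] : exists2 q, S q & q < ls + (1 + `|M|)^-1.
    by apply: inf_adherent => //; rewrite invr_gt0.
  have [chi [sc ec nc]] := HM psi s.1.
  have eT : T chi = psi by apply: funext.
  (* Here T chi = psi, and q = <psi, H psi> is within 1 / t of ls. Positivity of T at chi - t psi
     reads 0 <= <chi, psi> - 2 t + t^2 (q - ls), whereas <chi, psi> <= t / 2 and t (q - ls) < 1. *)
  set t := 1 + `|M|.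
  have sx : schr_dom W (fun n => chi n - t * psi n).
    by apply: schr_domB => //; exact: schr_domZ.
  have := T_ge0 _ sx.
  have TB : T (fun n => chi n - t * psi n) = fun n => T chi n - t * T psi n.
    apply: funext => n; rewrite !TE schrB schrZ.
    have -> : P (fun n => chi n - t * psi n) n = P chi n - t * P psi n.
      rewrite /P mulr_sumr -sumrB; apply: eq_bigr => j _.
      rewrite dotBr ?dotZr//; try solve [exact: sc.1|exact: s.1|apply: l2Z; exact: s.1].
      by ring.
    by ring.
  have [sc1 s1] := (sc.1, s.1).
  have lT := l2T _ s; have lTc := l2T _ sc.
  rewrite TB dotBl//; [|exact: l2Z|by apply: l2B => //; exact: l2Z].
  rewrite !dotBr//; try exact: l2Z.
  rewrite !dotZl// ?dotZr//; try exact: l2Z.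
  rewrite -(T_sym _ _ sc s) eT -/(nrm2 psi) n1.
  have -> : dot psi (T psi) = dot psi (schr W psi) - ls.
    rewrite dotT// -/(nrm2 psi) n1.
    have [-> _ _ _ _] := PE _ s.
    by rewrite big1 ?mulr0 ?addr0 ?mulr1// => j _; rewrite o expr0n.
  have cp : dot chi psi <= t / 2.
    have := nrm2_ge0 (fun n => chi n - psi n).
    rewrite {1}/nrm2 dotBl//; last exact: l2B.
    rewrite !dotBr// (dotC psi chi) -/(nrm2 chi) -/(nrm2 psi) n1.
    move: nc; rewrite n1 mulr1 => nc.
    by have := ler_norm M; rewrite /t; lra.
  move: qls; rewrite -ltrBlDl -/t; set dl := _ - ls => qls.
  have : t * dl < 1 by rewrite mulrC -ltr_pdivlMr// div1r.
  by have tp : 0 < t := M1; move: cp; set D := dot chi psi; nra.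
have sp := s.1; have sH := l2_schr s.
(* Pairing T psi = 0 with v_j leaves (lam_j + 1) <v_j, psi> = 0, so the penalty vanishes at psi. *)
have o j : dot (v j) psi = 0.
  have : dot (v j) (T psi) = 0.
    by rewrite (funext Tpsi0) dotC /dot (_ : (fun n => _) = fun=> 0) ?lsum0//;
      apply: funext => n; rewrite mul0r.
  rewrite dotT//; have [_ -> _ _ _] := PE _ s.
  rewrite -(schr_sym (vd j) s) (funext (ve j)) dotZl// => e0.
  have : (lam j + 1) * dot (v j) psi = 0 by move: e0; lra.
  move=> /eqP; rewrite mulf_eq0 => /orP[|/eqP//].
  by have := lam0 j => l0 /eqP; lra.
have e n : schr W psi n = ls * psi n.
  have := Tpsi0 n; rewrite TE /P big1; last by move=> j _; rewrite o mul0r.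
  by rewrite mulr0 addr0 => /eqP; rewrite subr_eq0 => /eqP.
have np : 0 < nrm2 psi.
  by rewrite ltNge; apply/negP => /(nrm2_eq0 sp)/(_ n1).
have [nn _] := normalize psi s np.
exists ls, (fun n => (Num.sqrt (nrm2 psi))^-1 * psi n); split => //.
- exact: schr_domZ.
- by move=> n; rewrite schrZ e mulrCA.
- by move=> j; rewrite dotZr// o mulr0.
Qed.

Lemma exists_low_eigenvalues : at_least_eigenvalues H [set lam | lam <= mu] N.
Proof.
have fam m : (m <= N)%N -> exists (lam : 'I_m -> R) v, eigen_family lam v.
  elim: m => [_|m IH mN].
    by exists (fun=> 0), (fun _ _ => 0); split; case.
  have [lam [v [vd ve vo vmu]]] := IH (ltnW mN).
  have [lam' [psi [s e o n1 le]]] := next_eigenvector mN (And4 vd ve vo vmu).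
  exists (fun i => oapp lam lam' (unlift ord_max i)).
  exists (fun i => oapp v psi (unlift ord_max i)); split.
  - by move=> i; case: (unlift ord_max i).
  - by move=> i n; case: (unlift ord_max i) => /=.
  - move=> i j; case: (unliftP ord_max i) => [i' ->|->];
      case: (unliftP ord_max j) => [j' ->|->] /=.
    + by rewrite vo (inj_eq (lift_inj (h := ord_max))).
    + by rewrite o eq_sym (negbTE (neq_lift _ _)).
    + by rewrite dotC o (negbTE (neq_lift _ _)).
    + by rewrite eqxx.
  - by move=> i; case: (unlift ord_max i).
have [lam [v [vd ve vo vmu]]] := fam N (leqnn N).
exists lam, v; split; last first.
  by move=> i; split; [exact: vmu|apply/schr_eigenspaceP].
move=> a a0 i.
have : dot (v i) (fun n => \sum_j a j * v j n) = a i.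
  rewrite dot_sumr; [|by move=> j _; apply: l2Z; exact: (vd j).1|exact: (vd i).1].
  rewrite (bigD1 i)//= dotZr ?vo ?eqxx ?mulr1; try exact: (vd i).1.
  rewrite big1 ?addr0// => j ji.
  by rewrite dotZr ?vo; [rewrite eq_sym (negbTE ji) mulr0|exact: (vd j).1|exact: (vd i).1].
move=> <-; rewrite /dot (_ : (fun n => _) = fun=> 0) ?lsum0//.
by apply: funext => n; rewrite -lattice_fun_sumE a0 mulr0.
Qed.

(** The value sought is the least eigenvalue below c having at least N eigenvalues at or below it.
    The candidates form a finite nonempty set, and N eigenvalues strictly below the least one would
    produce a smaller candidate, namely their maximum. *)
Lemma exists_nth_eigenvalue : N <> 0%N ->
  exists lam, nth_eigenvalue H N lam /\ 0 <= lam <= mu.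
Proof.
move=> N0.
have ev0 lam : Defs.eigenvalue H lam -> 0 <= lam.
  move=> [psi /schr_eigenspaceP [s e] pn0]; have := W_ge0 s.
  rewrite (funext e) dotZr; [|exact: s.1|exact: s.1].
  rewrite pmulr_lge0// ltNge; apply/negP => /(nrm2_eq0 s.1) p0.
  by apply: pn0; apply: funext.
have evI (I : set R) lam : at_least_eigenvalues H I N -> exists2 mu', I mu' &
    Defs.eigenvalue H mu' /\ at_least_eigenvalues H [set x | I x /\ x <= mu'] N.
  move=> [x [psi [ip Hx]]].
  have [n Nn] : exists n, N = n.+1 by case: (N) N0 => // n _; exists n.
  pose i0 : 'I_N := cast_ord (esym Nn) ord0.
  have [i _ imax] := @arg_maxP _ R 'I_N i0 xpredT x isT.
  exists (x i); first exact: (Hx i).1.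
  split.
    exists (psi i); first exact: (Hx i).2.
    move=> p0; have := ip (fun j => (j == i)%:R) _ i.
    rewrite eqxx (bigD1 i)//= p0 scaler0 add0r big1; last first.
      by move=> j /negbTE ->; rewrite scale0r.
    by move=> /(_ erefl) /eqP; rewrite oner_eq0.
  exists x, psi; split => // j; split; last exact: (Hx j).2.
  by split; [exact: (Hx j).1|exact: imax].
pose A := [set lam | [/\ lam < c, Defs.eigenvalue H lam &
  at_least_eigenvalues H [set x | x <= lam] N]].
have finA : finite_set A.
  by apply: sub_finite_set finite_low_eigenvalues => x [].
have sub (I J : set R) : I `<=` J -> at_least_eigenvalues H I N ->
    at_least_eigenvalues H J N.
  move=> IJ [x [psi [ip Hx]]]; exists x, psi; split => // i.
  by split; [apply: IJ; exact: (Hx i).1|exact: (Hx i).2].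
have [mu0 mu0le [ev0' al0]] := evI _ 0 exists_low_eigenvalues.
have A0 : A mu0.
  split => //; first exact: le_lt_trans mu0le muc.
  by apply: sub al0 => x [].
have [lam Alam lammin] : exists2 lam, A lam & forall x, A x -> lam <= x.
  have [B AB] := finite_fsetP.1 finA.
  have mu0B : mu0 \in B by move: A0; rewrite AB.
  pose bmin := [arg min_(x < [` mu0B]%fset) val x]%O.
  exists (val bmin); first by rewrite AB /=; exact: valP.
  rewrite /bmin; case: arg_minP => // i _ imin x; rewrite AB /= => xB.
  exact: (imin [` xB]%fset).
have [lc le la] := Alam.
exists lam; split; last first.
  by rewrite ev0//=; apply: le_trans (lammin _ A0) mu0le.
split => // al.
have [mu' /= mul [ev' al']] := evI _ 0 al.
have : A mu' by split => //; [exact: lt_trans mul lc|apply: sub al' => x []].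
by move=> /lammin; rewrite leNgt mul.
Qed.

End existence.
End low_spectrum.

(** * Completing squares along the edges *)

Section edge_identity.
Variables (R : realType) (d : nat).
Local Notation L := 'rV[int]_d.
Local Notation e := (basis_vec int).
Implicit Types (psi : L -> R).

Lemma neighbours_sum (K : nzRingType) (G : 'rV[K]_d -> R) :
  \sum_(v <- neighbours K d) G v =
  \sum_k (G (basis_vec K k) + G (- basis_vec K k)).
Proof. by rewrite big_cat !big_map big_split. Qed.

Lemma hamiltonianE (f : 'rV[R]_d -> R) (eps : R) : eps != 0 ->
  hamiltonian f eps =
  schr_op (fun n => potential f eps (lattice_point eps n) + (2 * d)%:R).
Proof.
move=> e0; rewrite /hamiltonian /schr_op; congr Operator.
  apply/seteqP; split => psi [s1 s2]; split => //.
    have := l2D s2 (l2Z (2 * d)%:R s1).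
    by congr l2; apply: funext => n; rewrite /potential_mul; ring.
  have := l2B s2 (l2Z (2 * d)%:R s1).
  by congr l2; apply: funext => n; rewrite /potential_mul; ring.
apply: funext => psi; apply: funext => n.
change (- (eps ^+ 2 * laplacian eps psi n) + potential_mul f eps psi n =
  schr (fun n => potential f eps (lattice_point eps n) + (2 * d)%:R) psi n).
rewrite /laplacian mulrA divff ?expf_neq0// mul1r neighbours_sum /schr /potential_mul.
have -> : \sum_k (psi (n + e k) - psi n + (psi (n - e k) - psi n)) =
    adj psi n - (2 * d)%:R * psi n.
  have -> : (2 * d)%:R * psi n = \sum_(k < d) 2 * psi n.
    by rewrite sumr_const card_ord -[RHS]mulr_natr natrM; ring.
  rewrite /adj -sumrB.
  by apply: eq_bigr => k _; ring.
by ring.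
Qed.

(** Where t is nonzero this is the square t (psi(n) - psi(n + e_k) / t)^2, which vanishes when psi
    is multiplied by t along the edge. *)
Definition edge_energy (t : 'I_d -> L -> R) psi (k : 'I_d) (n : L) : R :=
  t k n * psi n ^+ 2 + (t k n)^-1 * psi (n + e k) ^+ 2 - 2 * (psi n * psi (n + e k)).

(* What remains of [W] once the form is written as a sum of edge energies: the
   ground state transform with weights [t]. *)
Definition edge_potential (W : L -> R) (t : 'I_d -> L -> R) (n : L) : R :=
  W n - \sum_k (t k n + (t k (n - e k))^-1).

Lemma edge_energy_ge0 t psi k n : 0 < t k n -> 0 <= edge_energy t psi k n.
Proof.
move=> t0; have -> : edge_energy t psi k n =
    t k n * (psi n - (t k n)^-1 * psi (n + e k)) ^+ 2.
  by rewrite /edge_energy; field; rewrite gt_eqF.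
by rewrite mulr_ge0 ?sqr_ge0 ?ltW.
Qed.

(** A site receives t_k(n) as start of the edge to n + e_k and 1 / t_k(n - e_k) as end of the edge
    from n - e_k; the edge potential is what is left of W. Only summability against psi^2 is asked
    of the weights, since the Gibbs ratios are unbounded in general. *)
Lemma edge_identity (W : L -> R) (t : 'I_d -> L -> R) psi : schr_dom W psi ->
  (forall k, smb (fun n => t k n * psi n ^+ 2)) ->
  (forall k, smb (fun n => (t k (n - e k))^-1 * psi n ^+ 2)) ->
  [/\ smb (fun n => edge_potential W t n * psi n ^+ 2),
      forall k, smb (edge_energy t psi k) &
      dot psi (schr W psi) = lsum (fun n => edge_potential W t n * psi n ^+ 2)
        + \sum_k lsum (edge_energy t psi k)].
Proof.
move=> [s sW] st st'.
have sh (v : L) : l2 (fun n => psi (n + v)) by exact: l2_shift.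
have sWp : smb (fun n => W n * psi n ^+ 2).
  have := smbM s sW; congr smb; apply: funext => n; ring.
have stt : smb (fun n => \sum_k (t k n * psi n ^+ 2 + (t k (n - e k))^-1 * psi n ^+ 2)).
  by apply: smb_sum => k _; exact: smbD.
have sp : smb (fun n => edge_potential W t n * psi n ^+ 2).
  have := smbB sWp stt; congr smb; apply: funext => n.
  by rewrite /edge_potential mulrBl mulr_suml; congr (_ - _); apply: eq_bigr => k _; ring.
have st2 k : smb (fun n => (t k n)^-1 * psi (n + e k) ^+ 2).
  have := smb_shift (e k) (st' k); congr smb; apply: funext => n.
  by rewrite addrK.
have spp k : smb (fun n => 2 * (psi n * psi (n + e k))) by apply/smbZ/smbM.
have se k : smb (edge_energy t psi k) by apply: smbB => //; exact: smbD.
split => //.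
have lse k : lsum (edge_energy t psi k) =
    lsum (fun n => t k n * psi n ^+ 2 + (t k (n - e k))^-1 * psi n ^+ 2)
    - lsum (fun n => psi n * (psi (n + e k) + psi (n - e k))).
  rewrite /edge_energy lsumB//; last exact: smbD.
  rewrite !lsumD//; congr (_ + _ - _).
    rewrite -[RHS](lsum_shift (e k)); congr lsum; apply: funext => n.
    by rewrite addrK.
  have -> : (fun n => psi n * (psi (n + e k) + psi (n - e k))) =
      (fun n => psi n * psi (n + e k) + psi n * psi (n - e k)).
    by apply: funext => n; rewrite mulrDr.
  rewrite lsumD; [|exact: smbM|exact: smbM].
  rewrite lsumZ; last exact: smbM.
  rewrite mulr2n mulrDl mul1r; congr (_ + _).
  rewrite -[RHS](lsum_shift (e k)); congr lsum; apply: funext => n.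
  by rewrite addrK mulrC.
under eq_bigr do rewrite lse.
rewrite sumrB addrA -lsum_sum; last by move=> k _; exact: smbD.
rewrite -lsumD//.
rewrite (_ : dot psi (schr W psi) = lsum (fun n => W n * psi n ^+ 2) - dot psi (adj psi)).
  congr (_ - _).
    congr lsum; apply: funext => n.
    by rewrite /edge_potential mulrBl mulr_suml -addrA [X in _ + X](_ : _ = 0) ?addr0//;
      apply/eqP; rewrite addrC subr_eq0; apply/eqP; apply: eq_bigr => k _; ring.
  rewrite /dot /adj -lsum_sum; last by move=> k _; apply: smbM => //; exact: l2D.
  by congr lsum; apply: funext => n; rewrite mulr_sumr.
rewrite dotBr//; last exact: l2_adj.
by congr (_ - _); congr lsum; apply: funext => n; ring.
Qed.

Lemma edge_lower_bound (W : L -> R) (t : 'I_d -> L -> R) psi (B : R) : schr_dom W psi ->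
  (forall k n, 0 < t k n) -> (forall k n, t k n <= B) -> (forall k n, (t k n)^-1 <= B) ->
  smb (fun n => edge_potential W t n * psi n ^+ 2) /\
  lsum (fun n => edge_potential W t n * psi n ^+ 2) <= dot psi (schr W psi).
Proof.
move=> s t0 tB tB'.
have sB : smb (fun n => B * psi n ^+ 2) by apply: smbZ; exact: s.1.
have [||h1 h2 ->] := @edge_identity W t psi s.
- move=> k; apply: smb_le sB _ => n; have tn := t0 k n; have p2 := sqr_ge0 (psi n).
  by rewrite normrM (gtr0_norm tn) (ger0_norm p2); exact: ler_wpM2r.
- move=> k; apply: smb_le sB _ => n; have p2 := sqr_ge0 (psi n).
  have tn : 0 < (t k (n - e k))^-1 by rewrite invr_gt0.
  by rewrite normrM (gtr0_norm tn) (ger0_norm p2); exact: ler_wpM2r.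
split => //; rewrite lerDl; apply: sumr_ge0 => k _; apply: lsum_ge0 => n.
exact: edge_energy_ge0.
Qed.

Variables (f : 'rV[R]_d -> R) (eps : R).
Hypothesis eps0 : 0 < eps.
Local Notation V := (fun n => potential f eps (lattice_point eps n) + (2 * d)%:R).
Local Notation fe := (fun n : L => f (lattice_point eps n)).

Lemma lattice_pointD (n m : L) :
  lattice_point eps (n + m) = lattice_point eps n + lattice_point eps m.
Proof. by rewrite /lattice_point raddfD scalerDr. Qed.

Lemma lattice_pointN (n : L) : lattice_point eps (- n) = - lattice_point eps n.
Proof. by rewrite /lattice_point raddfN scalerN. Qed.

Lemma lattice_point_basis (k : 'I_d) : lattice_point eps (e k) = eps *: basis_vec R k.
Proof. by rewrite /lattice_point map_delta_mx. Qed.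

(** Quotient of the formal ground state exp(- f / (2 eps)) at the two ends of an edge. *)
Definition gibbs_ratio (k : 'I_d) (n : L) : R :=
  expR (- (2 * eps)^-1 * (fe (n + e k) - fe n)).

Lemma gibbs_ratioV k n :
  (gibbs_ratio k n)^-1 = expR (- (2 * eps)^-1 * (fe n - fe (n + e k))).
Proof. by rewrite /gibbs_ratio -expRN; congr expR; ring. Qed.

Lemma potentialE n : V n = \sum_k (gibbs_ratio k n + (gibbs_ratio k (n - e k))^-1).
Proof.
rewrite /potential neighbours_sum.
have -> : (2 * d)%:R = \sum_(k < d) 2 :> R.
  by rewrite sumr_const card_ord -[RHS]mulr_natr natrM.
rewrite -big_split/=; apply: eq_bigr => k _.
rewrite gibbs_ratioV subrK /gibbs_ratio !lattice_pointD lattice_pointN.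
by rewrite lattice_point_basis scalerN; ring.
Qed.

(** V is the sum of the Gibbs ratios at a site and these are positive, so V dominates each of them;
    membership in the domain then gives the summability that [edge_identity] needs. *)
Lemma gibbs_identity psi : schr_dom V psi ->
  (forall k, smb (edge_energy gibbs_ratio psi k)) /\
  dot psi (schr V psi) = \sum_k lsum (edge_energy gibbs_ratio psi k).
Proof.
move=> s.
have t0 k n : 0 <= gibbs_ratio k n by exact: expR_ge0.
have sV : smb (fun n => V n * psi n ^+ 2).
  have := smbM s.1 s.2; congr smb; apply: funext => n; ring.
have le k n : gibbs_ratio k n + (gibbs_ratio k (n - e k))^-1 <= V n.
  by rewrite potentialE (bigD1 k)//= lerDl sumr_ge0// => j _; rewrite addr_ge0 ?invr_ge0.
have [||h1 h2 ->] := @edge_identity V gibbs_ratio psi s.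
- move=> k; apply: smb_le sV _ => n; have p2 := sqr_ge0 (psi n).
  rewrite normrM (ger0_norm (t0 k n)) (ger0_norm p2); apply: ler_wpM2r => //.
  by apply: le_trans (le k n); rewrite lerDl invr_ge0.
- move=> k; apply: smb_le sV _ => n; have p2 := sqr_ge0 (psi n).
  have tn : 0 <= (gibbs_ratio k (n - e k))^-1 by rewrite invr_ge0.
  rewrite normrM (ger0_norm tn) (ger0_norm p2); apply: ler_wpM2r => //.
  by apply: le_trans (le k n); rewrite lerDr.
split => //; rewrite (_ : (fun n => _) = fun=> 0) ?lsum0 ?add0r//.
by apply: funext => n; rewrite /edge_potential potentialE subrr mul0r.
Qed.

Lemma gibbs_ge0 psi : schr_dom V psi -> 0 <= dot psi (schr V psi).
Proof.
move=> s; have [_ ->] := gibbs_identity s; apply: sumr_ge0 => k _.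
by apply: lsum_ge0 => n; apply: edge_energy_ge0; exact: expR_gt0.
Qed.

(** Ground state representation: a positive weight times the squared increment of u = exp(f / (2
    eps)) psi. The Poincare estimate in the wells and the energy of the quasimodes both start from
    it. *)
Lemma gibbs_edgeE psi k n : edge_energy gibbs_ratio psi k n =
  expR (- (fe n + fe (n + e k)) / (2 * eps)) *
  (expR (fe (n + e k) / (2 * eps)) * psi (n + e k)
    - expR (fe n / (2 * eps)) * psi n) ^+ 2.
Proof.
have e2 : 2 * eps != 0 by rewrite mulf_neq0// gt_eqF.
rewrite /edge_energy gibbs_ratioV /gibbs_ratio.
set a := fe n; set b := fe (n + e k); set u := psi n; set v := psi (n + e k).
set E := expR (- (a + b) / (2 * eps)).
set A := expR (a / (2 * eps)); set B := expR (b / (2 * eps)).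
have -> : expR (- (2 * eps)^-1 * (b - a)) = E * A ^+ 2.
  by rewrite expr2 /E /A -!expRD; congr expR; field; rewrite gt_eqF.
have -> : expR (- (2 * eps)^-1 * (a - b)) = E * B ^+ 2.
  by rewrite expr2 /E /B -!expRD; congr expR; field; rewrite gt_eqF.
have EAB : E * A * B = 1.
  by rewrite /E /A /B -!expRD -[RHS]expR0; congr expR; field; rewrite gt_eqF.
have -> : E * A ^+ 2 * u ^+ 2 + E * B ^+ 2 * v ^+ 2 - 2 * (u * v)
  = E * A ^+ 2 * u ^+ 2 + E * B ^+ 2 * v ^+ 2 - 2 * (E * A * B) * (u * v).
  by rewrite EAB mulr1.
by ring.
Qed.

End edge_identity.

(** * Critical points *)

Section mean_value.
Variables (R : realType) (d : nat).
Local Notation e := (basis_vec R).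
Implicit Types (g dg : 'rV[R]_d -> R) (x y v : 'rV[R]_d).

Lemma is_derive_line g x v (t : R) (a : R) : is_derive (x + t *: v) v g a ->
  is_derive t 1 (fun s : R => g (x + s *: v)) a.
Proof.
move=> [dg dga].
have E : (fun h : R => h^-1 *: (((fun s : R => g (x + s *: v)) \o pseudometric_normed_Zmodule.shift t) (h *: (1 : R)) - g (x + t *: v))) =
   (fun h : R => h^-1 *: ((g \o pseudometric_normed_Zmodule.shift (x + t *: v)) (h *: v) - g (x + t *: v))).
  apply: funext => h /=; congr (_ *: (g _ - _)).
  by rewrite [h *: 1]mulr1 scalerDl addrA [RHS]addrC -addrA [_ *: v + _]addrC addrA.
by split; [rewrite /derivable E|rewrite /derive E].
Qed.

Lemma is_derive_shift g y v z a : is_derive (y + z) v g a ->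
  is_derive y v (fun x => g (x + z)) a.
Proof.
move=> [dg dga].
have E : (fun h : R => h^-1 *: (((fun x => g (x + z)) \o pseudometric_normed_Zmodule.shift y) (h *: v) - g (y + z))) =
   (fun h : R => h^-1 *: ((g \o pseudometric_normed_Zmodule.shift (y + z)) (h *: v) - g (y + z))).
  by apply: funext => h /=; rewrite addrA.
by split; [rewrite /derivable E|rewrite /derive E].
Qed.

Lemma mvt01 (h dh : R -> R) (t : R) : (forall s : R, is_derive s 1 h (dh s)) ->
  exists th : R, [/\ 0 <= th, th <= 1 & h t - h 0 = t * dh (th * t)].
Proof.
move=> Dh.
have ch a b : {within `[a, b], continuous h}.
  by apply: derivable_within_continuous => s _; have [] := Dh s.
have [t0|t0|->] := ltgtP t 0; last first.
- by exists 0; rewrite lexx ler01 subrr mul0r.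
- have [c] := MVT_segment (ltW t0) (fun s _ => Dh s) (ch 0 t).
  rewrite in_itv/= subr0 => /andP[c0 ct] ->; exists (c / t); split.
  + by rewrite divr_ge0// ltW.
  + by rewrite ler_pdivrMr// mul1r.
  + by rewrite divfK ?gt_eqF// mulrC.
- have [c] := MVT_segment (ltW t0) (fun s _ => Dh s) (ch t 0).
  rewrite in_itv/= sub0r => /andP[ct c0] hh; exists (c / t); split.
  + by rewrite -mulrNN -invrN divr_ge0// oppr_ge0// ltW.
  + by rewrite ler_ndivrMr// mul1r.
  + by rewrite divfK ?lt_eqF//; move: hh; lra.
Qed.

Lemma line_mvt g dg x v (t : R) : (forall y, is_derive y v g (dg y)) ->
  exists th : R, [/\ 0 <= th, th <= 1 &
    g (x + t *: v) - g x = t * dg (x + (th * t) *: v)].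
Proof.
move=> Dg.
have [th [t0 t1]] := @mvt01 (fun s => g (x + s *: v)) (fun s => dg (x + s *: v)) t
  (fun s => is_derive_line (Dg _)).
by rewrite scale0r addr0 => E; exists th.
Qed.

Lemma rV_norm_le x (a : R) : 0 <= a -> (forall k, `|x 0 k| <= a) -> `|x| <= a.
Proof.
move=> a0 xa; rewrite [Num.norm x]mx_normrE; apply/bigmax_leP; split => // -[i j] _ /=.
by rewrite (ord1 i).
Qed.

Lemma rV_coord_le x k : `|x 0 k| <= `|x|.
Proof.
rewrite [Num.norm x]mx_normrE; apply: (@le_bigmax _ _ _ _ (fun ij => `|x ij.1 ij.2|) (0, k)).
Qed.

Lemma basis_vecE (k j : 'I_d) : e k 0 j = (j == k)%:R.
Proof. by rewrite /basis_vec mxE eqxx. Qed.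

Lemma norm_basis_le (t : R) (k : 'I_d) : `|t *: e k| <= `|t|.
Proof.
apply: rV_norm_le => // j; rewrite mxE basis_vecE normrM.
by case: eqP; rewrite ?normr1 ?mulr1// normr0 mulr0.
Qed.

Lemma partial_is_derive g k : (forall x, derivable g x (e k)) ->
  forall y, is_derive y (e k) g (partial k g y).
Proof. by move=> Dg y; apply: DeriveDef. Qed.

Lemma axis_mvt g k x (t : R) : (forall x, derivable g x (e k)) ->
  exists z, `|z - x| <= `|t| /\ g (x + t *: e k) - g x = t * partial k g z.
Proof.
move=> Dg; have [th [t0 t1 E]] := line_mvt x t (partial_is_derive Dg).
exists (x + (th * t) *: e k); split => //.
rewrite addrC addKr; apply: le_trans (norm_basis_le _ _) _.
by rewrite normrM ger0_norm// ler_piMl.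
Qed.

(* The increment is telescoped along the axis-parallel path from x to x + w. *)
Lemma partials_mvt g x w : (forall k x, derivable g x (e k)) ->
  exists z : 'I_d -> 'rV[R]_d, (forall k, `|z k - x| <= `|w|) /\
    g (x + w) - g x = \sum_k w 0 k * partial k g (z k).
Proof.
move=> Dg.
pose y (m : nat) : 'rV[R]_d := x + \row_j (if (j < m)%N then w 0 j else 0).
have yS (k : 'I_d) : y k.+1 = y k + w 0 k *: e k.
  rewrite /y -addrA; congr (_ + _); apply/rowP => j; rewrite !mxE eqxx/= -/(e k).
  rewrite ltnS; case: (ltngtP j k) => jk.
  - by rewrite (_ : (j == k) = false) ?mulr0 ?addr0//; apply/negbTE; rewrite neq_ltn jk.
  - by rewrite (_ : (j == k) = false) ?mulr0 ?addr0//; apply/negbTE; rewrite neq_ltn jk orbT.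
  - by rewrite (val_inj jk) eqxx mulr1 add0r.
have /choice [th Hth] : forall k : 'I_d, exists th : R, [/\ 0 <= th, th <= 1 &
    g (y k + w 0 k *: e k) - g (y k) = w 0 k * partial k g (y k + (th * w 0 k) *: e k)].
  by move=> k; exact: line_mvt (partial_is_derive (Dg k)).
exists (fun k : 'I_d => y k + (th k * w 0 k) *: e k); split.
  move=> k; have [t0 t1 _] := Hth k.
  rewrite addrAC /y [x + _]addrC addrK; apply: rV_norm_le => // j.
  rewrite !mxE eqxx/=; case: (ltngtP j k) => jk.
  - rewrite (_ : (j == k) = false) ?mulr0 ?addr0 ?rV_coord_le//.
    by apply/negbTE; rewrite neq_ltn jk.
  - rewrite (_ : (j == k) = false) ?mulr0 ?addr0 ?normr0//.
    by apply/negbTE; rewrite neq_ltn jk orbT.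
  - rewrite (val_inj jk) eqxx mulr1 add0r normrM ger0_norm//.
    by apply: le_trans (rV_coord_le w k); rewrite ler_piMl.
have <- : \sum_(k < d) (g (y k.+1) - g (y k)) = g (x + w) - g x.
  rewrite -(big_mkord xpredT (fun k => g (y k.+1) - g (y k))) telescope_sumr//.
  congr (g _ - g _); rewrite /y.
    by congr (_ + _); apply/rowP => j; rewrite mxE ltn_ord.
  by rewrite [X in _ + X](_ : _ = 0) ?addr0//; apply/rowP => j; rewrite !mxE.
by apply: eq_bigr => k _; rewrite yS; have [_ _ ->] := Hth k.
Qed.

Lemma continuous_ball g x (eta : R) : 0 < eta -> continuous g ->
  exists2 r : R, 0 < r & forall y, `|y - x| <= r -> `|g y - g x| <= eta.
Proof.
move=> eta0 cg; have /cvgrPdist_le/(_ _ eta0) := cg x.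
move=> /nbhs_ballP [r /= r0 H]; exists (r / 2); first by rewrite divr_gt0.
move=> y yx; rewrite distrC; apply: H.
rewrite -ball_normE /= distrC; apply: le_lt_trans yx _.
by rewrite ltr_pdivrMr// ltr_pMr// ltr1n.
Qed.

Lemma continuous_ball_fin (I : finType) (g : I -> 'rV[R]_d -> R) x (eta : R) : 0 < eta ->
  (forall i, continuous (g i)) ->
  exists2 r : R, 0 < r & forall i y, `|y - x| <= r -> `|g i y - g i x| <= eta.
Proof.
move=> eta0 cg.
have /choice [r Hr] : forall i, exists r : R, 0 < r /\
    forall y, `|y - x| <= r -> `|g i y - g i x| <= eta.
  by move=> i; have [r] := continuous_ball x eta0 (cg i); exists r.
exists (\big[Num.min/1]_i r i).
  by apply/bigmin_gtP; split => // i _; have [] := Hr i.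
move=> i y le; have [_ H] := Hr i; apply: H; apply: le_trans le _.
exact: bigmin_le.
Qed.

(** The regularity hypothesis only speaks of derivatives along the axes; continuity of the partials
    recovers every direction. *)
Lemma is_derive_dir g x v : (forall k x, derivable g x (e k)) ->
  (forall k, continuous (partial k g)) ->
  is_derive x v g (\sum_k v 0 k * partial k g x).
Proof.
move=> Dg cg; set D := \sum_k _.
suff H : (fun h : R => h^-1 *: ((g \o pseudometric_normed_Zmodule.shift x) (h *: v) - g x)) @ 0^' --> D.
  by apply: DeriveDef; [exact: cvgP H|exact: cvg_lim H].
apply/cvgrPdist_le => eta eta0.
pose S := 1 + \sum_k `|v 0 k|.
have S0 : 0 < S by rewrite ltr_pwDl// sumr_ge0.
have eS : 0 < eta / S by rewrite divr_gt0.
have [r r0 Hr] := continuous_ball_fin x eS cg.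
have V0 : 0 < 1 + `|v| by rewrite ltr_pwDl.
near=> h.
have h0 : h != 0 by near: h; exact: nbhs_dnbhs_neq.
have hr : `|h| * (1 + `|v|) <= r.
  rewrite -ler_pdivlMr//; near: h; apply: dnbhs0_le; exact: divr_gt0.
have [z [zx E]] := partials_mvt x (h *: v) Dg.
rewrite /= [h *: v + x]addrC E /D scaler_sumr -sumrB.
apply: le_trans (ler_norm_sum _ _ _) _.
apply: (@le_trans _ _ (\sum_k `|v 0 k| * (eta / S))).
  apply: ler_sum => k _; rewrite mxE.
  have -> : v 0 k * partial k g x - h^-1 *: (h * v 0 k * partial k g (z k)) =
      v 0 k * (partial k g x - partial k g (z k)).
    by rewrite [_ *: _]mulrA mulrA mulVf// mul1r mulrBr.
  rewrite normrM ler_wpM2l// distrC; apply: Hr.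
  apply: le_trans (zx k) _; rewrite normrZ; apply: le_trans hr.
  by rewrite ler_wpM2l// lerDr.
rewrite -mulr_suml mulrCA ler_piMr ?(ltW eta0)// ler_pdivrMr// mul1r.
by rewrite lerDr.
Unshelve. all: by end_near. Qed.

(** The mean value theorem for f minus the quadratic bound, and then for its first partial, leaves
    th t^2 (P - m) with th >= 0, whose sign does not depend on that of t. *)
Lemma taylor_axis_le f k x (t m : R) : (forall x, derivable f x (e k)) ->
  (forall x, derivable (partial k f) x (e k)) ->
  (forall z, `|z - x| <= `|t| -> partial k (partial k f) z <= m) ->
  f (x + t *: e k) - f x <= t * partial k f x + t ^+ 2 / 2 * m.
Proof.
move=> Df Ddf hm.
pose h (s : R) := f (x + s *: e k) - (s * partial k f x + s ^+ 2 / 2 * m).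
pose dh (s : R) := partial k f (x + s *: e k) - (partial k f x + s * m).
have Dh (s : R) : is_derive s 1 h (dh s).
  have D1 := is_derive_line (x := x) (t := s) (partial_is_derive Df (x + s *: e k)).
  have D2 : is_derive s 1 (fun s : R => s * partial k f x + s ^+ 2 / 2 * m)
      (partial k f x + s * m).
    apply: is_derive_eq; rewrite /GRing.scale/=; lra.
  exact: (is_deriveB D1 D2).
have [th [t0 t1]] := @mvt01 h dh t Dh.
have [z [zx E]] := axis_mvt x (th * t) Ddf.
rewrite /h /dh scale0r addr0 mul0r expr0n !mul0r addr0 subr0.
set A := partial k f _ in E *; set B := partial k f x in E *.
have mz : partial k (partial k f) z <= m.
  apply: hm; apply: le_trans zx _; rewrite normrM ger0_norm//.
  by rewrite ler_piMl.
set P := partial k (partial k f) z in E mz => Eh.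
have : t * (A - (B + th * t * m)) = th * t ^+ 2 * (P - m).
  by rewrite (_ : A = B + th * t * P); [ring|move: E; lra].
have : th * t ^+ 2 * (P - m) <= 0.
  by apply: mulr_ge0_le0; [rewrite mulr_ge0 ?sqr_ge0|rewrite subr_le0].
by move: Eh; set X := f _; set Y := f x; lra.
Qed.

End mean_value.

(** * Gradient and Hessian near a critical point *)

Section critical_points.
Variables (R : realType) (d : nat).
Local Notation e := (basis_vec R).
Implicit Types (x y p : 'rV[R]_d).

Lemma rV_sqr_norm_le x (C : R) : 0 <= C -> (forall k, x 0 k ^+ 2 <= C) -> `|x| ^+ 2 <= C.
Proof.
move=> C0 xC; have : `|x| <= Num.sqrt C.
  by apply: rV_norm_le; rewrite ?sqrtr_ge0// => k; rewrite -sqrtr_sqr ler_wsqrtr.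
by move=> h; rewrite -(sqr_sqrtr C0) lerXn2r ?nnegrE ?sqrtr_ge0.
Qed.

Lemma sum_const_ord (a : R) : \sum_(j < d) a = d%:R * a.
Proof. by rewrite sumr_const card_ord -[LHS]mulr_natl. Qed.

Lemma dist_half_le (a b c c' eta : R) : a = b -> `|a - c| <= eta / 2 ->
  `|b - c'| <= eta / 2 -> `|c - c'| <= eta.
Proof.
move=> <-; rewrite !ler_norml => /andP[h1 h2] /andP[h3 h4].
by apply/andP; split; lra.
Qed.

Lemma unitmx_lower_bound (A : 'M[R]_d) : A \in unitmx ->
  exists2 kap : R, 0 < kap & forall y, kap * `|y| ^+ 2 <= \sum_k (y *m A) 0 k ^+ 2.
Proof.
move=> uA; pose B := \sum_k \sum_j invmx A k j ^+ 2.
have B0 : 0 <= B by apply: sumr_ge0 => k _; apply: sumr_ge0 => j _; exact: sqr_ge0.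
have K0 : 0 < 1 + d%:R * B by rewrite ltr_pwDl// mulr_ge0.
exists (1 + d%:R * B)^-1; first by rewrite invr_gt0.
move=> y; rewrite ler_pdivrMl//; set s := \sum_k _.
have s0 : 0 <= s by apply: sumr_ge0 => k _; exact: sqr_ge0.
apply: rV_sqr_norm_le => [|j]; first by rewrite mulr_ge0 ?(ltW K0).
have -> : y 0 j = \sum_k (y *m A) 0 k * invmx A k j.
  by rewrite -[y in LHS](mulmxK uA) mxE.
apply: le_trans (sqr_sum_le _) _; rewrite card_ord mulrDl mul1r -mulrA.
apply: (@le_trans _ _ (d%:R * (B * s))); last by rewrite lerDr.
rewrite ler_wpM2l// [leRHS]mulrC /s mulr_suml; apply: ler_sum => k _.
rewrite exprMn ler_wpM2l ?sqr_ge0//.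
rewrite /B (bigD1 k)//= (bigD1 j)//= -addrA lerDl addr_ge0//.
  by apply: sumr_ge0 => i _; exact: sqr_ge0.
by apply: sumr_ge0 => i _; apply: sumr_ge0 => i' _; exact: sqr_ge0.
Qed.

Variable f : 'rV[R]_d -> R.
Hypothesis cf : continuous f.
Hypothesis Df : forall k x, derivable f x (e k).
Hypothesis cdf : forall k, continuous (partial k f).
Hypothesis Ddf : forall k j x, derivable (partial j f) x (e k).
Hypothesis cddf : forall k j, continuous (partial k (partial j f)).

(** The second difference of f over a square of side t is t^2 times either mixed partial at some
    point within 2 t of x; continuity carries the comparison back to x. *)
Lemma partial_comm i j x : partial i (partial j f) x = partial j (partial i f) x.
Proof.
apply/eqP; rewrite -subr_eq0 -normr_le0; apply/ler_addgt0Pr => eta eta0.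
rewrite add0r; have e2 : 0 < eta / 2 by rewrite divr_gt0.
have [r1 r10 H1] := continuous_ball x e2 (@cddf i j).
have [r2 r20 H2] := continuous_ball x e2 (@cddf j i).
pose t := Num.min r1 r2 / 2.
have t0 : 0 < t by rewrite divr_gt0// lt_min r10.
have second k l : exists z, `|z - x| <= 2 * t /\
    f (x + t *: e l + t *: e k) - f (x + t *: e k) - (f (x + t *: e l) - f x) =
    t * t * partial k (partial l f) z.
  pose g y := f (y + t *: e k) - f y.
  have Dg y : is_derive y (e l) g (partial l f (y + t *: e k) - partial l f y).
    apply: is_deriveB; last exact: partial_is_derive.
    exact: is_derive_shift (partial_is_derive _ _).
  have [th [th0 th1 E]] := line_mvt x t Dg.
  have [z [zx E']] := axis_mvt (x + (th * t) *: e l) t (@Ddf k l).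
  exists z; split.
    rewrite (_ : z - x = z - (x + (th * t) *: e l) + (th * t) *: e l); last first.
      by rewrite opprD addrA subrK.
    apply: le_trans (ler_normD _ _) _; rewrite mulr_natl mulr2n.
    rewrite gtr0_norm// in zx; apply: lerD => //.
    apply: le_trans (norm_basis_le _ _) _; rewrite normrM !ger0_norm ?(ltW t0)//.
    by rewrite ler_piMl// ltW.
  by rewrite -mulrA -E' -E /g; ring.
have [z1 [z1x E1]] := second i j; have [z2 [z2x E2]] := second j i.
have tr1 : 2 * t <= r1 by rewrite mulrC divfK// ge_min lexx.
have tr2 : 2 * t <= r2 by rewrite mulrC divfK// ge_min lexx orbT.
have {}H1 := H1 _ (le_trans z1x tr1); have {}H2 := H2 _ (le_trans z2x tr2).
have E : partial i (partial j f) z1 = partial j (partial i f) z2.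
  have tt : t * t != 0 by rewrite mulf_neq0// gt_eqF.
  apply/eqP; rewrite -(inj_eq (mulfI tt)); apply/eqP.
  move: E1 E2; rewrite (addrAC x (t *: e i) (t *: e j)).
  move: (f _) (f _) (f _) (f _) => a1 a2 a3 a4.
  move: (partial i (partial j f) z1) (partial j (partial i f) z2) => b1 b2.
  by move=> <- <-; ring.
exact: (dist_half_le E H1 H2).
Qed.

Definition gsq x : R := \sum_k partial k f x ^+ 2.

Lemma gsq_ge0 x : 0 <= gsq x.
Proof. by apply: sumr_ge0 => k _; exact: sqr_ge0. Qed.

Lemma continuous_gsq : continuous gsq.
Proof.
move=> x; apply: (@cvg_sumr _ _ _ (nbhs x) (nbhs_filter x)) => k.
by under eq_fun do rewrite expr2; apply: cvgM; exact: cdf.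
Qed.

Lemma gradE x k : grad f x 0 k = partial k f x.
Proof. by rewrite mxE. Qed.

Lemma gsq_eq0 x : (gsq x == 0) = (grad f x == 0).
Proof.
apply/eqP/eqP => [|g0]; last first.
  by rewrite /gsq big1// => k _; rewrite -gradE g0 mxE expr0n.
move=> s0; apply/rowP => k; rewrite gradE mxE; apply/eqP; rewrite -sqrf_eq0.
by apply/eqP; apply: (psumr_eq0P _ s0) => // j _; exact: sqr_ge0.
Qed.

Lemma enorm_grad x : enorm (grad f x) ^+ 2 = gsq x.
Proof.
rewrite /enorm sqr_sqrtr; last by apply: sumr_ge0 => k _; exact: sqr_ge0.
by apply: eq_bigr => k _; rewrite gradE.
Qed.

Lemma grad_expansion p : grad f p = 0 -> forall eta : R, 0 < eta ->
  exists2 r : R, 0 < r & forall y k, `|y| <= r ->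
    exists2 er : 'I_d -> R, (forall j, `|er j| <= eta) &
      partial k f (p + y) = \sum_j y 0 j * (hess f p j k + er j).
Proof.
move=> gp eta eta0.
have [r r0 Hr] := continuous_ball_fin (I := ('I_d * 'I_d)%type)
  (g := fun ij => partial ij.1 (partial ij.2 f)) p eta0 (fun ij => @cddf ij.1 ij.2).
exists r => // y k yr.
have [z [zp E]] := partials_mvt p y (fun j => @Ddf j k).
exists (fun j => partial j (partial k f) (z j) - partial j (partial k f) p).
  by move=> j; apply: (Hr (j, k)); apply: le_trans yr.
have pk0 : partial k f p = 0 by rewrite -gradE gp mxE.
by rewrite pk0 subr0 in E; rewrite E; apply: eq_bigr => j _; rewrite mxE addrC subrK.
Qed.

Lemma critical_gsq_ge p : grad f p = 0 -> \det (hess f p) != 0 ->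
  exists r kap : R, [/\ 0 < r, 0 < kap &
    forall x, `|x - p| <= r -> kap * `|x - p| ^+ 2 <= gsq x].
Proof.
move=> gp detp; have uA : hess f p \in unitmx by rewrite unitmxE unitfE.
have [kap kap0 Hk] := unitmx_lower_bound uA.
pose D : R := 1 + d%:R * (d%:R * d%:R).
have D0 : 0 < D by rewrite ltr_pwDl// !mulr_ge0.
(* From (a + b)^2 >= a^2 / 2 - b^2 the linear part keeps kap / 2, and this eta limits the remainder
   to kap / 4. *)
have [eta eta0 etaD] : exists2 eta : R, 0 < eta & eta ^+ 2 * D <= kap / 4.
  exists (Num.sqrt (kap / 4 / D)); first by rewrite sqrtr_gt0 !divr_gt0.
  have q0 : 0 <= kap / 4 / D by apply: ltW; rewrite !divr_gt0.
  by rewrite (sqr_sqrtr q0) divfK// gt_eqF.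
have [r r0 Hr] := grad_expansion gp eta0.
exists r, (kap / 4); split => //; first by rewrite divr_gt0.
move=> x xr; set y := x - p in xr *.
have yk k := Hr y k xr.
have key k : (y *m hess f p) 0 k ^+ 2 / 2 - (d%:R * `|y| * eta) ^+ 2 <= partial k f x ^+ 2.
  have [er her E] := yk k.
  have -> : x = p + y by rewrite addrC subrK.
  rewrite E; have -> : \sum_j y 0 j * (hess f p j k + er j) =
      (y *m hess f p) 0 k + \sum_j y 0 j * er j.
    by rewrite mxE -big_split/=; apply: eq_bigr => j _; rewrite mulrDr.
  set a := (y *m _) 0 k; set b := \sum_j _.
  have : `|b| <= d%:R * `|y| * eta.
    apply: le_trans (ler_norm_sum _ _ _) _.
    apply: (@le_trans _ _ (\sum_(j < d) `|y| * eta)).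
      by apply: ler_sum => j _; rewrite normrM ler_pM// rV_coord_le.
    by rewrite sum_const_ord mulrA.
  rewrite ler_norml; set M := _ * eta => /andP[h1 h2].
  have : b ^+ 2 <= M ^+ 2 by nra.
  by have := sqr_ge0 (a + 2 * b); nra.
have : \sum_k ((y *m hess f p) 0 k ^+ 2 / 2 - (d%:R * `|y| * eta) ^+ 2) <= gsq x.
  by apply: ler_sum => k _; exact: key.
rewrite sumrB -mulr_suml sum_const_ord; have := Hk y.
set s := \sum_k _; set n2 := `|y| => h1 h2.
have h3 : eta ^+ 2 * (d%:R * (d%:R * d%:R)) * n2 ^+ 2 <= kap / 4 * n2 ^+ 2.
  apply: ler_wpM2r; first exact: sqr_ge0.
  apply: le_trans etaD; rewrite /D mulrDr lerDr mulr1.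
  exact: sqr_ge0.
move: h2; have -> : d%:R * (d%:R * n2 * eta) ^+ 2 =
   eta ^+ 2 * (d%:R * (d%:R * d%:R)) * n2 ^+ 2 by ring.
by lra.
Qed.

Lemma local_min_grad p : local_minima f p -> grad f p = 0.
Proof.
move=> mp; apply/rowP => k; rewrite gradE mxE.
have [r /= r0 Hr] := (nbhs_ballP _ _).1 mp.
pose h (t : R) := f (p + t *: e k).
have Dh (t : R) : is_derive t 1 h (partial k f (p + t *: e k)).
  exact: is_derive_line (partial_is_derive _ _).
have rr : - r <= r by rewrite (@le_trans _ _ 0)// ?oppr_le0 ltW.
have r00 : 0 \in `]- r, r[ by rewrite in_itv/= oppr_lt0 r0.
have := @derive1_at_min _ h (- r) r 0 rr (fun t _ => @ex_derive _ _ _ _ _ _ _ (Dh t)) r00.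
case.
  move=> t; rewrite in_itv/= => /andP[t1 t2]; rewrite /h scale0r addr0.
  apply: Hr; rewrite -ball_normE /= opprD addrA subrr add0r normrN.
  apply: le_lt_trans (norm_basis_le _ _) _.
  by rewrite ltr_norml t1.
move=> _ <-; have := @derive_val _ _ _ _ _ _ _ (Dh 0).
by rewrite scale0r addr0 => ->.
Qed.

(** Let z = y A, s = |z|^2 and t = 1 / (1 + Lc), where q(z) <= Lc s. Nonnegativity of q at y - t z
    gives q(y) >= 2 t s - t^2 Lc s >= t s, and s controls |y|^2 because A is invertible. *)
Lemma psd_lower_bound (A : 'M[R]_d) : A \in unitmx -> (forall i j, A i j = A j i) ->
  (forall y, 0 <= \sum_i \sum_j y 0 i * y 0 j * A i j) ->
  exists2 c : R, 0 < c & forall y, c * `|y| ^+ 2 <= \sum_i \sum_j y 0 i * y 0 j * A i j.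
Proof.
move=> uA symA psd; have [kap kap0 Hk] := unitmx_lower_bound uA.
pose Lc : R := \sum_i \sum_j `|A i j|.
have L0 : 0 <= Lc by apply: sumr_ge0 => i _; exact: sumr_ge0.
have t0 : 0 < (1 + Lc)^-1 by rewrite invr_gt0 ltr_pwDl.
exists ((1 + Lc)^-1 * kap); first by rewrite mulr_gt0.
move=> y; set t := (1 + Lc)^-1 in t0 *; pose z := y *m A.
pose s := \sum_k z 0 k ^+ 2; pose q (v : 'rV[R]_d) := \sum_i \sum_j v 0 i * v 0 j * A i j.
have s0 : 0 <= s by apply: sumr_ge0 => k _; exact: sqr_ge0.
have zE j : z 0 j = \sum_i y 0 i * A i j by rewrite mxE.
have qz : q z <= Lc * s.
  rewrite /q /Lc mulr_suml; apply: ler_sum => i _; rewrite mulr_suml.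
  apply: ler_sum => j _; rewrite [leRHS]mulrC.
  apply: le_trans (ler_norm _) _; rewrite normrM ler_wpM2r//.
  have zs k : `|z 0 k| ^+ 2 <= s.
    rewrite real_normK ?num_real// /s (bigD1 k)//= lerDl; apply: sumr_ge0 => l _.
    exact: sqr_ge0.
  rewrite normrM; have := zs i; have := zs j.
  by have := sqr_ge0 (`|z 0 i| - `|z 0 j|); nra.
have := psd (y - t *: z).
have -> : \sum_i \sum_j (y - t *: z) 0 i * (y - t *: z) 0 j * A i j =
    q y - 2 * t * s + t ^+ 2 * q z.
  have b1 : \sum_i \sum_j y 0 i * z 0 j * A i j = s.
    rewrite exchange_big/=; apply: eq_bigr => j _.
    transitivity (z 0 j * \sum_i y 0 i * A i j); last by rewrite -zE.
    by rewrite mulr_sumr; apply: eq_bigr => i _; ring.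
  have b2 : \sum_i \sum_j z 0 i * y 0 j * A i j = s.
    rewrite -b1 exchange_big/=; apply: eq_bigr => j _; apply: eq_bigr => i _.
    by rewrite symA; ring.
  transitivity (q y - t * \sum_i \sum_j y 0 i * z 0 j * A i j
     - t * \sum_i \sum_j z 0 i * y 0 j * A i j + t ^+ 2 * q z); last first.
    by rewrite b1 b2; ring.
  rewrite /q !mulr_sumr -!sumrB -big_split/=; apply: eq_bigr => i _.
  rewrite !mulr_sumr -!sumrB -big_split/=; apply: eq_bigr => j _.
  by rewrite !mxE; ring.
rewrite -/(q y) => h.
have ts : t * s <= q y.
  have tL : t * (1 + Lc) = 1 by rewrite /t mulVf// gt_eqF// ltr_pwDl.
  have : t ^+ 2 * q z <= t ^+ 2 * (Lc * s) by rewrite ler_wpM2l// sqr_ge0.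
  have -> : t ^+ 2 * (Lc * s) = t * s - t ^+ 2 * s.
    have -> : t ^+ 2 * (Lc * s) = (t * (1 + Lc)) * (t * s) - t ^+ 2 * s by ring.
    by rewrite tL mul1r.
  have : 0 <= t ^+ 2 * s by rewrite mulr_ge0 ?sqr_ge0.
  by move: h; set T := t ^+ 2 * q z; set X := t ^+ 2 * s; lra.
by apply: le_trans ts; rewrite -mulrA ler_wpM2l// ltW.
Qed.

(** Without a direction of negative curvature the invertible Hessian is bounded below by a positive
    constant, and the expansion of the gradient makes p a local minimum. *)
Lemma saddle_direction p : grad f p = 0 -> \det (hess f p) != 0 -> ~ local_minima f p ->
  exists2 xi : 'rV[R]_d, \sum_k xi 0 k ^+ 2 = 1 &
    \sum_i \sum_j xi 0 i * xi 0 j * hess f p i j < 0.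
Proof.
move=> gp detp; apply: contra_notP => nxi.
have uA : hess f p \in unitmx by rewrite unitmxE unitfE.
have symA i j : hess f p i j = hess f p j i by rewrite !mxE partial_comm.
have psd y : 0 <= \sum_i \sum_j y 0 i * y 0 j * hess f p i j.
  rewrite leNgt; apply/negP => qy; apply: nxi.
  pose s := \sum_k y 0 k ^+ 2.
  have s0 : 0 < s.
    rewrite lt_def; apply/andP; split; last by apply: sumr_ge0 => k _; exact: sqr_ge0.
    apply: contraTneq qy => s0; rewrite -leNgt big1// => i _; rewrite big1// => j _.
    suff -> : y 0 i = 0 by rewrite !mul0r.
    apply/eqP; rewrite -sqrf_eq0; apply/eqP.
    by apply: (psumr_eq0P _ s0) => // k _; exact: sqr_ge0.
  exists ((Num.sqrt s)^-1 *: y).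
    transitivity ((Num.sqrt s)^-1 ^+ 2 * s).
      by rewrite mulr_sumr; apply: eq_bigr => k _; rewrite mxE exprMn.
    by rewrite exprVn sqr_sqrtr ?(ltW s0)// mulVf// gt_eqF.
  rewrite [ltLHS](_ : _ = s^-1 * \sum_i \sum_j y 0 i * y 0 j * hess f p i j).
    by rewrite pmulr_rlt0// invr_gt0.
  have ss : (Num.sqrt s)^-1 * (Num.sqrt s)^-1 = s^-1.
    by rewrite -expr2 exprVn sqr_sqrtr ?(ltW s0).
  rewrite mulr_sumr; apply: eq_bigr => i _; rewrite mulr_sumr; apply: eq_bigr => j _.
  by rewrite !mxE -ss; ring.
have [c c0 Hc] := psd_lower_bound uA symA psd.
have D0 : 0 < 1 + d%:R * d%:R :> R by rewrite ltr_pwDl// mulr_ge0.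
(* The remainder has d^2 terms, each at most eta |y|^2, so this eta keeps their sum below c
   |y|^2. *)
have eta0 : 0 < c / (1 + d%:R * d%:R) by rewrite divr_gt0.
have [r r0 Hr] := grad_expansion gp eta0.
apply/nbhs_ballP; exists r => //= x; rewrite -ball_normE /= => px.
pose y := x - p; have yr : `|y| <= r by rewrite distrC ltW.
have [th [th0 th1]] := line_mvt p 1 (fun z => is_derive_dir z y (fun k => @Df k) (fun k => @cdf k)).
have pyx : p + y = x by rewrite /y addrC subrK.
rewrite !mulr1 mul1r scale1r pyx => E.
have tyr : `|th *: y| <= r.
  by apply: le_trans yr; rewrite normrZ ger0_norm// ler_piMl.
rewrite -subr_ge0 E.
have /choice [er Her] : forall k, exists er : 'I_d -> R,
    (forall j, `|er j| <= c / (1 + d%:R * d%:R)) /\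
    partial k f (p + th *: y) = \sum_j (th *: y) 0 j * (hess f p j k + er j).
  by move=> k; have [er] := Hr _ k tyr; exists er.
have -> : \sum_k y 0 k * partial k f (p + th *: y) = th *
    (\sum_k \sum_j y 0 k * y 0 j * hess f p k j + \sum_k \sum_j y 0 k * y 0 j * er k j).
  rewrite -big_split/= mulr_sumr; apply: eq_bigr => k _.
  rewrite (Her k).2 -big_split/= !mulr_sumr; apply: eq_bigr => j _.
  by rewrite symA !mxE; ring.
apply: mulr_ge0 => //.
have : - (c * `|y| ^+ 2) <= \sum_k \sum_j y 0 k * y 0 j * er k j.
  rewrite lerNl -sumrN.
  apply: (@le_trans _ _ (\sum_(k < d) \sum_(j < d) `|y| ^+ 2 * (c / (1 + d%:R * d%:R)))).
    apply: ler_sum => k _; rewrite -sumrN; apply: ler_sum => j _.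
    apply: le_trans (ler_norm _) _; rewrite normrN !normrM expr2.
    by rewrite ler_pM ?mulr_ge0 ?(Her k).1// ler_pM ?rV_coord_le.
  rewrite sum_const_ord sum_const_ord.
  have -> : d%:R * (d%:R * (`|y| ^+ 2 * (c / (1 + d%:R * d%:R)))) =
    c * `|y| ^+ 2 * (d%:R * d%:R / (1 + d%:R * d%:R)) by ring.
  rewrite ler_piMr ?mulr_ge0 ?(ltW c0) ?sqr_ge0//.
  by rewrite ler_pdivrMr// mul1r lerDr.
by have := Hc y; set q := \sum_i _; lra.
Qed.

End critical_points.

(** * Finiteness of the critical set and bounds away from it *)

Section critical_set.
Variables (R : realType) (d : nat).
Local Notation e := (basis_vec R).
Implicit Types (x y p : 'rV[R]_d).

Lemma norm_le_enorm x : `|x| <= enorm x.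
Proof.
apply: rV_norm_le => [|k]; first exact: sqrtr_ge0.
rewrite -sqrtr_sqr ler_wsqrtr// (bigD1 k)//= lerDl.
by apply: sumr_ge0 => j _; exact: sqr_ge0.
Qed.

Lemma compact_norm_le (M : R) (A : set 'rV[R]_d) : closed A -> (forall x, A x -> `|x| <= M) ->
  compact A.
Proof.
move=> cA AM; apply: bounded_closed_compact cA.
exists M; split; first exact: num_real.
by move=> M' MM' x Ax /=; apply: le_trans (AM x Ax) (ltW MM').
Qed.

Lemma closed_norm_sub_ge p (r : R) : closed [set x : 'rV[R]_d | r <= `|x - p|].
Proof.
apply: (@closed_comp _ _ (fun x => `|x - p|) [set t | r <= t]); last exact: closed_ge.
move=> x _; apply: continuous_comp; last exact: norm_continuous.
by apply: continuousB => //; exact: cst_continuous.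
Qed.

Lemma closed_norm_sub_le p (r : R) : closed [set x : 'rV[R]_d | `|x - p| <= r].
Proof.
apply: (@closed_comp _ _ (fun x => `|x - p|) [set t | t <= r]); last exact: closed_le.
move=> x _; apply: continuous_comp; last exact: norm_continuous.
by apply: continuousB => //; exact: cst_continuous.
Qed.

Lemma pos_lower_bound (g : 'rV[R]_d -> R) (A : set 'rV[R]_d) (b : R) : compact A ->
  continuous g -> (forall x, A x -> b < g x) -> exists2 c, b < c & forall x, A x -> c <= g x.
Proof.
move=> cA cg gA; have [->|/set0P A0] := eqVneq A set0.
  by exists (b + 1); rewrite ?ltrDl.
have [x Ax xmin] := EVT_min_rV A0 cA (continuous_subspaceT cg).
exists (g x); first exact/gA/set_mem.
by move=> y Ay; apply: xmin; exact/mem_set.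
Qed.

Variable f : 'rV[R]_d -> R.
Hypothesis cf : continuous f.
Hypothesis Df : forall k x, derivable f x (e k).
Hypothesis cdf : forall k, continuous (partial k f).
Hypothesis Ddf : forall k j x, derivable (partial j f) x (e k).
Hypothesis cddf : forall k j, continuous (partial k (partial j f)).
Hypothesis nondeg : nondegenerate_critical_points f.
Hypothesis grad_inf : (0 < limf_einf (fun x => (enorm (grad f x))%:E) (@at_infinity R d))%E.

Lemma gsq_infty : exists M c : R, 0 < c /\ forall x, M < `|x| -> c <= gsq f x.
Proof.
move: grad_inf; rewrite limf_einfE => /ereal_sup_gt [_ [V [M _ MV] <-]] iV.
have [c c0 cV] : exists2 c : R, 0 < c & (c%:E <= ereal_inf [set (enorm (grad f x))%:E | x in V])%E.
  move: iV; set I := ereal_inf _; case: I => [r|_|//].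
  - by rewrite lte_fin => r0; exists r.
  - by exists 1 => //; rewrite leey.
exists M, (c ^+ 2); split; first by rewrite exprn_gt0.
move=> x Mx; rewrite -enorm_grad lerXn2r ?nnegrE ?(ltW c0) ?sqrtr_ge0//.
rewrite -lee_fin; apply: le_trans cV _; apply: ereal_inf_lbound.
by exists x => //; apply: MV => /=; apply: lt_le_trans Mx _; exact: norm_le_enorm.
Qed.

Lemma critical_isolated p : grad f p = 0 -> exists2 r : R, 0 < r &
  forall x, `|x - p| <= r -> grad f x = 0 -> x = p.
Proof.
move=> gp; have [r [kap [r0 kap0 H]]] := critical_gsq_ge Ddf cddf gp (nondeg gp).
exists r => // x xr gx; have := H x xr.
have -> : gsq f x = 0 by apply/eqP; rewrite gsq_eq0 gx.
rewrite pmulr_rle0// => h; apply/eqP; rewrite -subr_eq0 -normr_eq0 -sqrf_eq0.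
by rewrite eq_le h sqr_ge0.
Qed.

(** Every point has a ball containing no critical point except possibly its centre. Finitely many
    such balls cover the compact set outside which the gradient is bounded below. *)
Lemma finite_critical : exists ps : seq 'rV[R]_d, uniq ps /\
  forall x, (x \in ps) = (grad f x == 0).
Proof.
have [M [c [c0 Mc]]] := gsq_infty.
pose K := [set x : 'rV[R]_d | `|x - 0| <= M].
have cK : compact K.
  apply: (@compact_norm_le M); first exact: closed_norm_sub_le.
  by move=> x; rewrite /K /= subr0.
have /choice [r Hr] : forall x, exists r : R, 0 < r /\
    forall y, `|y - x| <= r -> grad f y = 0 -> y = x.
  move=> x; have [gx|gx] := eqVneq (grad f x) 0.
    by have [r] := critical_isolated gx; exists r.
  have gx0 : 0 < gsq f x by rewrite lt_def gsq_eq0 gx gsq_ge0.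
  have gx2 : 0 < gsq f x / 2 by rewrite divr_gt0.
  have [r r0 H] := continuous_ball x gx2 (continuous_gsq cdf).
  exists r; split => // y /H h gy; move: h.
  have -> : gsq f y = 0 by apply/eqP; rewrite gsq_eq0 gy.
  by rewrite sub0r normrN gtr0_norm// leNgt ltr_pdivrMr// ltr_pMr// ltr1n.
move: cK; rewrite compact_cover => /(_ _ [set: 'rV[R]_d] (fun x => ball x (r x))).
case; first by move=> x _; exact: ball_open.
  by move=> x _; exists x => //; apply: ballxx; have [] := Hr x.
move=> D _ KD; exists [seq x <- undup (enum_fset D) | grad f x == 0].
split; first by rewrite filter_uniq ?undup_uniq.
move=> x; rewrite mem_filter mem_undup; apply/andP/idP => [[]//|gx]; split => //.
have Kx : K x.
  rewrite /K /= subr0 leNgt; apply/negP => /Mc; rewrite (_ : gsq f x = 0) ?leNgt ?c0//.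
  by apply/eqP; rewrite gsq_eq0.
have [p /= Dp] := KD x Kx; rewrite -ball_normE /= distrC => xp.
by have [_ /(_ x (ltW xp) (eqP gx)) ->] := Hr p.
Qed.

Lemma gsq_away (ps : seq 'rV[R]_d) : (forall x, (x \in ps) = (grad f x == 0)) ->
  forall r : R, 0 < r -> exists2 c : R, 0 < c &
    forall x, (forall p, p \in ps -> r <= `|x - p|) -> c <= gsq f x.
Proof.
move=> psE r r0; have [M [c1 [c10 Mc]]] := gsq_infty.
pose K := [set x : 'rV[R]_d | `|x - 0| <= M] `&`
  \bigcap_(p in [set` ps]) [set x : 'rV[R]_d | r <= `|x - p|].
have cK : compact K.
  apply: (@compact_norm_le M); last by move=> x [] /=; rewrite subr0.
  apply: closedI; first exact: closed_norm_sub_le.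
  by apply: closed_bigI => p _; exact: closed_norm_sub_ge.
have [x [_ Kx]|c2 c20 Hc] := pos_lower_bound cK (continuous_gsq cdf) (b := 0).
  rewrite lt_def gsq_ge0 andbT gsq_eq0 -psE; apply/negP => xps.
  by have := Kx x xps; rewrite /= subrr normr0 leNgt r0.
exists (Num.min c1 c2); first by rewrite lt_min c10.
move=> x xps; have [xM|xM] := leP `|x| M.
  by rewrite ge_min; apply/orP; right; apply: Hc; split => //=; rewrite subr0.
by rewrite ge_min Mc.
Qed.

(** A point x of the annulus with f x <= f p would be a local minimum too, hence a second critical
    point, against isolation; compactness makes the gap uniform. An annulus is used because a
    lattice edge crossing a sphere has its ends off the sphere. *)
Lemma local_min_annulus p : local_minima f p ->
  exists2 r0 : R, 0 < r0 & forall r : R, 0 < r -> r <= r0 ->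
    exists2 eta : R, 0 < eta &
      forall x, r / 2 <= `|x - p| -> `|x - p| <= r -> f p + eta <= f x.
Proof.
move=> mp; have gp := local_min_grad Df mp.
have [r1 r10 iso] := critical_isolated gp.
have [r2 /= r20 Hr2] := (nbhs_ballP _ _).1 mp.
pose r0 := Num.min r1 r2 / 2.
have m0 : 0 < Num.min r1 r2 by rewrite lt_min r10.
exists r0; first by rewrite divr_gt0.
move=> r rp rr0.
have rm : r < Num.min r1 r2 by apply: le_lt_trans rr0 _; rewrite /r0; lra.
move: rm; rewrite lt_min => /andP[rr1 rr2].
pose A := [set x : 'rV[R]_d | r / 2 <= `|x - p|] `&` [set x : 'rV[R]_d | `|x - p| <= r].
have cA : compact A.
  apply: (@compact_norm_le (r + `|p|)).
    by apply: closedI; [exact: closed_norm_sub_ge|exact: closed_norm_sub_le].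
  move=> x [_ /= xr]; rewrite -[x](subrK p).
  by apply: le_trans (ler_normD _ _) _; rewrite lerD2r.
have [x [/= x1 x2]|c fc Hc] := pos_lower_bound cA cf (b := f p).
  rewrite ltNge; apply/negP => fx.
  have mx : local_minima f x.
    apply/nbhs_ballP; exists (r2 - r); first by rewrite /= subr_gt0.
    move=> y; rewrite -ball_normE /= => xy.
    apply: le_trans fx _; apply: Hr2; rewrite -ball_normE /=.
    rewrite -(subrKA x); apply: le_lt_trans (ler_normD _ _) _.
    by rewrite (distrC p); move: xy x2; lra.
  have xp := iso x (le_trans x2 (ltW rr1)) (local_min_grad Df mx).
  by move: x1; rewrite xp subrr normr0; lra.
exists (c - f p); first by rewrite subr_gt0.
by move=> x x1 x2; rewrite addrC subrK; apply: Hc.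
Qed.

End critical_set.

(** * Escape fields *)

Section exponential_bounds.
Variable R : realType.
Implicit Types s u : R.

Lemma expR_le_inv u : u < 1 -> expR u <= (1 - u)^-1.
Proof.
move=> u1; have u0 : 0 < 1 - u by rewrite subr_gt0.
rewrite -[leLHS]invrK -expRN lef_pV2 ?posrE ?expR_gt0//.
by have := expR_ge1Dx (- u).
Qed.

Lemma expR_le_quad u : `|u| <= 1 / 2 -> expR u <= 1 + u + 2 * u ^+ 2.
Proof.
rewrite ler_norml => /andP[h1 h2].
have u1 : u < 1 by lra.
apply: le_trans (expR_le_inv u1) _.
rewrite -[leLHS]div1r ler_pdivrMr ?subr_gt0//.
have := sqr_ge0 u; have : 0 <= u ^+ 2 * (1 - 2 * u) by rewrite mulr_ge0 ?sqr_ge0//; lra.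
nra.
Qed.

(** This is 2 cosh(s / 2). With s a partial derivative of f it is the leading part of the two terms
    of V + 2 d along that axis. *)
Definition cosh2 s : R := expR (s / 2) + expR (- (s / 2)).

Let sinh_mvt v : exists th : R, [/\ 0 <= th, th <= 1 &
  expR v - expR (- v) = v * (expR (th * v) + expR (- (th * v)))].
Proof.
have Dh (t : R) : is_derive t 1 (fun t : R => expR t - expR (- t)) (expR t + expR (- t)).
  have D1 := is_derive_expR t.
  have D2 : is_derive t 1 (fun t : R => expR (- t)) (- expR (- t)).
    have DN : is_derive t 1 (fun t : R => - t) (-1) by exact: is_deriveN.
    have := @is_derive1_comp _ _ _ t _ _ (is_derive_expR (- t)) DN.
    by rewrite mulrN1.
  by have := is_deriveB D1 D2; rewrite opprK.
have [th [t0 t1]] := mvt01 v Dh.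
by rewrite oppr0 subrr subr0 => E; exists th.
Qed.

Let cosh2_sinh s : cosh2 s = 2 + (expR (s / 4) - expR (- (s / 4))) ^+ 2.
Proof.
rewrite /cosh2 (_ : s / 2 = s / 4 + s / 4); last by field.
rewrite opprD !expRD expRN; set E := expR _.
by field; rewrite gt_eqF// expR_gt0.
Qed.

Let cosh_ge2 u : 2 <= expR u + expR (- u).
Proof. by have := cosh2_sinh (2 * u); rewrite /cosh2 mulrAC divff// mul1r => ->; rewrite lerDl sqr_ge0. Qed.

Lemma cosh2_ge s : 2 + s ^+ 2 / 4 <= cosh2 s.
Proof.
rewrite cosh2_sinh; have [th [t0 t1 ->]] := sinh_mvt (s / 4).
rewrite lerD2l exprMn; have := cosh_ge2 (th * (s / 4)); set C := _ + _ => C2.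
have : 4 <= C ^+ 2 by nra.
by move=> C4; have := sqr_ge0 (s / 4); rewrite !exprMn; nra.
Qed.

(** The quadratic coefficient 1 / 4 agrees with that of [cosh2_ge]. A larger one would consume the
    small margin between the lengths of the gradient and of the field. *)
Lemma cosh2_le s : `|s| <= 1 -> cosh2 s <= 2 + s ^+ 2 / 4 * (1 + s ^+ 2).
Proof.
move=> s1; rewrite cosh2_sinh; have [th [t0 t1 ->]] := sinh_mvt (s / 4).
set w := th * (s / 4).
have w2 : w ^+ 2 <= s ^+ 2 / 16.
  rewrite /w exprMn (_ : (s / 4) ^+ 2 = s ^+ 2 / 16); last by field.
  by rewrite ler_piMl ?divr_ge0 ?sqr_ge0// expr_le1.
have s2 : s ^+ 2 <= 1 by rewrite -(real_normK (num_real s)) expr_le1.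
have s20 := sqr_ge0 s; have w20 := sqr_ge0 w.
have w1 : -1 < w < 1 by apply/andP; split; nra.
case/andP: w1 => wm wp.
have C1 : expR w + expR (- w) <= 2 * (1 + 2 * w ^+ 2).
  have h1 := expR_le_inv wp.
  have h2 : expR (- w) <= (1 - - w)^-1 by apply: expR_le_inv; lra.
  apply: le_trans (lerD h1 h2) _; rewrite opprK.
  have -> : (1 - w)^-1 + (1 + w)^-1 = 2 / (1 - w ^+ 2).
    by field; apply/and3P; split; apply/eqP; nra.
  have p : 0 < 1 - w ^+ 2 by nra.
  by rewrite ler_pdivrMr//; nra.
have C0 : 0 <= expR w + expR (- w) by rewrite addr_ge0 ?expR_ge0.
rewrite lerD2l exprMn; set C := _ + _ in C0 C1 *.
have : C ^+ 2 <= (2 * (1 + 2 * w ^+ 2)) ^+ 2 by rewrite lerXn2r// nnegrE; nra.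
move=> h; apply: (@le_trans _ _ ((s / 4) ^+ 2 * (2 * (1 + s ^+ 2 / 8)) ^+ 2)).
  rewrite ler_wpM2l ?sqr_ge0//; apply: le_trans h _.
  by rewrite lerXn2r ?nnegrE//; nra.
have -> : (s / 4) ^+ 2 * (2 * (1 + s ^+ 2 / 8)) ^+ 2 =
  s ^+ 2 / 4 * (1 + s ^+ 2 / 8) ^+ 2 by field.
rewrite ler_wpM2l ?divr_ge0//; nra.
Qed.

End exponential_bounds.

(** * Lower bounds for the potential and the field potential *)

Section potential_bounds.
Variables (R : realType) (d : nat).
Local Notation e := (basis_vec R).
Implicit Types (x y p : 'rV[R]_d).

Variable f : 'rV[R]_d -> R.
Hypothesis Df : forall k x, derivable f x (e k).
Hypothesis Ddf : forall k j x, derivable (partial j f) x (e k).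

Lemma potential_sum (eps : R) x : potential f eps x + (2 * d)%:R = \sum_k
  (expR (- (2 * eps)^-1 * (f (x + eps *: e k) - f x))
   + expR (- (2 * eps)^-1 * (f (x - eps *: e k) - f x))).
Proof.
rewrite /potential neighbours_sum.
have -> : (2 * d)%:R = \sum_(k < d) 2 :> R by rewrite sum_const_ord natrM mulrC.
by rewrite -big_split/=; apply: eq_bigr => k _; rewrite scalerN; ring.
Qed.

Lemma gibbs_term_ge (eps m t : R) x k : 0 < eps -> `|t| = eps ->
  (forall z, `|z - x| <= eps -> partial k (partial k f) z <= m) ->
  expR (- (t / eps * partial k f x / 2)) * (1 - eps * m / 4) <=
  expR (- (2 * eps)^-1 * (f (x + t *: e k) - f x)).
Proof.
move=> e0 te hm.
have T : f (x + t *: e k) - f x <= t * partial k f x + t ^+ 2 / 2 * m.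
  by apply: taylor_axis_le => //; rewrite te.
have t2 : t ^+ 2 = eps ^+ 2 by rewrite -te real_normK// num_real.
apply: (@le_trans _ _ (expR (- (t / eps * partial k f x / 2) + - (eps * m / 4)))).
  rewrite expRD ler_wpM2l ?expR_ge0//.
  exact: expR_ge1Dx.
rewrite ler_expR t2 in T *.
have -> : - (t / eps * partial k f x / 2) + - (eps * m / 4) =
   - (2 * eps)^-1 * (t * partial k f x + eps ^+ 2 / 2 * m).
  by field; rewrite gt_eqF.
by rewrite !mulNr lerN2 ler_wpM2l// invr_ge0 mulr_ge0// ltW.
Qed.

Lemma gibbs_pair_ge (eps m : R) x k : 0 < eps ->
  (forall z, `|z - x| <= eps -> partial k (partial k f) z <= m) ->
  cosh2 (partial k f x) * (1 - eps * m / 4) <=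
  expR (- (2 * eps)^-1 * (f (x + eps *: e k) - f x))
   + expR (- (2 * eps)^-1 * (f (x - eps *: e k) - f x)).
Proof.
move=> e0 hm; rewrite /cosh2 addrC mulrDl lerD//.
  have := @gibbs_term_ge eps m eps x k e0 (gtr0_norm e0) hm.
  by rewrite divff ?gt_eqF// mul1r.
have := @gibbs_term_ge eps m (- eps) x k e0 _ hm.
by rewrite normrN gtr0_norm// mulNr divff ?gt_eqF// mulN1r mulNr opprK scaleNr; apply.
Qed.

Variable K : R.
Hypothesis K0 : 0 < K.
Hypothesis hessK : forall k j x, `|partial k (partial j f) x| <= K.

(** In (2 + a^2 / 4) (1 - eps K / 4), the condition eps K <= 2 leaves at least half of a^2 / 4, and
    the constant loses eps K / 2 per axis. *)
Lemma potential_ge (eps : R) x : 0 < eps -> eps * K <= 2 ->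
  gsq f x / 8 - d%:R * K * eps / 2 <= potential f eps x.
Proof.
move=> e0 eK; rewrite -(lerD2r (2 * d)%:R) potential_sum.
have -> : gsq f x / 8 - d%:R * K * eps / 2 + (2 * d)%:R =
   \sum_k (partial k f x ^+ 2 / 8 - K * eps / 2 + 2).
  rewrite !big_split/= -mulr_suml -/(gsq f x) !sum_const_ord natrM.
  by ring.
apply: ler_sum => k _.
apply: le_trans (@gibbs_pair_ge eps K x k e0 _); last first.
  by move=> z _; apply: le_trans (ler_norm _) (hessK _ _ _).
have := cosh2_ge (partial k f x); have := sqr_ge0 (partial k f x).
set a := partial k f x; set C := cosh2 a => a0 C0.
have : (2 + a ^+ 2 / 4) * (1 - eps * K / 4) <= C * (1 - eps * K / 4).
  by rewrite ler_wpM2r//; lra.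
have : 0 <= a ^+ 2 * (2 - eps * K) by rewrite mulr_ge0 ?sqr_ge0// subr_ge0.
by nra.
Qed.

(* The edge potential for the weights [exp (- X_k / 2)], with [X_k] taken at the
   midpoint of the edge. *)
Definition field_potential (X : 'I_d -> 'rV[R]_d -> R) (eps : R) x : R :=
  potential f eps x + (2 * d)%:R -
  \sum_k (expR (- (X k (x + (eps / 2) *: e k) / 2)) + expR (X k (x - (eps / 2) *: e k) / 2)).

(** [b k] is meant as the field at x and [g k] as a lower bound for its derivative along the axis.
    The factors 1 - eps m / 4 and exp(- eps g / 4) carry the Laplacian of f and the divergence of
    the field. *)
Lemma field_potential_ge (X : 'I_d -> 'rV[R]_d -> R) (eps : R) x (b m g : 'I_d -> R) :
  0 < eps ->
  (forall k z, `|z - x| <= eps -> partial k (partial k f) z <= m k) ->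
  (forall k, b k + eps / 2 * g k <= X k (x + (eps / 2) *: e k)) ->
  (forall k, X k (x - (eps / 2) *: e k) <= b k - eps / 2 * g k) ->
  \sum_k (cosh2 (partial k f x) * (1 - eps * m k / 4)
          - cosh2 (b k) * expR (- (eps * g k / 4))) <= field_potential X eps x.
Proof.
move=> e0 hm hp hn; rewrite /field_potential potential_sum -sumrB.
apply: ler_sum => k _; apply: lerB; first exact: (gibbs_pair_ge e0 (@hm k)).
rewrite /cosh2 addrC mulrDl -!expRD; apply: lerD; rewrite ler_expR.
  by have := hn k; lra.
by have := hp k; lra.
Qed.

End potential_bounds.

(** CA and CB lie in [2, 2 + n], so in the terms of order eps they may be replaced by 2 at a cost of
    order k1 n. What remains is CA - CB + eps / 2 (G - M), up to an error quadratic in eps. *)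
Lemma cosh_exp_pair_ge (R : realType) (eps k1 n CA CB M G E : R) :
  0 < eps -> 0 < k1 -> 0 < n -> n <= 1 -> 2 <= CA -> 2 <= CB ->
  CA <= 2 + n -> CB <= 2 + n -> `|M| <= k1 -> `|G| <= k1 ->
  E <= 1 + - (eps * G / 4) + 2 * (- (eps * G / 4)) ^+ 2 ->
  CA - CB - (eps / 4 * (2 * M - 2 * G + 2 * k1 * n) + eps ^+ 2 * k1 ^+ 2 / 2) <=
  CA * (1 - eps * M / 4) - CB * E.
Proof.
move=> e0 k10 n0 n1 ca2 cb2 ca cb.
rewrite !ler_norml => /andP[m1 m2] /andP[g1 g2] hE.
have hm : M * (CA - 2) <= k1 * n by nra.
have hg : - (k1 * n) <= G * (CB - 2) by nra.
have hCE : CB * E <= CB * (1 + - (eps * G / 4) + 2 * (- (eps * G / 4)) ^+ 2).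
  by rewrite ler_wpM2l//; lra.
have g2k : G ^+ 2 <= k1 ^+ 2 by nra.
have hq : CB * (eps ^+ 2 * G ^+ 2) <= 4 * (eps ^+ 2 * k1 ^+ 2).
  apply: ler_pM => //; [lra|by rewrite mulr_ge0 ?sqr_ge0|lra|].
  by rewrite ler_wpM2l ?sqr_ge0.
have hm' : eps * (M * (CA - 2)) <= eps * (k1 * n) by rewrite ler_wpM2l// ltW.
have hg' : eps * - (k1 * n) <= eps * (G * (CB - 2)) by rewrite ler_wpM2l// ltW.
have -> : CA * (1 - eps * M / 4) = CA - eps * (M * (CA - 2)) / 4 - eps * M / 2 by field.
move: hCE; have -> : CB * (1 + - (eps * G / 4) + 2 * (- (eps * G / 4)) ^+ 2) =
  CB - eps * (G * (CB - 2)) / 4 - eps * G / 2 + CB * (eps ^+ 2 * G ^+ 2) / 8 by field.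
move: hm' hg' hq; set A1 := eps * (M * _); set A2 := eps * (G * _).
set A3 := CB * (_ * G ^+ 2); set A4 := CB * E.
have -> : eps / 4 * (2 * M - 2 * G + 2 * k1 * n) + eps ^+ 2 * k1 ^+ 2 / 2 =
   eps * M / 2 - eps * G / 2 + eps * (k1 * n) / 2 + eps ^+ 2 * k1 ^+ 2 / 2 by field.
set A5 := eps * M; set A6 := eps * G.
have -> : eps * - (k1 * n) = - (eps * (k1 * n)) by ring.
set A7 := eps * (k1 * n); set A8 := eps ^+ 2 * k1 ^+ 2.
by lra.
Qed.

(** * Positivity of the field potential near a saddle *)

Section saddle_estimates.
Variables (R : realType) (d : nat).
Local Notation e := (basis_vec R).
Implicit Types (x y p : 'rV[R]_d).

Variable f : 'rV[R]_d -> R.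
Hypothesis Df : forall k x, derivable f x (e k).
Hypothesis cdf : forall k, continuous (partial k f).
Hypothesis Ddf : forall k j x, derivable (partial j f) x (e k).
Hypothesis cddf : forall k j, continuous (partial k (partial j f)).
Variable K : R.
Hypothesis K0 : 0 < K.
Hypothesis hessK : forall k j x, `|partial k (partial j f) x| <= K.

(* [lra] after clearing a long local context, which it would otherwise scan. *)
Local Ltac quick_lra := clear - Df cdf Ddf cddf K0 hessK; lra.

(* The strict norm inequality with a larger divergence at [p] is what makes the field
   potential of [F] positive of order [eps] around the saddle [p]. *)
Definition escape_field p (del : R) (F dF : 'I_d -> 'rV[R]_d -> R) : Prop :=
  [/\ 0 < del /\ del <= 1,
    forall x, \sum_k F k x ^+ 2 <= (1 - del) ^+ 2 * gsq f x,
    forall k x, is_derive x (e k) (F k) (dF k x),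
    (forall k, continuous (dF k)) /\ (forall k x, `|dF k x| <= K * (1 + 2 * d%:R)) &
    \sum_k partial k (partial k f) p < \sum_k dF k p].

(* Reflecting [grad f] across the hyperplane orthogonal to the descent direction [xi]
   preserves its length and adds [- 2 * hess f p xi xi > 0] to its divergence at [p]. *)
Lemma escape_field_exists p (xi : 'rV[R]_d) : \sum_k xi 0 k ^+ 2 = 1 ->
  \sum_i \sum_j xi 0 i * xi 0 j * hess f p i j < 0 ->
  exists del F dF, escape_field p del F dF.
Proof.
move=> xi1; set q := \sum_i _ => q0.
pose T := \sum_k partial k (partial k f) p.
(* Chosen so that del (T - 2 q) <= - q: shortening the field by 1 - del costs at most half of the
   divergence - 2 q gained by the reflection. *)
pose del : R := - q / (1 + `|T| - 2 * q).
have D0 : 0 < 1 + `|T| - 2 * q.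
  by have := normr_ge0 T; set a := `|T|; move: q0; lra.
have del0 : 0 < del by rewrite divr_gt0// oppr_gt0.
have del1 : del <= 1.
  by rewrite /del ler_pdivrMr// mul1r; have := normr_ge0 T; set a := `|T|; move: q0; lra.
pose F k x := (1 - del) * (partial k f x - 2 * xi 0 k * \sum_j xi 0 j * partial j f x).
pose dF k x := (1 - del) * (partial k (partial k f) x
  - 2 * xi 0 k * \sum_j xi 0 j * partial k (partial j f) x).
have xi_le k : `|xi 0 k| <= 1.
  rewrite -(@expr_le1 _ 2)// real_normK ?num_real// -xi1 (bigD1 k)//= lerDl.
  by apply: sumr_ge0 => j _; exact: sqr_ge0.
exists del, F, dF; split => //.
- move=> x; rewrite le_eqVlt; apply/orP; left; apply/eqP; pose s := \sum_j xi 0 j * partial j f x.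
  transitivity ((1 - del) ^+ 2 * (gsq f x - 4 * s * s + 4 * s ^+ 2 * \sum_k xi 0 k ^+ 2)).
    transitivity ((1 - del) ^+ 2 * (gsq f x - 4 * s * (\sum_j xi 0 j * partial j f x)
        + 4 * s ^+ 2 * \sum_k xi 0 k ^+ 2)); last by [].
    rewrite /gsq [4 * s * _]mulr_sumr [4 * s ^+ 2 * _]mulr_sumr -sumrB -big_split/= mulr_sumr.
    by apply: eq_bigr => k _; rewrite /F -/s; ring.
  by rewrite xi1; ring.
- move=> k x; apply: is_deriveZ.
  apply: is_deriveB; first exact: partial_is_derive.
  apply: is_deriveZ; rewrite -fct_sumE.
  apply: is_derive_sum => j; apply: is_deriveZ; exact: partial_is_derive.
- split => [k x|k x].
    have N := nbhs_filter x.
    have cs : (fun x => \sum_j xi 0 j * partial k (partial j f) x) @ x -->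
        \sum_j xi 0 j * partial k (partial j f) x.
      by apply: (@cvg_sumr _ _ _ (nbhs x) N) => j; apply: cvgMr; exact: cddf.
    have := cvgB (FF := N) (@cddf k k x) (cvgMr (FF := N) (a := 2 * xi 0 k) cs).
    by move=> /(cvgMr (FF := N) (a := 1 - del)).
  rewrite /dF normrM ger0_norm ?subr_ge0//.
  apply: (@le_trans _ _ (1 * (K * (1 + 2 * d%:R)))); last by rewrite mul1r.
  apply: ler_pM => //; [by rewrite subr_ge0|by move: del0; lra|].
  apply: le_trans (ler_normB _ _) _; rewrite mulrDr mulr1; apply: lerD => //.
  rewrite 2!normrM ger0_norm// (_ : K * (2 * d%:R) = 2 * 1 * (d%:R * K)); last by ring.
  rewrite ler_pM// ?mulr_ge0// ?ler_wpM2l//.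
  apply: le_trans (ler_norm_sum _ _ _) _; rewrite -sum_const_ord; apply: ler_sum => j _.
  by rewrite normrM -[leRHS]mul1r ler_pM.
- have -> : \sum_k dF k p = (1 - del) * (T - 2 * q).
    rewrite /T /q mulr_sumr -sumrB mulr_sumr; apply: eq_bigr => k _.
    rewrite /dF mulrBr mulrBr; congr (_ - _); congr (_ * _).
    rewrite -mulrA; congr (_ * _); rewrite mulr_sumr; apply: eq_bigr => j _.
    by rewrite mxE mulrA.
  rewrite -/T; have : del * (T - 2 * q) <= - q.
    rewrite /del mulrAC ler_pdivrMr// ler_wpM2l ?oppr_ge0 ?(ltW q0)//.
    by have := ler_norm T; set a := `|T|; lra.
  by move: q0; lra.
Qed.

(** As b_k^2 <= gsq <= del, the correction 1 + b_k^2 in [cosh2_le] is at most 1 + del, and (1 + del)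
    (1 - del)^2 <= 1 - del leaves the gain del / 4. *)
Lemma cosh2_gain (del : R) (b : 'I_d -> R) x : 0 < del -> del <= 1 ->
  \sum_k b k ^+ 2 <= (1 - del) ^+ 2 * gsq f x -> gsq f x <= del ->
  del / 4 * gsq f x <= \sum_k (cosh2 (partial k f x) - cosh2 (b k)) /\
  forall k, [/\ partial k f x ^+ 2 <= gsq f x, b k ^+ 2 <= gsq f x,
    cosh2 (partial k f x) <= 2 + gsq f x & cosh2 (b k) <= 2 + gsq f x].
Proof.
move=> d0 d1 bs gd; have g0 := gsq_ge0 f x.
have bg : \sum_k b k ^+ 2 <= gsq f x.
  by apply: le_trans bs _; rewrite ler_piMl// expr_le1 ?subr_ge0//; lra.
have ak k : partial k f x ^+ 2 <= gsq f x.
  by rewrite /gsq (bigD1 k)//= lerDl; apply: sumr_ge0 => j _; exact: sqr_ge0.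
have bk k : b k ^+ 2 <= gsq f x.
  by apply: le_trans bg; rewrite (bigD1 k)//= lerDl; apply: sumr_ge0 => j _; exact: sqr_ge0.
have small (s : R) : s ^+ 2 <= gsq f x -> `|s| <= 1.
  move=> sg; rewrite -(@expr_le1 _ 2)// real_normK ?num_real//.
  exact: le_trans sg (le_trans gd d1).
have up (s : R) : s ^+ 2 <= gsq f x -> cosh2 s <= 2 + gsq f x.
  move=> sg; apply: le_trans (cosh2_le (small s sg)) _; have := sqr_ge0 s.
  by move: sg gd d1 g0; set S := s ^+ 2; set G := gsq f x; nra.
split; last by move=> k; split => //; exact: up.
apply: (@le_trans _ _ (\sum_k (partial k f x ^+ 2 / 4 - (1 + del) / 4 * b k ^+ 2))).
  rewrite sumrB -mulr_suml -/(gsq f x) -mulr_sumr.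
  move: bs; set B := \sum_k _; set G := gsq f x in g0 * => bs.
  have : (1 + del) / 4 * B <= (1 + del) / 4 * ((1 - del) ^+ 2 * G).
    by rewrite ler_wpM2l//; lra.
  have -> : (1 + del) / 4 * ((1 - del) ^+ 2 * G) =
    (1 - del) / 4 * G - (del ^+ 2 * (1 - del)) / 4 * G by field.
  have : 0 <= (del ^+ 2 * (1 - del)) / 4 * G.
    apply: mulr_ge0 => //; apply: divr_ge0 => //.
    by apply: mulr_ge0; rewrite ?sqr_ge0 ?subr_ge0.
  by lra.
apply: ler_sum => k _; have := cosh2_ge (partial k f x); have := cosh2_le (small _ (bk k)).
have := bk k; have := sqr_ge0 (b k); set B := b k ^+ 2 => B0 Bg.
have : B / 4 * (1 + B) <= (1 + del) / 4 * B.
  rewrite mulrAC [leLHS]mulrC mulrA; rewrite -mulrA -mulrA.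
  by nra.
by lra.
Qed.

(** For the zone where the cutoff varies: the field is merely Lipschitz there and its increments
    count as a loss of order eps, affordable wherever [gsq] is bounded below. *)
Lemma field_potential_transition (del L eps : R) (X : 'I_d -> 'rV[R]_d -> R) x :
  0 < del -> del <= 1 -> 0 <= L -> 0 < eps -> eps * L <= 2 ->
  \sum_k X k x ^+ 2 <= (1 - del) ^+ 2 * gsq f x -> gsq f x <= del ->
  (forall k, `|X k (x + (eps / 2) *: e k) - X k x| <= eps / 2 * L) ->
  (forall k, `|X k (x - (eps / 2) *: e k) - X k x| <= eps / 2 * L) ->
  del / 4 * gsq f x - eps * (d%:R * (K + 2 * L)) <= field_potential f X eps x.
Proof.
move=> d0 d1 L0 e0 eL Xs gd Xp Xn.
have [gain bnd] := cosh2_gain d0 d1 Xs gd.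
have h := @field_potential_ge _ _ f Df Ddf X eps x (fun k => X k x) (fun=> K) (fun=> - L) e0.
apply: le_trans (h _ _ _); last 3 first.
- by move=> k z _; apply: le_trans (ler_norm _) (hessK _ _ _).
- by move=> k; have := Xp k; rewrite ler_norml => /andP[h1 h2]; move: h1; quick_lra.
- by move=> k; have := Xn k; rewrite ler_norml => /andP[h1 h2]; move: h2; lra.
have -> : eps * (d%:R * (K + 2 * L)) = \sum_(k < d) eps * (K + 2 * L).
  by rewrite sum_const_ord; ring.
apply: le_trans (_ : \sum_k (cosh2 (partial k f x) - cosh2 (X k x))
   - \sum_(k < d) eps * (K + 2 * L) <= _); first by rewrite lerD2r.
rewrite -sumrB; apply: ler_sum => k _; have [_ _ ca cb] := bnd k.
have ca2 := cosh2_ge (partial k f x); have cb2 := cosh2_ge (X k x).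
have := sqr_ge0 (partial k f x); have := sqr_ge0 (X k x).
have g1 := le_trans gd d1; have e1 : expR (- (eps * - L / 4)) <= 1 + eps * L / 2.
  have -> : - (eps * - L / 4) = eps * L / 4 by field.
  have eL0 : 0 <= eps * L by exact: mulr_ge0 (ltW e0) L0.
  have hl : `|eps * L / 4| <= 1 / 2 by rewrite ger0_norm; lra.
  by apply: le_trans (expR_le_quad hl) _; nra.
move: e1; set E := expR _; set CA := cosh2 (partial k f x) in ca ca2 *.
set CB := cosh2 (X k x) in cb cb2 *; move=> e1 x0 a0.
have : CB * E <= CB * (1 + eps * L / 2) by rewrite ler_wpM2l//; lra.
have : CB * (eps * L) <= 3 * (eps * L).
  by rewrite ler_wpM2r//; [exact: (mulr_ge0 (ltW e0) L0)|lra].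
have : CA * (eps * K) <= 3 * (eps * K).
  by rewrite ler_wpM2r//; [exact: (mulr_ge0 (ltW e0) (ltW K0))|lra].
have := mulr_ge0 (ltW e0) L0; have := mulr_ge0 (ltW e0) (ltW K0).
by lra.
Qed.

(** At p the gain of [cosh2_gain] degenerates and is only used to be nonnegative. Positivity comes
    from the first-order term (eps / 2) (div F - Delta f), positive at p and nearby by
    continuity. *)
Lemma field_potential_core p del F dF : grad f p = 0 -> escape_field p del F dF ->
  exists r c eps1 : R, [/\ 0 < r, 0 < c, 0 < eps1 &
    forall (X : 'I_d -> 'rV[R]_d -> R) (eps : R) x, 0 < eps -> eps <= eps1 ->
      `|x - p| <= r ->
      (forall k, X k (x + (eps / 2) *: e k) = F k (x + (eps / 2) *: e k)) ->
      (forall k, X k (x - (eps / 2) *: e k) = F k (x - (eps / 2) *: e k)) ->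
      c * eps <= field_potential f X eps x].
Proof.
move=> gp [[d0 d1] Fs DF [cdF dFK] gap].
pose gam := \sum_k dF k p - \sum_k partial k (partial k f) p.
have gam0 : 0 < gam by rewrite subr_gt0.
pose K1 := K * (1 + 2 * d%:R) + 1.
have K10 : 1 <= K1 by rewrite /K1 lerDr mulr_ge0 ?(ltW K0)// addr_ge0.
(* [nu] bounds [gsq] and [om] the oscillation of the derivatives. The errors 2 d om, d K1 nu and d
   eps K1^2 are each kept below gam / 4, so eps gam / 8 survives of eps gam / 2. *)
pose nu := Num.min del (gam / (4 * (1 + d%:R * K1))).
have DK0 : 0 < 1 + d%:R * K1 by rewrite ltr_pwDl// mulr_ge0//; lra.
have nu0 : 0 < nu by rewrite lt_min d0 divr_gt0// mulr_gt0.
pose om := Num.min 1 (gam / (8 * (1 + d%:R))).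
have D0 : 0 < 1 + d%:R :> R by rewrite ltr_pwDl.
have om0 : 0 < om by rewrite lt_min ltr01 divr_gt0// mulr_gt0.
have om1 : om <= 1 by rewrite ge_min lexx.
have omg : d%:R * om <= gam / 8.
  apply: (@le_trans _ _ ((1 + d%:R) * (gam / (8 * (1 + d%:R))))).
    by apply: ler_pM; rewrite ?(ltW om0)// ?lerDr// ge_min lexx orbT.
  by rewrite le_eqVlt; apply/orP; left; apply/eqP; field; rewrite gt_eqF.
have nug : d%:R * K1 * nu <= gam / 4.
  apply: (@le_trans _ _ ((1 + d%:R * K1) * (gam / (4 * (1 + d%:R * K1))))).
    apply: ler_pM; rewrite ?(ltW nu0)// ?lerDr//; last by rewrite ge_min lexx orbT.
    by rewrite mulr_ge0//; lra.
  by rewrite le_eqVlt; apply/orP; left; apply/eqP; field; rewrite gt_eqF.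
have gp0 : gsq f p = 0 by apply/eqP; rewrite gsq_eq0 gp.
have [r1 r10 H1] := continuous_ball p nu0 (continuous_gsq cdf).
have [r2 r20 H2] := continuous_ball_fin p om0 (fun k => @cddf k k).
have [r3 r30 H3] := continuous_ball_fin p om0 cdF.
pose r0 := Num.min r1 (Num.min r2 r3).
have r00 : 0 < r0 by rewrite !lt_min r10 r20.
have [r01 r02 r03] : [/\ r0 <= r1, r0 <= r2 & r0 <= r3].
  by rewrite /r0 !ge_min !lexx !orbT.
have DK2 : 0 < 1 + d%:R * K1 ^+ 2 by rewrite ltr_pwDl// mulr_ge0// sqr_ge0.
pose eps1 := Num.min (r0 / 2) (Num.min (2 / K1) (gam / (4 * (1 + d%:R * K1 ^+ 2)))).
have K1p : 0 < K1 by apply: lt_le_trans K10.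
exists (r0 / 2), (gam / 8), eps1; split.
- by rewrite divr_gt0.
- by rewrite divr_gt0.
- by rewrite !lt_min !divr_gt0// mulr_gt0.
move=> X eps x e0; rewrite !le_min => /and3P[e1 e2 e3] xr Xp Xn.
have near (t : R) k : `|t| <= eps -> `|x + t *: e k - p| <= r0.
  move=> te; rewrite addrAC; apply: le_trans (ler_normD _ _) _.
  have := norm_basis_le t k; set n1 := `|x - p| in xr *; set n2 := `|t *: _|.
  by move: te xr e1; set n3 := `|t|; quick_lra.
have mvtF k (t : R) : `|t| <= eps -> exists2 a, `|a - dF k p| <= om &
    F k (x + t *: e k) = F k x + t * a.
  move=> te; have [th [t0 t1 E]] := line_mvt x t (DF k).
  exists (dF k (x + (th * t) *: e k)).
    apply: H3; apply: le_trans r03; apply: near; apply: le_trans te.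
    by rewrite normrM ger0_norm// ler_piMl.
  by rewrite -E [RHS]addrC subrK.
have te2 : `|eps / 2| <= eps by rewrite ger0_norm; move: e0; quick_lra.
have te2n : `|- (eps / 2)| <= eps by rewrite normrN.
pose m k := partial k (partial k f) p + om; pose g k := dF k p - om.
have W := @field_potential_ge _ _ f Df Ddf X eps x (fun k => F k x) m g e0.
apply: le_trans (W _ _ _); last 3 first.
- move=> k z zx; rewrite /m; have zp : `|z - p| <= r0.
    rewrite -(subrKA x); apply: le_trans (ler_normD _ _) _.
    by move: zx xr e1; set n1 := `|z - x|; set n2 := `|x - p|; quick_lra.
  have := H2 k z (le_trans zp r02); rewrite ler_norml => /andP[_].
  by rewrite lerBlDl.
- move=> k; rewrite Xp; have [a aom ->] := mvtF k _ te2.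
  rewrite lerD2l ler_wpM2l ?divr_ge0 ?(ltW e0)//.
  by move: aom; rewrite /g ler_norml => /andP[h1 h2]; move: h1; quick_lra.
- move=> k; rewrite Xn -scaleNr; have [a aom ->] := mvtF k _ te2n.
  rewrite mulNr lerD2l lerN2 ler_wpM2l ?divr_ge0 ?(ltW e0)//.
  by move: aom; rewrite /g ler_norml => /andP[h1 h2]; move: h1; quick_lra.
have xr0 : `|x - p| <= r0 by apply: le_trans xr _; move: r00; quick_lra.
have gnu : gsq f x <= nu.
  have := H1 x (le_trans xr0 r01); rewrite gp0 subr0; apply: le_trans.
  exact: ler_norm.
have nud : nu <= del by rewrite ge_min lexx.
have [gain bnd] := cosh2_gain d0 d1 (Fs x) (le_trans gnu nud).
have gain0 : 0 <= \sum_k (cosh2 (partial k f x) - cosh2 (F k x)).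
  apply: le_trans gain; apply: mulr_ge0; last exact: gsq_ge0.
  by rewrite divr_ge0// ltW.
pose rest k := eps / 4 * (2 * m k - 2 * g k + 2 * K1 * nu) + eps ^+ 2 * K1 ^+ 2 / 2.
apply: (@le_trans _ _ (\sum_k (cosh2 (partial k f x) - cosh2 (F k x)) - \sum_k rest k)).
  apply: (@le_trans _ _ (- \sum_k rest k)); last by rewrite -[leLHS]add0r lerD2r.
  have -> : \sum_k rest k = eps / 2 * (- gam + 2 * (d%:R * om)
      + d%:R * K1 * nu + d%:R * eps * K1 ^+ 2).
    rewrite /rest big_split/= sum_const_ord -mulr_sumr !big_split/= sum_const_ord.
    rewrite sumrN -!mulr_sumr /m /g sumrB big_split/= !sum_const_ord /gam.
    by field.
  have : d%:R * eps * K1 ^+ 2 <= gam / 4.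
    rewrite mulrAC; apply: (@le_trans _ _ ((1 + d%:R * K1 ^+ 2)
        * (gam / (4 * (1 + d%:R * K1 ^+ 2))))).
      by apply: ler_pM => //; rewrite ?(ltW e0)// ?lerDr// mulr_ge0// sqr_ge0.
    by rewrite le_eqVlt; apply/orP; left; apply/eqP; field; rewrite gt_eqF.
  move: omg nug; set A1 := d%:R * om; set A2 := d%:R * K1 * nu; set A3 := _ * K1 ^+ 2.
  move=> h1 h2 h3; have : 0 <= eps / 2 * (3 / 4 * gam - 2 * A1 - A2 - A3).
    by apply: mulr_ge0; [rewrite divr_ge0// ltW|move: gam0 h1 h2 h3; quick_lra].
  by quick_lra.
rewrite -sumrB; apply: ler_sum => k _.
have [_ _ ca cb] := bnd k; have {}ca := le_trans ca (lerD (lexx 2) gnu).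
have {}cb := le_trans cb (lerD (lexx 2) gnu).
have ca2 : 2 <= cosh2 (partial k f x).
  by apply: le_trans (cosh2_ge _); rewrite lerDl divr_ge0// sqr_ge0.
have cb2 : 2 <= cosh2 (F k x).
  by apply: le_trans (cosh2_ge _); rewrite lerDl divr_ge0// sqr_ge0.
have mK : `|m k| <= K1.
  rewrite /m /K1; apply: le_trans (ler_normD _ _) _.
  apply: lerD; last by rewrite gtr0_norm.
  apply: le_trans (hessK _ _ _) _; rewrite ler_peMr ?(ltW K0)//.
  by rewrite lerDl mulr_ge0.
have gK : `|g k| <= K1.
  rewrite /g /K1; apply: le_trans (ler_normB _ _) _.
  by apply: lerD; [exact: dFK|rewrite gtr0_norm].
have eK : eps * K1 <= 2 by rewrite -ler_pdivlMr.
have eg : `|- (eps * g k / 4)| <= 1 / 2.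
  rewrite normrN !normrM gtr0_norm// (@gtr0_norm _ 4^-1)//.
  have : eps * `|g k| <= eps * K1 by rewrite ler_wpM2l// ltW.
  by move: eK; quick_lra.
have := expR_le_quad eg; set E := expR _.
by move=> hE; exact: (cosh_exp_pair_ge e0 K1p nu0 (le_trans nud d1)).
Qed.

End saddle_estimates.

(** * Gluing the escape fields *)

Section cutoff.
Variables (R : realType) (d : nat).
Implicit Types (x y p : 'rV[R]_d).

(** A piecewise linear cutoff suffices: derivatives of the field enter only where the cutoff equals
    1. *)
Definition cutoff (r : R) p x : R := Num.max 0 (Num.min 1 (2 - `|x - p| / r)).

Variable r : R.
Hypothesis r0 : 0 < r.

Lemma cutoff_ge0 p x : 0 <= cutoff r p x.
Proof. by rewrite /cutoff le_max lexx. Qed.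

Lemma cutoff_le1 p x : cutoff r p x <= 1.
Proof. by rewrite /cutoff ge_max ler01 ge_min lexx. Qed.

Lemma cutoff1 p x : `|x - p| <= r -> cutoff r p x = 1.
Proof.
move=> xr; have h : 1 <= 2 - `|x - p| / r.
  by have : `|x - p| / r <= 1; [rewrite ler_pdivrMr// mul1r|lra].
by rewrite /cutoff (min_l h) max_r.
Qed.

Lemma cutoff0 p x : 2 * r <= `|x - p| -> cutoff r p x = 0.
Proof.
move=> xr; have h : 2 - `|x - p| / r <= 0.
  by have : 2 <= `|x - p| / r; [rewrite ler_pdivlMr|lra].
by rewrite /cutoff max_l// ge_min h orbT.
Qed.

Lemma cutoff_lip p x y : `|cutoff r p y - cutoff r p x| <= `|y - x| / r.
Proof.
have L1 (u v : R) : `|Num.max 0 u - Num.max 0 v| <= `|u - v|.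
  have h1 := ler_norm (u - v); have h2 := ler_norm (v - u); rewrite distrC in h2.
  rewrite ler_norml; move: h1 h2; set n := `|u - v| => h1 h2.
  by case: (lerP 0 u) => hu; case: (lerP 0 v) => hv; apply/andP; split; lra.
have L2 (u v : R) : `|Num.min 1 u - Num.min 1 v| <= `|u - v|.
  have h1 := ler_norm (u - v); have h2 := ler_norm (v - u); rewrite distrC in h2.
  rewrite ler_norml; move: h1 h2; set n := `|u - v| => h1 h2.
  by case: (lerP 1 u) => hu; case: (lerP 1 v) => hv; apply/andP; split; lra.
have H (a b : R) : `|Num.max 0 (Num.min 1 (2 - a)) - Num.max 0 (Num.min 1 (2 - b))| <= `|a - b|.
  apply: le_trans (L1 _ _) _; apply: le_trans (L2 _ _) _.
  have -> : 2 - a - (2 - b) = b - a by ring.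
  by rewrite distrC.
apply: le_trans (H _ _) _; rewrite -mulrBl normrM (@gtr0_norm _ r^-1) ?invr_gt0//.
rewrite ler_pM2r ?invr_gt0//; apply: le_trans (ler_dist_dist _ _) _.
by rewrite opprB addrA subrK.
Qed.

End cutoff.

Section global_field.
Variables (R : realType) (d : nat).
Local Notation e := (basis_vec R).
Implicit Types (x y p : 'rV[R]_d).

(** Merges the constants attached to finitely many points into one, for properties that survive
    shrinking the constant. *)
Lemma seq_pos_lower_bound (T : eqType) (s : seq T) (P : T -> R -> Prop) :
  (forall t (a b : R), P t a -> 0 < b -> b <= a -> P t b) ->
  (forall t, t \in s -> exists2 a : R, 0 < a & P t a) ->
  exists2 a : R, 0 < a & forall t, t \in s -> P t a.
Proof.
move=> mono; elim: s => [|t s IH] H; first by exists 1.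
have [|a a0 Ha] := IH; first by move=> u us; apply: H; rewrite inE us orbT.
have [b b0 Hb] := H t (mem_head _ _).
have m0 : 0 < Num.min a b by rewrite lt_min a0.
exists (Num.min a b) => // u; rewrite inE => /orP[/eqP ->|us].
  by apply: mono Hb m0 _; rewrite ge_min lexx orbT.
by apply: (mono _ _ _ (Ha u us) m0); rewrite ge_min lexx.
Qed.

Variable f : 'rV[R]_d -> R.
Hypothesis cf : continuous f.
Hypothesis Df : forall k x, derivable f x (e k).
Hypothesis cdf : forall k, continuous (partial k f).
Hypothesis Ddf : forall k j x, derivable (partial j f) x (e k).
Hypothesis cddf : forall k j, continuous (partial k (partial j f)).
Hypothesis nondeg : nondegenerate_critical_points f.
Hypothesis grad_inf : (0 < limf_einf (fun x => (enorm (grad f x))%:E) (@at_infinity R d))%E.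
Variable K : R.
Hypothesis K0 : 0 < K.
Hypothesis hessK : forall k j x, `|partial k (partial j f) x| <= K.

Local Ltac quick_lra := clear - cf Df cdf Ddf cddf nondeg grad_inf K0 hessK; lra.

(** Within r / 2 of a saddle the field is the escape field at all adjacent midpoints. Up to 3 r the
    cutoff may vary, but [gsq] is bounded below and beats the losses of order eps. Farther out the
    field vanishes at the adjacent midpoints, so the field potential is V >= gsq / 8 - Km eps, which
    can fall below eps only within sqrt(rho eps) of a point of [ms]. *)
Lemma global_field_exists (ps : seq 'rV[R]_d) (ms ss : seq 'rV[R]_d) : uniq ps ->
  (forall x, (x \in ps) = (grad f x == 0)) ->
  (forall x, x \in ps -> x \in ms \/ x \in ss) ->
  (forall x, x \in ms -> grad f x = 0) ->
  (forall x, x \in ss -> grad f x = 0 /\ ~ local_minima f x) -> uniq ss ->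
  exists (X : 'I_d -> 'rV[R]_d -> R) (B c rho Km eps1 : R),
    [/\ 0 < c, 0 < rho, 0 < eps1, 0 <= Km /\ (forall k x, `|X k x| <= B) &
      forall eps x, 0 < eps -> eps <= eps1 ->
        c * eps <= field_potential f X eps x \/
        (exists2 p, p \in ms & `|x - p| ^+ 2 <= rho * eps) /\
        - (Km * eps) <= field_potential f X eps x].
Proof.
move=> ups psE pms msE ssE uss.
(* With r <= sep, a point within 4 r of a saddle is at least 4 r from every other critical point, so
   only one summand of the field is active there. *)
have [sep sep0 Hsep] : exists2 a : R, 0 < a &
    forall p, p \in ps -> forall q, q \in ps -> q != p -> 8 * a <= `|q - p|.
  apply: (@seq_pos_lower_bound _ ps (fun p a => forall q, q \in ps -> q != p -> 8 * a <= `|q - p|)).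
    by move=> p a b Ha b0 ba q qps qp; apply: le_trans (Ha q qps qp); rewrite ler_pM2l.
  move=> p pps; have gp : grad f p = 0 by apply/eqP; rewrite -psE.
  have [r r0 iso] := critical_isolated Ddf cddf nondeg gp.
  exists (r / 8); first by rewrite divr_gt0.
  move=> q qps qp; rewrite mulrC divfK// leNgt; apply/negP => /ltW /iso qr.
  by move/negP: qp; apply; apply/eqP/qr/eqP; rewrite -psE.
have /choice [del /choice [F /choice [dF HF]]] : forall p, exists del F dF,
    p \in ss -> escape_field f K p del F dF.
  move=> p; have [pss|pss] := boolP (p \in ss); last by exists 0, (fun _ _ => 0), (fun _ _ => 0).
  have [gp nm] := ssE p pss.
  have [xi xi1 xin] := saddle_direction Df cdf Ddf cddf gp (nondeg gp) nm.
  have [dl [F [dF H]]] := escape_field_exists Ddf cddf hessK xi1 xin.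
  by exists dl, F, dF.
have [r r0 Hr] : exists2 r : R, 0 < r & forall p, p \in ss -> r <= sep /\
    (forall y, `|y - p| <= 4 * r -> gsq f y <= del p) /\
    exists c eps1 : R, [/\ 0 < c, 0 < eps1 &
    forall (X : 'I_d -> 'rV[R]_d -> R) (eps : R) x, 0 < eps -> eps <= eps1 ->
      `|x - p| <= r / 2 ->
      (forall k, X k (x + (eps / 2) *: e k) = F p k (x + (eps / 2) *: e k)) ->
      (forall k, X k (x - (eps / 2) *: e k) = F p k (x - (eps / 2) *: e k)) ->
      c * eps <= field_potential f X eps x].
  apply: (@seq_pos_lower_bound _ ss (fun p r => r <= sep /\
    (forall y, `|y - p| <= 4 * r -> gsq f y <= del p) /\
    exists c eps1 : R, [/\ 0 < c, 0 < eps1 &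
    forall (X : 'I_d -> 'rV[R]_d -> R) (eps : R) x, 0 < eps -> eps <= eps1 ->
      `|x - p| <= r / 2 ->
      (forall k, X k (x + (eps / 2) *: e k) = F p k (x + (eps / 2) *: e k)) ->
      (forall k, X k (x - (eps / 2) *: e k) = F p k (x - (eps / 2) *: e k)) ->
      c * eps <= field_potential f X eps x])).
    move=> p a b [asep [ag [c [e1 [c0 e10 H]]]]] b0 ba; split; first exact: le_trans ba asep.
    split; first by move=> y yb; apply: ag; apply: le_trans yb _; rewrite ler_pM2l.
    exists c, e1; split => // X eps x h1 h2 h3; apply: H => //.
    by apply: le_trans h3 _; rewrite ler_pM2r// invr_gt0.
  move=> p pss; have [gp _] := ssE p pss.
  have EF := HF p pss; have [[d0 d1] _ _ _ _] := EF.
  have [rc [c [e1 [rc0 c0 e10 H]]]] := field_potential_core Df cdf Ddf cddf K0 hessK gp EF.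
  have [rg rg0 Hg] := continuous_ball p d0 (continuous_gsq cdf).
  exists (Num.min sep (Num.min rc (rg / 4))); first by rewrite !lt_min sep0 rc0 divr_gt0.
  split; first by rewrite ge_min lexx.
  split.
    move=> y yr; have : `|y - p| <= rg.
      apply: le_trans yr _; rewrite mulrC -ler_pdivlMr// !ge_min lexx !orbT//.
    move=> /Hg; have -> : gsq f p = 0 by apply/eqP; rewrite gsq_eq0 gp.
    by rewrite subr0; apply: le_trans; exact: ler_norm.
  exists c, e1; split => // X eps x h1 h2 h3; apply: H => //.
  apply: le_trans h3 _; rewrite ler_pdivrMr//.
  apply: (@le_trans _ _ rc); first by rewrite !ge_min lexx !orbT.
  by rewrite ler_peMr ?ltW// ltr1n.
have del01 p : p \in ss -> 0 < del p /\ del p <= 1 by move=> /HF [].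
pose X k x := \sum_(p <- ss) cutoff r p x * F p k x.
have F1 p k y : p \in ss -> `|y - p| <= 4 * r -> `|F p k y| <= 1.
  move=> pss yr; have [_ [Hg _]] := Hr p pss; have [d0 d1] := del01 p pss.
  have [_ Fs _ _ _] := HF p pss.
  rewrite -(@expr_le1 _ 2)// real_normK ?num_real//.
  apply: (@le_trans _ _ (\sum_k F p k y ^+ 2)).
    by rewrite (bigD1 k)//= lerDl; apply: sumr_ge0 => j _; exact: sqr_ge0.
  apply: le_trans (Fs y) _; apply: mulr_ile1; rewrite ?sqr_ge0 ?gsq_ge0//.
    by rewrite expr_le1 ?subr_ge0//; move: d0; lra.
  exact: le_trans (Hg y yr) d1.
have Xnear p k y : p \in ss -> `|y - p| <= 4 * r -> X k y = cutoff r p y * F p k y.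
  move=> pss yr; rewrite /X (bigD1_seq p)//= big_seq_cond big1 ?addr0// => q /andP[qss qp].
  have [sr _] := Hr p pss.
  have pps : p \in ps by rewrite psE (ssE p pss).1.
  have qps : q \in ps by rewrite psE (ssE q qss).1.
  have := Hsep p pps q qps qp => qp8.
  rewrite cutoff0 ?mul0r//.
  have := ler_distD y q p; rewrite (distrC q y).
  by move: yr qp8 sr; set n1 := `|y - p|; set n2 := `|q - p|; set n3 := `|y - q|; lra.
have Xfar k y : (forall p, p \in ss -> 2 * r <= `|y - p|) -> X k y = 0.
  move=> far; rewrite /X big_seq big1// => p pss.
  by rewrite cutoff0 ?mul0r//; exact: far.
have XB k x : `|X k x| <= (size ss)%:R.
  have [near|far] := pselect (exists2 p, p \in ss & `|x - p| <= 4 * r).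
    have [p pss xr] := near; rewrite (Xnear p)// normrM.
    apply: (@le_trans _ _ (1 * 1)).
      by apply: ler_pM => //; [rewrite ger0_norm ?cutoff_ge0 ?cutoff_le1|exact: F1].
    by rewrite mulr1 ler1n; case: (ss) pss.
  rewrite Xfar ?normr0// => p pss; rewrite leNgt; apply/negP => h; apply: far.
  by exists p => //; apply: le_trans (ltW h) _; rewrite ler_pM2r// ler_nat.
have [cc cc0 Hcc] : exists2 c : R, 0 < c & forall p, p \in ss ->
    forall (eps : R) x, 0 < eps -> eps <= c ->
      `|x - p| <= r / 2 ->
      (forall k, X k (x + (eps / 2) *: e k) = F p k (x + (eps / 2) *: e k)) ->
      (forall k, X k (x - (eps / 2) *: e k) = F p k (x - (eps / 2) *: e k)) ->
      c * eps <= field_potential f X eps x.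
  apply: (@seq_pos_lower_bound _ ss (fun p c => forall (eps : R) x, 0 < eps -> eps <= c ->
      `|x - p| <= r / 2 ->
      (forall k, X k (x + (eps / 2) *: e k) = F p k (x + (eps / 2) *: e k)) ->
      (forall k, X k (x - (eps / 2) *: e k) = F p k (x - (eps / 2) *: e k)) ->
      c * eps <= field_potential f X eps x)).
    move=> p a b Ha b0 ba eps x h1 h2 h3 h4 h5.
    apply: le_trans (Ha eps x h1 (le_trans h2 ba) h3 h4 h5).
    by rewrite ler_pM2r.
  move=> p pss; have [_ [_ [c [e1 [c0 e10 H]]]]] := Hr p pss.
  exists (Num.min c e1); first by rewrite lt_min c0.
  move=> eps x h1 h2 h3 h4 h5; apply: le_trans (H X eps x h1 _ h3 h4 h5).
    by rewrite ler_pM2r// ge_min lexx.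
  by apply: le_trans h2 _; rewrite ge_min lexx orbT.
have [kap kap0 [rm rm0 Hm]] : exists2 kap : R, 0 < kap & exists2 rm : R, 0 < rm &
    forall p, p \in ms -> forall x, `|x - p| <= rm -> kap * `|x - p| ^+ 2 <= gsq f x.
  have [a a0 Ha] : exists2 a : R, 0 < a & forall p, p \in ms ->
      forall x, `|x - p| <= a -> a * `|x - p| ^+ 2 <= gsq f x.
    apply: (@seq_pos_lower_bound _ ms (fun p a => forall x, `|x - p| <= a -> a * `|x - p| ^+ 2 <= gsq f x)).
      move=> p a b Ha b0 ba x xb; apply: le_trans (Ha x (le_trans xb ba)).
      by rewrite ler_wpM2r// sqr_ge0.
    move=> p pms'; have gp := msE p pms'.
    have [r1 [kap [r10 kap0 H]]] := critical_gsq_ge Ddf cddf gp (nondeg gp).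
    exists (Num.min r1 kap); first by rewrite lt_min r10.
    move=> x xr; apply: le_trans (H x _).
      by rewrite ler_wpM2r ?sqr_ge0// ge_min lexx orbT.
    by apply: le_trans xr _; rewrite ge_min lexx.
  by exists a => //; exists a.
pose r' := Num.min (r / 2) rm.
have r'0 : 0 < r' by rewrite lt_min divr_gt0.
have [cg cg0 Hcg] := gsq_away cdf grad_inf psE r'0.
have [dm dm0 Hdm] : exists2 a : R, 0 < a & forall p, p \in ss -> a <= del p.
  apply: (@seq_pos_lower_bound _ ss (fun p a => a <= del p)) => [p a b h1 _ h2|p pss].
    exact: le_trans h2 h1.
  by have [d0 _] := del01 p pss; exists (del p).
pose L := K * (1 + 2 * d%:R) + r^-1.
have L0 : 0 < L by rewrite addr_gt0 ?invr_gt0// mulr_gt0// ltr_pwDl// mulr_ge0.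
pose Cg := d%:R * (K + 2 * L).
have Cg0 : 0 <= Cg by rewrite mulr_ge0// addr_ge0 ?mulr_ge0 ?(ltW K0) ?(ltW L0).
pose Km := d%:R * K / 2.
have Km0 : 0 <= Km by rewrite divr_ge0// mulr_ge0// ltW.
(* Where |x - p|^2 exceeds rho eps, the quadratic growth of [gsq] gives gsq / 8 >= (Km + 1) eps. *)
pose rho := 8 * (Km + 1) / kap.
have rho0 : 0 < rho by rewrite divr_gt0// mulr_gt0// ltr_wpDl.
pose c := Num.min cc 1.
(* The bound by r keeps half edges inside the regions; the last two entries make the gains dm cg / 4
   and cg / 8 exceed the losses Cg eps and Km eps by eps. *)
pose eps1 := Num.min (Num.min cc r) (Num.min (Num.min (2 / L) (2 / K))
  (Num.min (dm / 4 * cg / (Cg + 1)) (cg / 8 / (Km + 1)))).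
have Cg1 : 0 < Cg + 1 by rewrite ltr_wpDl.
have Km1 : 0 < Km + 1 by rewrite ltr_wpDl.
exists X, (size ss)%:R, c, rho, Km, eps1; split.
- by rewrite lt_min cc0 ltr01.
- exact: rho0.
- rewrite !lt_min cc0 r0 !divr_gt0//= ?mulr_gt0 ?divr_gt0//.
- by split.
move=> eps x eps0; rewrite !le_min -!andbA => /and5P[ecc er eL eK /andP[e1 e2]].
have el (k : 'I_d) t : `|t| = eps -> `|(t / 2) *: e k| <= eps / 2.
  by move=> te; apply: le_trans (norm_basis_le _ _) _; rewrite normrM te gtr0_norm.
have en : `|- eps| = eps by rewrite normrN gtr0_norm.
have ep : `|eps| = eps by rewrite gtr0_norm.
have stepn k : x - (eps / 2) *: e k = x + (- eps / 2) *: e k by rewrite mulNr scaleNr.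
have step p k t a : `|t| = eps -> `|x - p| <= a -> `|x + (t / 2) *: e k - p| <= a + eps / 2.
  move=> te xa; rewrite addrAC; apply: le_trans (ler_normD _ _) _.
  by apply: lerD => //; exact: el.
have [[p pss xp]|nocore] := pselect (exists2 p, p \in ss & `|x - p| <= r / 2).
  left; have XF k t : `|t| = eps -> X k (x + (t / 2) *: e k) = F p k (x + (t / 2) *: e k).
    move=> te; have := step p k t _ te xp => h.
    have hr : `|x + (t / 2) *: e k - p| <= r by apply: le_trans h _; move: r0 er; quick_lra.
    rewrite (Xnear p)// ?cutoff1 ?mul1r//.
    by apply: le_trans hr _; rewrite ler_peMl ?ltW// ltr1n.
  apply: (@le_trans _ _ (cc * eps)); first by rewrite ler_pM2r// ge_min lexx.
  apply: (Hcc p pss) => // k; first exact: XF.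
  by rewrite stepn; exact: XF.
have [[p pss xp]|notrans] := pselect (exists2 p, p \in ss & `|x - p| <= 3 * r).
  left; have [d0 d1] := del01 p pss; have [_ [Hg _]] := Hr p pss.
  have [_ Fs DF [_ dFK] _] := HF p pss.
  have xp4 : `|x - p| <= 4 * r by apply: le_trans xp _; rewrite ler_pM2r// ler_nat.
  have gx : cg <= gsq f x.
    apply: Hcg => q qps; rewrite /r' ge_min; apply/orP; left.
    have [qp|qp] := eqVneq q p.
      by rewrite qp leNgt; apply/negP => /ltW h; apply: nocore; exists p.
    have pps : p \in ps by rewrite psE (ssE p pss).1.
    have [sr _] := Hr p pss; have := Hsep p pps q qps qp.
    have := ler_distD x q p; rewrite (distrC q x).
    by move: r0 xp sr; set n1 := `|x - p|; set n2 := `|q - p|; set n3 := `|x - q|; quick_lra.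
  have Xlip k t : `|t| = eps -> `|X k (x + (t / 2) *: e k) - X k x| <= eps / 2 * L.
    move=> te; have hx' : `|x + (t / 2) *: e k - p| <= 4 * r.
      by apply: le_trans (step p k t _ te xp) _; move: r0 er; quick_lra.
    rewrite !(Xnear p)//; set y := x + _ in hx' *.
    have -> : cutoff r p y * F p k y - cutoff r p x * F p k x =
       cutoff r p y * (F p k y - F p k x) + (cutoff r p y - cutoff r p x) * F p k x by ring.
    apply: le_trans (ler_normD _ _) _.
    have -> : eps / 2 * L = eps / 2 * (K * (1 + 2 * d%:R)) + eps / 2 * r^-1.
      by rewrite /L mulrDr.
    rewrite 2!normrM; apply: lerD.
      rewrite ger0_norm ?cutoff_ge0// -[leRHS]mul1r; apply: ler_pM => //.
        exact: cutoff_ge0.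
        exact: cutoff_le1.
      have [th [_ _ E]] := line_mvt x (t / 2) (DF k).
      by rewrite /y E normrM normrM te (@gtr0_norm _ 2^-1)// ler_wpM2l// divr_ge0// ltW.
    rewrite -[leRHS]mulr1; apply: ler_pM => //; last exact: F1.
    apply: le_trans (cutoff_lip r0 _ _ _) _; rewrite /y addrC addKr.
    by rewrite ler_pM2r ?invr_gt0//; exact: el.
  have Xs : \sum_k X k x ^+ 2 <= (1 - del p) ^+ 2 * gsq f x.
    apply: le_trans (Fs x); apply: ler_sum => k _; rewrite (Xnear p)// exprMn.
    by rewrite ler_piMl ?sqr_ge0// expr_le1 ?cutoff_ge0 ?cutoff_le1.
  have eL' : eps * L <= 2 by rewrite -ler_pdivlMr.
  have Xn k : `|X k (x - (eps / 2) *: e k) - X k x| <= eps / 2 * L.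
    by rewrite stepn; exact: Xlip.
  have := field_potential_transition Df Ddf K0 hessK d0 d1 (ltW L0) eps0 eL' Xs
    (Hg x xp4) (fun k => Xlip k eps ep) Xn.
  apply: le_trans; rewrite -/Cg.
  have h1 : dm / 4 * cg <= del p / 4 * gsq f x.
    by apply: ler_pM => //; [rewrite divr_ge0// ltW|exact: ltW|rewrite ler_pM2r ?invr_gt0//; exact: Hdm].
  have h2 : eps * (Cg + 1) <= dm / 4 * cg by rewrite -ler_pdivlMr.
  have h3 : c * eps <= eps by rewrite ler_piMl ?(ltW eps0)// ge_min lexx orbT.
  by move: h1 h2 h3; set A := del p / 4 * _; set A2 := dm / 4 * _; rewrite mulrDr mulr1; quick_lra.
have far p : p \in ss -> 3 * r <= `|x - p|.
  by move=> pss; rewrite leNgt; apply/negP => /ltW h; apply: notrans; exists p.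
have X0 k t : `|t| = eps -> X k (x + (t / 2) *: e k) = 0.
  move=> te; apply: Xfar => p pss; have := far p pss => h.
  have := ler_distD (x + (t / 2) *: e k) x p; rewrite opprD addrA subrr add0r normrN.
  have := el k t te.
  by move: r0 er h; set n1 := `|x - p|; set n2 := `|_ *: _|; set n3 := `|_ - p|; quick_lra.
have VE : field_potential f X eps x = potential f eps x.
  rewrite /field_potential (eq_bigr (fun=> 2)); last first.
    by move=> k _; rewrite stepn !X0// mul0r oppr0 expR0.
  by rewrite sum_const_ord natrM mulrC addrK.
have eK' : eps * K <= 2 by rewrite -ler_pdivlMr.
have Vge := potential_ge Df Ddf hessK x eps0 eK'.
rewrite VE; have ec : c * eps <= eps by rewrite ler_piMl ?(ltW eps0)// ge_min lexx orbT.
have Kme : d%:R * K * eps / 2 = Km * eps by rewrite /Km mulrAC.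
rewrite Kme in Vge.
have [[p pms' xp]|nomin] := pselect (exists2 p, p \in ms & `|x - p| <= rm).
  have gx := Hm p pms' x xp.
  have [close|fr] := leP (`|x - p| ^+ 2) (rho * eps).
    right; split; first by exists p.
    by apply: le_trans Vge; rewrite lerDr; apply: divr_ge0 => //; exact: gsq_ge0.
  left; apply: le_trans Vge; apply: le_trans ec _.
  have : kap * (rho * eps) <= gsq f x by apply: le_trans gx; rewrite ler_pM2l// ltW.
  have -> : kap * (rho * eps) = 8 * (Km + 1) * eps by rewrite /rho; field; rewrite gt_eqF.
  by move: (gsq f x) eps0 => G; quick_lra.
left; apply: le_trans Vge; apply: le_trans ec _.
have gx : cg <= gsq f x.
  apply: Hcg => q qps; rewrite /r' ge_min; apply/orP; case: (pms q qps) => [qm|qs].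
    by right; rewrite leNgt; apply/negP => /ltW h; apply: nomin; exists q.
  by left; apply: le_trans (far q qs); move: r0; quick_lra.
have h2 : eps * (Km + 1) <= cg / 8 by rewrite -ler_pdivlMr.
by move: eps0 gx h2; set G := gsq f x; quick_lra.
Qed.

End global_field.

(** * The spectral gap *)

Section poincare.
Variables (R : realType) (d N : nat).
Local Notation L := 'rV[int]_d.
Local Notation e := (basis_vec int).
Local Notation T := {ffun 'I_d -> 'I_N}.

Lemma line_increment_le (h : nat -> R) (s t : nat) : (s < N)%N -> (t < N)%N ->
  (h t - h s) ^+ 2 <= N%:R * \sum_(r < N) (h r.+1 - h r) ^+ 2.
Proof.
wlog st : s t / (s <= t)%N.
  move=> H sN tN; have [st|st] := leqP s t; first exact: H.
  by rewrite -sqrrN opprB; apply: H => //; exact: ltnW.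
move=> sN tN.
have -> : h t - h s = \sum_(r < N) (if (s <= r < t)%N then h r.+1 - h r else 0).
  rewrite -big_mkcond/= -(big_mkord (fun r => s <= r < t)%N (fun r => h r.+1 - h r)).
  rewrite -(telescope_sumr h st) (big_nat_widen s t N xpredT)//=; last exact: ltnW.
  rewrite (big_nat_widenl s 0)//=; apply: eq_bigl => r.
  by rewrite andbC.
have := @sqr_sum_le R 'I_N (fun r => if (s <= r < t)%N then h r.+1 - h r else 0).
rewrite card_ord => /le_trans; apply; rewrite ler_wpM2l//; apply: ler_sum => r _.
by case: ifP => // _; rewrite expr0n sqr_ge0.
Qed.

Variable m : L.

Definition box_point (z : T) : L := \row_k (m 0 k + (z k)%:Z).

Lemma box_point_inj : injective box_point.
Proof.
move=> z1 z2 /rowP H; apply/ffunP => k; apply: val_inj.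
by have := H k; rewrite !mxE => /addrI [].
Qed.

Let upd (z : T) k (t : 'I_N) : T := [ffun i => if i == k then t else z i].

Let box_upd z k t : box_point (upd z k t) = box_point z + ((t : int) - (z k : int)) *: e k.
Proof.
apply/rowP => i; rewrite !mxE !ffunE eqxx/=.
case: eqP => [->|_]; last by rewrite mulr0 addr0.
by rewrite mulr1; ring.
Qed.

Let mix (j : nat) (x y : T) : T := [ffun k : 'I_d => if (k < j)%N then y k else x k].

(* Any two points of the box are joined by the path changing one coordinate at a time;
   swapping coordinates below [k] between the end points makes every step of all these
   paths start at a uniformly distributed point. *)
Lemma poincare_box (u : L -> R) : \sum_z u (box_point z) = 0 ->
  2 * \sum_z u (box_point z) ^+ 2 <=
  d%:R * (N ^ 2)%:R * \sum_k \sum_z (u (box_point z + e k) - u (box_point z)) ^+ 2.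
Proof.
move=> u0; pose g z := u (box_point z); pose M : R := #|{: T}|%:R.
have [M0|M0] := ltP 0 M; last first.
  have T0 : #|{: T}| = 0%N by apply/eqP; rewrite -leqn0 -(ler_nat R).
  have e0 (G : T -> R) : \sum_z G z = 0.
    by rewrite big_pred0// => z; have := card0_eq T0 z; rewrite !inE.
  by rewrite e0 mulr0 big1 ?mulr0// => k _; rewrite e0.
pose Dk k z := (u (box_point z + e k) - u (box_point z)) ^+ 2.
(* (z, t) -> (upd z k t, z k) is an involution, so replacing a coordinate by a uniform one preserves
   the uniform distribution. *)
have updsum k (G : T -> R) : \sum_z \sum_(t < N) G (upd z k t) = N%:R * \sum_z G z.
  rewrite pair_bigA/=.
  rewrite (reindex (fun zt : T * 'I_N => (upd zt.1 k zt.2, zt.1 k)))/=; last first.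
    exists (fun zt : T * 'I_N => (upd zt.1 k zt.2, zt.1 k)) => -[z t] _ /=;
      congr pair; rewrite ?ffunE ?eqxx//; apply/ffunP => i; rewrite !ffunE;
      by case: eqP => [->|].
  rewrite -(pair_bigA _ (fun z t => G (upd (upd z k t) k (z k))))/=.
  rewrite mulr_sumr; apply: eq_bigr => z _.
  rewrite (eq_bigr (fun=> G z)); last first.
    by move=> t _; congr G; apply/ffunP => i; rewrite !ffunE; case: eqP => [->|].
  by rewrite sumr_const card_ord -[LHS]mulr_natl.
have line k z t : (g (upd z k t) - g z) ^+ 2 <= N%:R * \sum_(r < N) Dk k (upd z k r).
  pose h (s : nat) := u (box_point z + ((s : int) - (z k : int)) *: e k).
  have := @line_increment_le h (z k) t (ltn_ord _) (ltn_ord _).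
  rewrite /h subrr scale0r addr0 -box_upd => /le_trans; apply.
  rewrite ler_wpM2l//; apply: ler_sum => r _; rewrite /Dk box_upd.
  have -> : (r.+1%:Z - (z k : int)) *: e k = (r%:Z - (z k : int)) *: e k + e k.
    by rewrite -[X in _ = _ + X]scale1r -scalerDl; congr (_ *: _); lia.
  by rewrite addrA.
have step (k : 'I_d) : \sum_x \sum_y (g (mix k.+1 x y) - g (mix k x y)) ^+ 2 <=
    M * (N ^ 2)%:R * \sum_z Dk k z.
  rewrite pair_bigA/=.
  rewrite (reindex (fun xy : T * T => (mix k xy.1 xy.2, mix k xy.2 xy.1)))/=; last first.
    exists (fun xy : T * T => (mix k xy.1 xy.2, mix k xy.2 xy.1)) => -[x y] _ /=;
      congr pair; apply/ffunP => i; by rewrite !ffunE; case: (i < k)%N.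
  have mixE x y : mix k (mix k x y) (mix k y x) = x.
    by apply/ffunP => i; rewrite !ffunE; case: (i < k)%N.
  have mixSE x y : mix k.+1 (mix k x y) (mix k y x) = upd x k (y k).
    apply/ffunP => i; rewrite !ffunE ltnS; case: (ltngtP i k) => ik.
    - by rewrite ifN// neq_ltn ik.
    - by rewrite ifN// neq_ltn ik orbT.
    - by rewrite (val_inj ik) eqxx.
  rewrite -(pair_bigA _ (fun x y => (g (mix k.+1 (mix k x y) (mix k y x))
     - g (mix k (mix k x y) (mix k y x))) ^+ 2))/=.
  apply: (@le_trans _ _ (\sum_(x : T) \sum_(y : T) N%:R * \sum_(r < N) Dk k (upd x k r))).
    by apply: ler_sum => x _; apply: ler_sum => y _; rewrite mixE mixSE; exact: line.
  rewrite (eq_bigr (fun x => M * (N%:R * \sum_(r < N) Dk k (upd x k r)))); last first.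
    by move=> x _; rewrite sumr_const -[LHS]mulr_natl.
  rewrite -!mulr_sumr updsum natrX expr2 !mulrA.
  by rewrite lexx.
have pairs : \sum_x \sum_y (g y - g x) ^+ 2 = 2 * (M * \sum_z g z ^+ 2).
  transitivity (\sum_x (M * g x ^+ 2 + \sum_y g y ^+ 2 - 2 * (g x * \sum_y g y))).
    apply: eq_bigr => x _.
    transitivity (\sum_y (g x ^+ 2 + (g y ^+ 2 - 2 * (g x * g y)))).
      by apply: eq_bigr => y _; ring.
    by rewrite big_split/= sumr_const sumrB -!mulr_sumr -[_ *+ _]mulr_natl addrA.
  rewrite sumrB big_split/= sumr_const -!mulr_sumr -mulr_suml -/(g _).
  rewrite (_ : \sum_y g y = 0)// mul0r mulr0 subr0 -[_ *+ _]mulr_natl; ring.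
set S := \sum_k \sum_z _; rewrite -(ler_pM2l M0).
have -> : M * (2 * \sum_z u (box_point z) ^+ 2) = \sum_x \sum_y (g y - g x) ^+ 2.
  by rewrite pairs mulrCA.
have -> : M * (d%:R * (N ^ 2)%:R * S) = d%:R * (M * (N ^ 2)%:R * S) by ring.
apply: (@le_trans _ _ (\sum_x \sum_y d%:R * \sum_(k < d) (g (mix k.+1 x y) - g (mix k x y)) ^+ 2)).
  apply: ler_sum => x _; apply: ler_sum => y _.
  have -> : g y - g x = \sum_(k < d) (g (mix k.+1 x y) - g (mix k x y)).
    rewrite -(big_mkord xpredT (fun k => g (mix k.+1 x y) - g (mix k x y))).
    rewrite telescope_sumr//; congr (g _ - g _); apply/ffunP => i; rewrite !ffunE//.
    by rewrite ltn_ord.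
  by apply: le_trans (sqr_sum_le _) _; rewrite card_ord.
have -> : \sum_x \sum_y d%:R * \sum_(k < d) (g (mix k.+1 x y) - g (mix k x y)) ^+ 2 =
    d%:R * \sum_(k < d) \sum_x \sum_y (g (mix k.+1 x y) - g (mix k x y)) ^+ 2.
  rewrite [in RHS]exchange_big/= mulr_sumr; apply: eq_bigr => x _.
  by rewrite -mulr_sumr exchange_big.
rewrite ler_wpM2l// /S mulr_sumr.
by apply: ler_sum => k _; exact: step.
Qed.

End poincare.

(** * Lattice points in balls and boxes *)

Section lattice_boxes.
Variables (R : realType) (d : nat).
Local Notation L := 'rV[int]_d.
Local Notation e := (basis_vec int).

Lemma lattice_box (eps a : R) (p : 'rV[R]_d) : 0 < eps -> 0 <= a ->
  exists (N : nat) (m : L), [/\ N%:R <= 2 * a / eps + 2,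
    forall n, `|lattice_point eps n - p| <= a -> exists z : {ffun 'I_d -> 'I_N}, n = box_point m z &
    forall z : {ffun 'I_d -> 'I_N}, `|lattice_point eps (box_point m z) - p| <= a + 2 * eps].
Proof.
move=> e0 a0; have ae0 : 0 <= 2 * a / eps by rewrite divr_ge0 ?mulr_ge0// ltW.
have [Mle Mgt] := andP (truncn_itv ae0); set M := Num.truncn _ in Mle Mgt.
pose m : L := \row_k Num.floor ((p 0 k - a) / eps).
have mk k : eps * (m 0 k)%:~R <= p 0 k - a /\ p 0 k - a < eps * ((m 0 k)%:~R + 1).
  rewrite mxE; have h1 := floor_le ((p 0 k - a) / eps).
  have h2 := floorD1_gt ((p 0 k - a) / eps).
  rewrite intrD in h2; set fl := Num.floor _ in h1 h2 *.
  by split; [rewrite mulrC -ler_pdivlMr|rewrite [ltRHS]mulrC -ltr_pdivrMr].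
(* Rounding the corner down costs less than eps, so points of the ball satisfy eps (n - m) < 2 a +
   eps, whence n - m < M + 2. *)
exists M.+2, m; split.
- by rewrite -addn2 natrD lerD2r.
- move=> n np; have nk k : [/\ m 0 k <= n 0 k & n 0 k - m 0 k < M.+2%:Z].
    have [m1 m2] := mk k.
    have [h1 h2] : - a <= eps * (n 0 k)%:~R - p 0 k /\ eps * (n 0 k)%:~R - p 0 k <= a.
      by have := le_trans (rV_coord_le _ k) np; rewrite !mxE ler_norml => /andP.
    split.
      by rewrite -(ler_int R) -(ler_pM2l e0); lra.
    rewrite -(ltr_int R) intrB -(ltr_pM2l e0).
    have : eps * (2 * a / eps) < eps * (M.+1%:R) by rewrite ltr_pM2l.
    rewrite [ltLHS]mulrC divfK ?gt_eqF//.
    have -> : (M.+2%:Z)%:~R = M.+1%:R + 1 :> R by rewrite -pmulrn natr1.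
    by lra.
  pose dz (k : 'I_d) : int := n 0 k - m 0 k.
  exists [ffun k => inord (absz (dz k))]; apply/rowP => k.
  have [k1 k2] := nk k; rewrite mxE ffunE inordK /dz.
    by rewrite gez0_abs ?subr_ge0// addrC subrK.
  by rewrite -ltz_nat gez0_abs ?subr_ge0.
- move=> z; apply: rV_norm_le; first by rewrite addr_ge0// mulr_ge0// ltW.
  move=> k; have [m1 m2] := mk k.
  have -> : (lattice_point eps (box_point m z) - p) 0 k =
      eps * (m 0 k)%:~R + eps * (z k)%:R - p 0 k.
    by rewrite /lattice_point /box_point; do 4 rewrite mxE; rewrite [(- p) 0 k]mxE intrD mulrDr -pmulrn.
  have zk : (z k)%:R <= M%:R + 1 :> R by rewrite natr1 ler_nat -ltnS ltn_ord.
  have ez : eps * (z k)%:R <= 2 * a + eps.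
    apply: (@le_trans _ _ (eps * (M%:R + 1))); first by rewrite ler_pM2l.
    rewrite mulrDr mulr1 lerD2r.
    by move: Mle; rewrite ler_pdivlMr// mulrC.
  have z0 : 0 <= eps * (z k)%:R by rewrite mulr_ge0// ltW.
  by rewrite ler_norml; apply/andP; split; lra.
Qed.

Definition box_seq (N : nat) (m : L) : seq L := [seq box_point m z | z : {ffun 'I_d -> 'I_N}].

Lemma box_seq_uniq N m : uniq (box_seq N m).
Proof. by rewrite map_inj_uniq ?enum_uniq//; exact: box_point_inj. Qed.

Lemma box_seq_sum N m (G : L -> R) :
  \sum_(n <- box_seq N m) G n = \sum_(z : {ffun 'I_d -> 'I_N}) G (box_point m z).
Proof. by rewrite big_map big_enum. Qed.

Lemma mem_box_seq N m (z : {ffun 'I_d -> 'I_N}) : box_point m z \in box_seq N m.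
Proof. by apply: map_f; rewrite mem_enum. Qed.

Lemma finite_lattice_ball (eps a : R) (p : 'rV[R]_d) : 0 < eps ->
  exists s : seq L, uniq s /\ forall n, (n \in s) = (`|lattice_point eps n - p| <= a).
Proof.
move=> e0; have [a0|a0] := leP 0 a; last first.
  exists [::]; split => // n; rewrite in_nil; apply/esym/negbTE; rewrite -ltNge.
  exact: lt_le_trans a0 _.
have [N [m [_ cov _]]] := lattice_box p e0 a0.
exists [seq n <- box_seq N m | `|lattice_point eps n - p| <= a].
split; first by rewrite filter_uniq ?box_seq_uniq.
move=> n; rewrite mem_filter; apply/andP/idP => [[]//|np]; split => //.
by have [z ->] := cov n np; exact: mem_box_seq.
Qed.

End lattice_boxes.

(** * Poincare estimate in a well *)

Section wells.
Variables (R : realType) (d : nat).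
Local Notation L := 'rV[int]_d.
Local Notation e := (basis_vec int).

Variable f : 'rV[R]_d -> R.
Hypothesis Df : forall k x, derivable f x (basis_vec R k).
Hypothesis Ddf : forall k j x, derivable (partial j f) x (basis_vec R k).
Variable K : R.
Hypothesis K0 : 0 < K.
Hypothesis hessK : forall k j x, `|partial k (partial j f) x| <= K.

Lemma critical_quadratic_bound p x : grad f p = 0 ->
  `|f x - f p| <= d%:R * (d%:R * K) * `|x - p| ^+ 2.
Proof.
have pe y : p + (y - p) = y by rewrite addrC subrK.
move=> gp; have [z [zp E]] := partials_mvt p (x - p) Df.
rewrite pe in E; rewrite E.
apply: le_trans (ler_norm_sum _ _ _) _; rewrite -mulrA -sum_const_ord; apply: ler_sum => k _.
have [w [_ E']] := partials_mvt p (z k - p) (fun j => @Ddf j k).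
have pk0 : partial k f p = 0 by rewrite -gradE gp mxE.
rewrite pe pk0 subr0 in E'.
have h : `|partial k f (z k)| <= d%:R * K * `|x - p|.
  rewrite E'; apply: le_trans (ler_norm_sum _ _ _) _; rewrite -mulrA -sum_const_ord.
  apply: ler_sum => j _; rewrite normrM mulrC; apply: ler_pM => //.
  by apply: le_trans (zp k); exact: rV_coord_le.
rewrite normrM expr2 mulrA mulrC [leRHS]mulrC.
by rewrite [leRHS]mulrC; apply: ler_pM => //; exact: rV_coord_le.
Qed.

Local Notation V eps := (fun n : L => potential f eps (lattice_point eps n) + (2 * d)%:R).
Local Notation fe eps := (fun n : L => f (lattice_point eps n)).

(** On a box of side O(sqrt eps) around p, f differs from f p by O(eps), so all Gibbs weights agree
    with their value at p up to a constant factor. The box inequality for u = exp(f / (2 eps)) psi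
    then loses N^2 = O(1 / eps), which the factor eps on the left compensates. *)
Lemma well_poincare (rho : R) : 0 <= rho ->
  exists2 C : R, 0 <= C & forall p eps, grad f p = 0 -> 0 < eps -> eps <= 1 ->
    exists s : seq L, [/\ uniq s,
      forall n, `|lattice_point eps n - p| ^+ 2 <= rho * eps -> n \in s &
      forall psi, schr_dom (V eps) psi ->
        \sum_(n <- s) expR (fe eps n / (2 * eps)) * psi n = 0 ->
        eps * \sum_(n <- s) psi n ^+ 2 <= C * dot psi (schr (V eps) psi)].
Proof.
(* The box exceeds the ball by 2 eps and its outgoing edges by one eps more; eps <= sqrt eps turns
   the sum into 3 sqrt eps. *)
move=> rho0; pose b : R := Num.sqrt rho + 3.
have sr0 : 0 <= Num.sqrt rho := sqrtr_ge0 _.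
pose C1 : R := d%:R * (d%:R * K) * b ^+ 2.
pose C : R := expR C1 * expR C1 * (d%:R * (2 * Num.sqrt rho + 2) ^+ 2).
exists C; first by rewrite !mulr_ge0 ?expR_ge0 ?sqr_ge0.
move=> p eps gp e0 e1; pose s := Num.sqrt eps.
have s0 : 0 < s by rewrite sqrtr_gt0.
have s2 : s ^+ 2 = eps by rewrite sqr_sqrtr// ltW.
have s1 : s <= 1 by rewrite -(@expr_le1 _ 2) ?s2// ltW.
have es : eps <= s by rewrite -s2 expr2 ler_piMl// ltW.
have a0 : 0 <= Num.sqrt rho * s by rewrite mulr_ge0// ltW.
have [N [m [NN cov bnd]]] := lattice_box p e0 a0.
exists (box_seq N m); split; first exact: box_seq_uniq.
  move=> n np; have : `|lattice_point eps n - p| <= Num.sqrt rho * s.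
    by rewrite -sqrtrM// -[leLHS]ger0_norm// -sqrtr_sqr ler_wsqrtr.
  by move=> /cov [z ->]; exact: mem_box_seq.
move=> psi sp sum0.
have near x : `|x - p| <= b * s -> `|f x - f p| <= C1 * eps.
  move=> xb; apply: le_trans (critical_quadratic_bound x gp) _.
  rewrite /C1 -[leRHS]mulrA ler_wpM2l ?mulr_ge0 ?(ltW K0)//.
  by rewrite -s2 -exprMn lerXn2r ?nnegrE// mulr_ge0 ?(ltW s0)// addr_ge0.
have nz (z : {ffun 'I_d -> 'I_N}) : `|lattice_point eps (box_point m z) - p| <= b * s.
  by apply: le_trans (bnd z) _; rewrite /b mulrDl; lra.
have nze (z : {ffun 'I_d -> 'I_N}) k : `|lattice_point eps (box_point m z + e k) - p| <= b * s.
  rewrite lattice_pointD lattice_point_basis addrAC.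
  apply: le_trans (ler_normD _ _) _; have := norm_basis_le eps k.
  have := bnd z; rewrite gtr0_norm// /b mulrDl.
  by set n1 := `|_ - p|; set n2 := `|eps *: _|; lra.
pose u n := expR (fe eps n / (2 * eps)) * psi n.
have P := @poincare_box R d N m u.
rewrite -box_seq_sum in P; have {}P := P sum0.
have [sE QE] := gibbs_identity sp.
(* Lower bound, valid for every edge starting in the box, for the weight in [gibbs_edgeE]. *)
pose w := expR (- f p / eps - C1).
have edge (z : {ffun 'I_d -> 'I_N}) k : w * (u (box_point m z + e k) - u (box_point m z)) ^+ 2 <=
    edge_energy (gibbs_ratio f eps) psi k (box_point m z).
  rewrite (gibbs_edgeE _ e0) ler_wpM2r ?sqr_ge0// ler_expR.
  have := near _ (nz z); have := near _ (nze z k); rewrite !ler_norml.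
  set f0 := f p; set f1 := f _; set f2 := f _ => /andP[_ h1] /andP[_ h2].
  have -> : - f0 / eps - C1 = - (2 * f0 + 2 * (C1 * eps)) / (2 * eps).
    by field; rewrite gt_eqF.
  rewrite ler_pM2r ?invr_gt0 ?mulr_gt0// lerN2; lra.
have psiu (z : {ffun 'I_d -> 'I_N}) : expR (f p / eps - C1) * psi (box_point m z) ^+ 2 <= u (box_point m z) ^+ 2.
  rewrite exprMn ler_wpM2r ?sqr_ge0// expr2 -expRD ler_expR.
  have := near _ (nz z); rewrite ler_norml.
  set f0 := f p; set f1 := f _ => /andP[h1 _].
  have -> : f0 / eps - C1 = (f0 - C1 * eps) / eps by field; rewrite gt_eqF.
  have -> : f1 / (2 * eps) + f1 / (2 * eps) = f1 / eps by field; rewrite gt_eqF.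
  by rewrite ler_pM2r ?invr_gt0//; lra.
set Q := dot psi _ in QE *.
have EQ : \sum_k \sum_(z : {ffun 'I_d -> 'I_N}) w * (u (box_point m z + e k) - u (box_point m z)) ^+ 2 <= Q.
  rewrite QE; apply: ler_sum => k _.
  apply: (@le_trans _ _ (\sum_(n <- box_seq N m) edge_energy (gibbs_ratio f eps) psi k n)).
    by rewrite box_seq_sum; apply: ler_sum => z _; exact: edge.
  apply: sum_le_lsum => //; last exact: box_seq_uniq.
  by move=> n; apply: edge_energy_ge0; exact: expR_gt0.
rewrite box_seq_sum; set S := \sum_(z : {ffun _ -> _}) psi _ ^+ 2.
have US : expR (f p / eps - C1) * S <= \sum_(z : {ffun 'I_d -> 'I_N}) u (box_point m z) ^+ 2.
  by rewrite mulr_sumr; apply: ler_sum => z _; exact: psiu.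
set D := \sum_k \sum_z (u _ - u _) ^+ 2 in P.
have ED : w * D <= Q.
  apply: le_trans EQ; rewrite /D mulr_sumr; apply: ler_sum => k _.
  by rewrite mulr_sumr.
have D0 : 0 <= D.
  by apply: sumr_ge0 => k _; apply: sumr_ge0 => z _; exact: sqr_ge0.
have N2 : eps * (N ^ 2)%:R <= (2 * Num.sqrt rho + 2) ^+ 2.
  rewrite natrX -s2 -exprMn lerXn2r ?nnegrE ?mulr_ge0 ?(ltW s0)// ?addr_ge0 ?mulr_ge0//.
  apply: (@le_trans _ _ (s * (2 * (Num.sqrt rho * s) / eps + 2))).
    by rewrite ler_wpM2l// ltW.
  have -> : s * (2 * (Num.sqrt rho * s) / eps + 2) = 2 * Num.sqrt rho + 2 * s.
    by rewrite -s2; field; rewrite gt_eqF.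
  by rewrite lerD2l; lra.
have wE : expR (f p / eps - C1) * w * (expR C1 * expR C1) = 1.
  by rewrite /w -!expRD -[RHS]expR0; congr expR; field; rewrite gt_eqF.
have X0 : 0 < expR (f p / eps - C1) by exact: expR_gt0.
have w0 : 0 < w by exact: expR_gt0.
have chain : eps * (2 * (expR (f p / eps - C1) * S)) * w <=
    d%:R * (2 * Num.sqrt rho + 2) ^+ 2 * Q.
  apply: (@le_trans _ _ (eps * (d%:R * (N ^ 2)%:R * D) * w)).
    rewrite ler_pM2r// ler_pM2l//; apply: le_trans P; rewrite ler_pM2l//.
  have -> : eps * (d%:R * (N ^ 2)%:R * D) * w = d%:R * (eps * (N ^ 2)%:R) * (w * D) by ring.
  apply: ler_pM => //; try by rewrite mulr_ge0// ltW.
  - by rewrite mulr_ge0// mulr_ge0// ltW.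
  - by rewrite ler_wpM2l.
have S0 : 0 <= S by apply: sumr_ge0 => z _; exact: sqr_ge0.
have : expR C1 * expR C1 * (eps * (2 * (expR (f p / eps - C1) * S)) * w) <=
    expR C1 * expR C1 * (d%:R * (2 * Num.sqrt rho + 2) ^+ 2 * Q).
  by rewrite ler_wpM2l// mulr_ge0 ?expR_ge0.
have -> : expR C1 * expR C1 * (eps * (2 * (expR (f p / eps - C1) * S)) * w) =
   2 * (eps * S) * (expR (f p / eps - C1) * w * (expR C1 * expR C1)) by ring.
rewrite wE mulr1 [leRHS]mulrA -/C; apply: le_trans.
by rewrite ler_peMl ?mulr_ge0 ?(ltW e0)// ler1n.
Qed.

End wells.

(** * Form bound of order eps in finite codimension *)

Section spectral_gap.
Variables (R : realType) (d : nat).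
Local Notation L := 'rV[int]_d.
Local Notation e := (basis_vec int).

Variable f : 'rV[R]_d -> R.
Hypothesis Df : forall k x, derivable f x (basis_vec R k).
Hypothesis cdf : forall k, continuous (partial k f).
Hypothesis Ddf : forall k j x, derivable (partial j f) x (basis_vec R k).
Hypothesis cddf : forall k j, continuous (partial k (partial j f)).
Hypothesis nondeg : nondegenerate_critical_points f.
Hypothesis grad_inf : (0 < limf_einf (fun x => (enorm (grad f x))%:E) (@at_infinity R d))%E.
Variable K : R.
Hypothesis K0 : 0 < K.
Hypothesis hessK : forall k j x, `|partial k (partial j f) x| <= K.
Local Notation V eps := (fun n : L => potential f eps (lattice_point eps n) + (2 * d)%:R).
Local Notation fe eps := (fun n : L => f (lattice_point eps n)).

Lemma field_lower_bound (X : 'I_d -> 'rV[R]_d -> R) (B eps : R) psi :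
  (forall k x, `|X k x| <= B) -> schr_dom (V eps) psi ->
  smb (fun n => field_potential f X eps (lattice_point eps n) * psi n ^+ 2) /\
  lsum (fun n => field_potential f X eps (lattice_point eps n) * psi n ^+ 2)
    <= dot psi (schr (V eps) psi).
Proof.
move=> XB sp.
pose t k n := expR (- (X k (lattice_point eps n + (eps / 2) *: basis_vec R k) / 2)).
have E n : field_potential f X eps (lattice_point eps n) = edge_potential (V eps) t n.
  rewrite /field_potential /edge_potential; congr (_ - _); apply: eq_bigr => k _.
  congr (_ + _); rewrite /t -expRN opprK lattice_pointD lattice_pointN lattice_point_basis.
  congr (expR (X k _ / 2)); rewrite -addrA; congr (_ + _).
  by rewrite -!scaleNr -scalerDl; congr (_ *: _); rewrite -[_ *: 2^-1]/(_ * _); field.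
rewrite (_ : (fun n => _) = fun n => edge_potential (V eps) t n * psi n ^+ 2); last first.
  by apply: funext => n; rewrite E.
apply: (@edge_lower_bound _ _ _ _ _ (expR (B / 2))) => //.
- by move=> k n; exact: expR_gt0.
- move=> k n; rewrite ler_expR; have := XB k (lattice_point eps n + (eps / 2) *: basis_vec R k).
  by rewrite ler_norml => /andP[]; lra.
- move=> k n; rewrite -expRN ler_expR; have := XB k (lattice_point eps n + (eps / 2) *: basis_vec R k).
  by rewrite ler_norml => /andP[]; lra.
Qed.

(** The field potential is at least c0 eps, except that on the wells it may be lower by (c0 + Km)
    eps. This deficit, summed against psi^2, is bounded by a multiple of the form itself through
    [well_poincare], and is absorbed on the other side. *)
Lemma spectral_gap (ps : seq 'rV[R]_d) (ms ss : seq 'rV[R]_d) : uniq ps ->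
  (forall x, (x \in ps) = (grad f x == 0)) ->
  (forall x, x \in ps -> x \in ms \/ x \in ss) ->
  (forall x, x \in ms -> grad f x = 0) ->
  (forall x, x \in ss -> grad f x = 0 /\ ~ local_minima f x) -> uniq ss ->
  exists c eps1 : R, [/\ 0 < c, 0 < eps1 & forall eps, 0 < eps -> eps <= eps1 ->
    exists s : 'I_(size ms) -> seq L, forall psi, schr_dom (V eps) psi ->
      (forall i, \sum_(n <- s i) expR (fe eps n / (2 * eps)) * psi n = 0) ->
      c * eps * nrm2 psi <= dot psi (schr (V eps) psi)].
Proof.
move=> ups psE pms msE ssE uss.
have [X [B [c0 [rho [Km [eps1 [c00 rho0 eps10 [Km0 XB] HX]]]]]]] :=
  global_field_exists Df cdf Ddf cddf nondeg grad_inf K0 hessK ups psE pms msE ssE uss.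
have [C C0 HC] := well_poincare Df Ddf K0 hessK (ltW rho0).
(* M Q >= c0 eps |psi|^2 once the deficit of all wells has been moved to the side of the form Q. *)
pose M := 1 + (c0 + Km) * ((size ms)%:R * C).
have cK0 : 0 <= c0 + Km by rewrite addr_ge0// ltW.
have M0 : 0 < M by rewrite ltr_pwDl// !mulr_ge0.
exists (c0 / M), (Num.min eps1 1); split; [exact: divr_gt0|by rewrite lt_min eps10/=|].
move=> eps e0; rewrite le_min => /andP[e1 el1].
have Hs (i : 'I_(size ms)) : exists s : seq L, [/\ uniq s,
      forall n, `|lattice_point eps n - ms`_i| ^+ 2 <= rho * eps -> n \in s &
      forall psi, schr_dom (V eps) psi ->
        \sum_(n <- s) expR (fe eps n / (2 * eps)) * psi n = 0 ->
        eps * \sum_(n <- s) psi n ^+ 2 <= C * dot psi (schr (V eps) psi)].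
  by apply: HC => //; apply: msE; exact: mem_nth.
have [s {}Hs] := choice Hs; exists s => psi sp s0.
have [sW] := field_lower_bound XB sp; set Q := dot psi _ => WQ.
have sl i : smb (fun n => (n \in s i)%:R * psi n ^+ 2).
  by apply: (@smb_finsupp _ _ (s i)) => n /negbTE ->; rewrite mul0r.
have le i : \sum_(n <- s i) psi n ^+ 2 = lsum (fun n => (n \in s i)%:R * psi n ^+ 2).
  have [us _ _] := Hs i.
  rewrite (lsum_finsupp us); last by move=> n /negbTE ->; rewrite mul0r.
  by rewrite big_seq [RHS]big_seq; apply: eq_bigr => n ->; rewrite mul1r.
have psi2 : smb (fun n => psi n ^+ 2) by exact: sp.1.
have low : c0 * eps * nrm2 psi - (c0 + Km) * eps * \sum_i \sum_(n <- s i) psi n ^+ 2 <= Q.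
  apply: le_trans WQ.
  have sS : smb (fun n => \sum_i (n \in s i)%:R * psi n ^+ 2) by apply: smb_sum => i _.
  have -> : nrm2 psi = lsum (fun n => psi n ^+ 2) by [].
  under eq_bigr do rewrite le.
  rewrite -lsum_sum// -!lsumZ// -lsumB//; [|exact: smbZ|exact: smbZ].
  apply: ler_lsum => //; first by apply: smbB; exact: smbZ.
  move=> n; have p2 := sqr_ge0 (psi n).
  have Sn0 : 0 <= \sum_i (n \in s i)%:R * psi n ^+ 2.
    by apply: sumr_ge0 => i _; rewrite mulr_ge0.
  have [W|[[p pm pn] W]] := HX eps (lattice_point eps n) e0 e1.
    apply: (@le_trans _ _ (c0 * eps * psi n ^+ 2)); last exact: ler_wpM2r.
    by rewrite gerBl mulr_ge0// mulr_ge0// ltW.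
  apply: (@le_trans _ _ (- (Km * eps) * psi n ^+ 2)); last exact: ler_wpM2r.
  have im : (index p ms < size ms)%N by rewrite index_mem.
  pose i := Ordinal im.
  have ni : n \in s i.
    by have [_ + _] := Hs i; apply; rewrite nth_index.
  have : psi n ^+ 2 <= \sum_i (n \in s i)%:R * psi n ^+ 2.
    by rewrite (bigD1 i)//= ni mul1r lerDl sumr_ge0// => j _; rewrite mulr_ge0.
  set S := \sum_i _; set P := psi n ^+ 2 => PS.
  have : (c0 + Km) * eps * P <= (c0 + Km) * eps * S by rewrite ler_wpM2l// mulr_ge0// ltW.
  rewrite !mulrDl mulNr; lra.
have up : eps * \sum_i \sum_(n <- s i) psi n ^+ 2 <= (size ms)%:R * C * Q.
  rewrite mulr_sumr -mulrA -sum_const_ord; apply: ler_sum => i _.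
  by have [_ _] := Hs i; apply.
rewrite mulrAC -mulrA mulrAC ler_pdivrMr//.
have : (c0 + Km) * (eps * \sum_i \sum_(n <- s i) psi n ^+ 2) <= (c0 + Km) * ((size ms)%:R * C * Q).
  exact: ler_wpM2l.
move: low; rewrite /M; set S := \sum_i _; set N := nrm2 psi.
have -> : Q * (1 + (c0 + Km) * ((size ms)%:R * C)) = Q + (c0 + Km) * ((size ms)%:R * C * Q) by ring.
set Z := (c0 + Km) * (_ * Q).
have -> : (c0 + Km) * eps * S = (c0 + Km) * (eps * S) by rewrite mulrA.
set Y := (c0 + Km) * (eps * S).
by lra.
Qed.

Lemma potential_infinity : exists c eps1 : R, [/\ 0 < c, 0 < eps1 &
  forall eps, 0 < eps -> eps <= eps1 -> exists F : seq L, uniq F /\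
    forall n, n \notin F -> c <= potential f eps (lattice_point eps n)].
Proof.
have [M [c [c0 Mc]]] := gsq_infty grad_inf.
have dK0 : 0 < d%:R * K + 1 by rewrite ltr_wpDl// mulr_ge0// ltW.
exists (c / 16), (Num.min (c / 8 / (d%:R * K + 1)) (2 / K)).
split; [by rewrite divr_gt0|by rewrite lt_min !divr_gt0|].
move=> eps e0; rewrite le_min !ler_pdivlMr// => /andP[e1 e2].
have [F [uF FE]] := finite_lattice_ball M (0 : 'rV[R]_d) e0.
exists F; split => // n; rewrite FE subr0 -ltNge => /Mc gc.
apply: le_trans (potential_ge Df Ddf hessK _ e0 e2).
have : d%:R * K * eps <= c / 8 by rewrite mulrDr mulr1 in e1; lra.
by lra.
Qed.

End spectral_gap.

(** * Quasimodes *)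

Section quasimodes.
Variables (R : realType) (d : nat).
Local Notation L := 'rV[int]_d.
Local Notation e := (basis_vec int).

(** exp y >= (y / (m + 1))^(m + 1) at y = b / eps beats eps^(- m) with one power of eps to spare,
    and that power absorbs A. *)
Lemma expR_dominates (A b : R) (m : nat) : 0 < A -> 0 < b -> exists2 eps1 : R, 0 < eps1 &
  forall eps, 0 < eps -> eps <= eps1 -> A * eps^-1 ^+ m * expR (- (2 * b) / eps) <= expR (- b / eps).
Proof.
move=> A0 b0; pose q := b / m.+1%:R.
have q0 : 0 < q by rewrite divr_gt0.
exists (q ^+ m.+1 / A); first by rewrite divr_gt0// exprn_gt0.
move=> eps e0; rewrite ler_pdivlMr// => le.
have ei0 : 0 < eps^-1 by rewrite invr_gt0.
have ex : (q / eps) ^+ m.+1 <= expR (b / eps).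
  have -> : b / eps = m.+1%:R * (q / eps) by rewrite /q; field; rewrite !gt_eqF.
  rewrite expRM_natl; apply: lerXn2r; rewrite ?nnegrE ?expR_ge0//.
    by apply: divr_ge0; exact: ltW.
  by apply: (le_trans _ (expR_ge1Dx _)); rewrite lerDr.
have -> : expR (- (2 * b) / eps) = expR (- b / eps) * expR (- b / eps).
  by rewrite -expRD; congr expR; field; rewrite gt_eqF.
have -> : expR (- b / eps) = (expR (b / eps))^-1 by rewrite -expRN mulNr.
rewrite mulrA ler_piMl ?invr_ge0 ?expR_ge0// ler_pdivrMr ?expR_gt0// mul1r.
apply: le_trans ex; rewrite exprMn exprSr.
have -> : A * eps^-1 ^+ m = eps * A * (eps^-1 ^+ m * eps^-1) by field; rewrite gt_eqF.
by rewrite -!exprSr ler_wpM2r ?exprn_ge0 ?(ltW ei0)// mulrC.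
Qed.

Lemma nearest_lattice_point (eps : R) (p : 'rV[R]_d) : 0 < eps ->
  exists n : L, `|lattice_point eps n - p| <= eps.
Proof.
move=> e0; exists (\row_k Num.floor (p 0 k / eps)).
apply: rV_norm_le => [|k]; first exact: ltW.
have h1 := floor_le (p 0 k / eps); have h2 := floorD1_gt (p 0 k / eps).
rewrite !mxE; rewrite intrD in h2; set fl := Num.floor _ in h1 h2 *.
have {}h1 : fl%:~R * eps <= p 0 k by rewrite -ler_pdivlMr.
have {}h2 : p 0 k < (fl%:~R + 1) * eps by rewrite -ltr_pdivrMr.
by rewrite ler_norml; apply/andP; split; lra.
Qed.

Variable f : 'rV[R]_d -> R.
Local Notation V eps := (fun n : L => potential f eps (lattice_point eps n) + (2 * d)%:R).
Local Notation fe eps := (fun n : L => f (lattice_point eps n)).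

Definition cutoff_gibbs (p : 'rV[R]_d) (a eps : R) (n : L) : R :=
  (`|lattice_point eps n - p| <= a)%R%:R * expR (- fe eps n / (2 * eps)).

(** Divided by the Gibbs weight the quasimode is an indicator function, so only edges crossing the
    sphere of radius 3 r / 4 count. As eps <= r / 4, both ends of such an edge lie in the annulus
    where f >= f p + eta. *)
Lemma cutoff_gibbs_edge p (r eta eps : R) k n : 0 < eps -> eps <= r / 4 ->
  (forall x, r / 2 <= `|x - p| -> `|x - p| <= r -> f p + eta <= f x) ->
  edge_energy (gibbs_ratio f eps) (cutoff_gibbs p (3 / 4 * r) eps) k n <=
    (`|lattice_point eps n - p| <= r)%R%:R * expR (- (f p + eta) / eps).
Proof.
move=> e0 er ann; rewrite gibbs_edgeE// /cutoff_gibbs.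
have cancel m c : expR (fe eps m / (2 * eps)) * (c * expR (- fe eps m / (2 * eps))) = c.
  by rewrite mulrCA -expRD mulNr subrr expR0 mulr1.
rewrite (cancel n) (cancel (n + e k)).
have step : `| `|lattice_point eps (n + e k) - p| - `|lattice_point eps n - p| | <= eps.
  apply: le_trans (ler_dist_dist _ _) _.
  rewrite lattice_pointD lattice_point_basis opprB addrA subrK addrAC subrr add0r.
  by apply: le_trans (norm_basis_le _ _) _; rewrite gtr0_norm.
have := ann (lattice_point eps n); have := ann (lattice_point eps (n + e k)).
move: step; set x := lattice_point eps n; set y := lattice_point eps (n + e k).
set nx := `|x - p|; set ny := `|y - p|; rewrite ler_norml => /andP[s1 s2] ay ax.
have R0 (b : bool) : 0 <= b%:R * expR (- (f p + eta) / eps) by rewrite mulr_ge0.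
have main : r / 2 <= nx -> nx <= r -> r / 2 <= ny -> ny <= r ->
    expR (- (f x + f y) / (2 * eps)) <= (nx <= r)%R%:R * expR (- (f p + eta) / eps).
  move=> x1 x2 y1 y2; rewrite x2 mul1r ler_expR.
  have -> : - (f p + eta) / eps = - (2 * (f p + eta)) / (2 * eps) by field; rewrite gt_eqF.
  rewrite ler_pM2r ?invr_gt0 ?mulr_gt0// lerN2.
  by have := ax x1 x2; have := ay y1 y2; set P := f p + eta; lra.
case: (leP nx (3 / 4 * r)) => hx; case: (leP ny (3 / 4 * r)) => hy.
- by rewrite subrr expr0n mulr0.
- rewrite sub0r sqrrN expr1n mulr1; apply: main; lra.
- rewrite subr0 expr1n mulr1; apply: main; lra.
- by rewrite subrr expr0n mulr0.
Qed.

Hypothesis Df : forall k x, derivable f x (basis_vec R k).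
Hypothesis Ddf : forall k j x, derivable (partial j f) x (basis_vec R k).
Variable K : R.
Hypothesis K0 : 0 < K.
Hypothesis hessK : forall k j x, `|partial k (partial j f) x| <= K.

Lemma cutoff_gibbs_energy p (r eta eps : R) k : 0 < eps -> eps <= r / 4 -> eps <= 1 ->
  (forall x, r / 2 <= `|x - p| -> `|x - p| <= r -> f p + eta <= f x) ->
  lsum (edge_energy (gibbs_ratio f eps) (cutoff_gibbs p (3 / 4 * r) eps) k) <=
    ((2 * r + 2) / eps) ^+ d * expR (- (f p + eta) / eps).
Proof.
move=> e0 er e1 ann; have r0 : 0 <= r by lra.
have [N [m [NN cov _]]] := lattice_box p e0 r0.
set E := expR (- (f p + eta) / eps).
have E0 : 0 <= E by exact: expR_ge0.
have nz n : n \notin box_seq N m -> (`|lattice_point eps n - p| <= r) = false.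
  move=> nb; apply/negbTE/negP => /cov [z nE]; move/negP: nb; apply.
  by rewrite nE mem_box_seq.
rewrite (lsum_finsupp (box_seq_uniq N m)); last first.
  move=> n /nz h; apply/eqP; rewrite eq_le edge_energy_ge0 ?andbT; last exact: expR_gt0.
  by apply: le_trans (cutoff_gibbs_edge k n e0 er ann) _; rewrite h mul0r.
rewrite box_seq_sum.
apply: (@le_trans _ _ (\sum_(z : {ffun 'I_d -> 'I_N}) E)).
  apply: ler_sum => z _; apply: le_trans (cutoff_gibbs_edge k _ e0 er ann) _.
  by rewrite ler_piMl// lern1 leq_b1.
rewrite sumr_const card_ffun !card_ord -[leLHS]mulr_natl ler_wpM2r// natrX.
apply: lerXn2r; rewrite ?nnegrE//.
  by rewrite divr_ge0 ?(ltW e0)// addr_ge0// mulr_ge0.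
apply: le_trans NN _; rewrite [leRHS]mulrDl lerD2l ler_pdivlMr//; lra.
Qed.

(** The lattice point nearest to a minimum sees a single quasimode, which gives independence and a
    lower bound for the norm of u. Its energy is bounded edge by edge with Cauchy-Schwarz. The
    quotient is a power of 1 / eps times exp(- eta / eps), and half of the exponent pays for the
    power. *)
Lemma quasimodes_exist (ms : seq 'rV[R]_d) : uniq ms -> (forall p, p \in ms -> local_minima f p) ->
  (forall p, local_minima f p -> exists2 r0 : R, 0 < r0 & forall r : R, 0 < r -> r <= r0 ->
    exists2 eta : R, 0 < eta &
      forall x, r / 2 <= `|x - p| -> `|x - p| <= r -> f p + eta <= f x) ->
  exists c eps1 : R, [/\ 0 < c, 0 < eps1 & forall eps, 0 < eps -> eps <= eps1 ->
    exists phi : 'I_(size ms) -> L -> R, [/\ forall i, schr_dom (V eps) (phi i),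
      forall a : 'I_(size ms) -> R, (forall n, \sum_i a i * phi i n = 0) -> forall i, a i = 0 &
      forall a : 'I_(size ms) -> R, let u n := \sum_i a i * phi i n in
        dot u (schr (V eps) u) <= expR (- c / eps) * nrm2 u]].
Proof.
move=> ums mins annulus.
have [r1 r10 Hr1] : exists2 r1 : R, 0 < r1 & forall p, p \in ms ->
    forall q, q \in ms -> q != p -> 2 * r1 <= `|q - p|.
  apply: (@seq_pos_lower_bound _ _ ms (fun p a => forall q, q \in ms -> q != p -> 2 * a <= `|q - p|)).
    by move=> p a b Ha b0 ba q qps qp; apply: le_trans (Ha q qps qp); rewrite ler_pM2l.
  move=> p pms; have [a a0 Ha] : exists2 a : R, 0 < a & forall q, q \in ms -> q != p -> a <= `|q - p|.
    apply: (@seq_pos_lower_bound _ _ ms (fun q a => q != p -> a <= `|q - p|)).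
      by move=> q a b Ha b0 ba qp; apply: le_trans (Ha qp).
    move=> q qms; have [->|qp] := eqVneq q p; first by exists 1.
    by exists `|q - p| => //; rewrite normr_gt0 subr_eq0.
  exists (a / 2); first by rewrite divr_gt0.
  by move=> q qms qp; rewrite mulrC divfK//; exact: Ha.
have [r2 r20 Hr2] : exists2 r2 : R, 0 < r2 & forall p, p \in ms ->
    forall r : R, 0 < r -> r <= r2 -> exists2 eta : R, 0 < eta &
      forall x, r / 2 <= `|x - p| -> `|x - p| <= r -> f p + eta <= f x.
  apply: (@seq_pos_lower_bound _ _ ms (fun p r2 => forall r : R, 0 < r -> r <= r2 ->
    exists2 eta : R, 0 < eta &
      forall x, r / 2 <= `|x - p| -> `|x - p| <= r -> f p + eta <= f x)).
    by move=> p a b Ha b0 ba r r0 rb; apply: Ha => //; exact: le_trans ba.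
  by move=> p /mins; exact: annulus.
pose r := Num.min r1 r2.
have r0 : 0 < r by rewrite lt_min r10.
have rr1 : r <= r1 by rewrite ge_min lexx.
have rr2 : r <= r2 by rewrite ge_min lexx orbT.
have [eta eta0 Heta] : exists2 eta : R, 0 < eta & forall p, p \in ms ->
    forall x, r / 2 <= `|x - p| -> `|x - p| <= r -> f p + eta <= f x.
  apply: (@seq_pos_lower_bound _ _ ms (fun p eta => forall x, r / 2 <= `|x - p| -> `|x - p| <= r ->
     f p + eta <= f x)).
    by move=> p a b Ha b0 ba x x1 x2; apply: le_trans (Ha x x1 x2); rewrite lerD2l.
  by move=> p /Hr2; exact.
pose D : R := d%:R * (d%:R * K).
have D0 : 0 <= D by rewrite !mulr_ge0// ltW.
pose A : R := (size ms)%:R * (d%:R * (2 * r + 2) ^+ d * expR D) + 1.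
have A1 : 0 <= (size ms)%:R * (d%:R * (2 * r + 2) ^+ d * expR D).
  by rewrite !mulr_ge0 ?expR_ge0// exprn_ge0// addr_ge0// mulr_ge0// ltW.
have A0 : 0 < A by rewrite ltr_wpDl.
have eta20 : 0 < eta / 2 by rewrite divr_gt0.
have [eps1 eps10 Heps] := expR_dominates d A0 eta20.
exists (eta / 2), (Num.min eps1 (Num.min 1 (r / 4))); split => //.
  by rewrite !lt_min eps10 ltr01 divr_gt0.
move=> eps e0; rewrite !le_min => /and3P[e1 el er].
pose phi (i : 'I_(size ms)) := cutoff_gibbs ms`_i (3 / 4 * r) eps.
have msi (i : 'I_(size ms)) : ms`_i \in ms by exact: mem_nth.
have /choice[n0 Hn0] (i : 'I_(size ms)) : exists n : L, `|lattice_point eps n - ms`_i| <= eps.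
  exact: nearest_lattice_point.
have phi0 i : phi i (n0 i) = expR (- fe eps (n0 i) / (2 * eps)).
  rewrite /phi /cutoff_gibbs (_ : _ <= 3 / 4 * r) ?mul1r//.
  by apply: le_trans (Hn0 i) _; lra.
have phij i j : i != j -> phi j (n0 i) = 0.
  move=> ij; rewrite /phi /cutoff_gibbs (_ : (_ <= 3 / 4 * r) = false) ?mul0r//.
  apply/negbTE/negP => le.
  have ne : ms`_i != ms`_j by rewrite nth_uniq.
  have := Hr1 _ (msi j) _ (msi i) ne.
  have -> : ms`_i - ms`_j = (lattice_point eps (n0 i) - ms`_j) - (lattice_point eps (n0 i) - ms`_i).
    by rewrite opprB [RHS]addrC [RHS]addrA subrK.
  have := ler_normB (lattice_point eps (n0 i) - ms`_j) (lattice_point eps (n0 i) - ms`_i).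
  move: le (Hn0 i); set t1 := `|_|; set t2 := `|_|; set t3 := `|_|; lra.
have uE (a : 'I_(size ms) -> R) i : \sum_j a j * phi j (n0 i) = a i * expR (- fe eps (n0 i) / (2 * eps)).
  rewrite (bigD1 i)//= phi0 big1 ?addr0// => j ji.
  by rewrite phij ?mulr0// eq_sym.
have phi_dom i : schr_dom (V eps) (phi i).
  have [s [_ sE]] := finite_lattice_ball (3 / 4 * r) ms`_i e0.
  apply: (@schr_dom_finsupp _ _ _ s) => n; rewrite sE /phi /cutoff_gibbs => /negbTE ->.
  by rewrite mul0r.
exists phi; split => //.
  move=> a au i; have := au (n0 i); rewrite uE => /eqP.
  by rewrite mulf_eq0 [X in _ || X]gt_eqF ?expR_gt0// orbF => /eqP.
move=> a; set u := (fun n => \sum_i a i * phi i n); rewrite /=.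
have su : schr_dom (V eps) u by apply: schr_dom_sum => i _; exact: schr_domZ.
have [sE QE] := gibbs_identity su.
have n0inj : injective n0.
  move=> i j ij; apply/eqP/negPn/negP => /phij h.
  have := phi0 j; rewrite -ij h => /esym/eqP; rewrite gt_eqF ?expR_gt0//.
(* f may take different values at the minima, so no common normalization works: norm and energy are
   both compared with these individual weights. *)
pose w i := a i ^+ 2 * expR (- f ms`_i / eps - D).
have low : \sum_i w i <= nrm2 u.
  apply: (@le_trans _ _ (\sum_(n <- [seq n0 i | i : 'I_(size ms)]) u n ^+ 2)); last first.
    apply: sum_le_lsum; first by move=> n; exact: sqr_ge0.
    - exact: su.1.
    - by rewrite map_inj_uniq// enum_uniq.
  rewrite big_map big_enum; apply: ler_sum => i _.
  rewrite /u uE exprMn; apply: ler_wpM2l; first exact: sqr_ge0.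
  rewrite expr2 -expRD ler_expR.
  have gp : grad f ms`_i = 0 by apply: local_min_grad => //; exact: mins.
  have := critical_quadratic_bound Df Ddf hessK (lattice_point eps (n0 i)) gp.
  have : D * `|lattice_point eps (n0 i) - ms`_i| ^+ 2 <= D * eps.
    rewrite ler_wpM2l// (@le_trans _ _ (eps ^+ 2))//.
      by rewrite lerXn2r ?nnegrE ?(ltW e0).
    by rewrite expr2 ler_piMl// ltW.
  rewrite -/D; set z := D * _ ^+ 2; rewrite ler_norml => zD /andP[_].
  set f0 := f ms`_i; set f1 := f (lattice_point _ _) => ff.
  have -> : - f1 / (2 * eps) + - f1 / (2 * eps) = - f1 / eps by field; rewrite gt_eqF.
  have -> : - f0 / eps - D = (- f0 - D * eps) / eps by field; rewrite gt_eqF.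
  by rewrite ler_pM2r ?invr_gt0//; lra.
have edge_phi i k := cutoff_gibbs_energy k e0 er el (Heta _ (msi i)).
have sphi i := gibbs_identity (phi_dom i).
have up : dot u (schr (V eps) u) <= (size ms)%:R * \sum_k \sum_i a i ^+ 2 *
    lsum (edge_energy (gibbs_ratio f eps) (phi i) k).
  rewrite QE mulr_sumr; apply: ler_sum => k _.
  under [X in _ <= _ * X]eq_bigr do rewrite -lsumZ ?(sphi _).1//.
  rewrite -lsum_sum => [|i _]; last exact/smbZ/(sphi i).1.
  have ss : smb (fun n => \sum_i a i ^+ 2 * edge_energy (gibbs_ratio f eps) (phi i) k n).
    by apply: smb_sum => i _; exact/smbZ/(sphi i).1.
  rewrite -lsumZ//; apply: ler_lsum => //; first exact: smbZ.
  move=> n; set G := expR (- (fe eps n + fe eps (n + e k)) / (2 * eps)).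
  pose g i := expR (fe eps (n + e k) / (2 * eps)) * phi i (n + e k) - expR (fe eps n / (2 * eps)) * phi i n.
  have -> : edge_energy (gibbs_ratio f eps) u k n = G * (\sum_i a i * g i) ^+ 2.
    rewrite gibbs_edgeE//; congr (_ * _ ^+ 2); rewrite /u !mulr_sumr -sumrB.
    by apply: eq_bigr => i _; rewrite /g; ring.
  have -> : \sum_i a i ^+ 2 * edge_energy (gibbs_ratio f eps) (phi i) k n = G * \sum_i (a i * g i) ^+ 2.
    rewrite mulr_sumr; apply: eq_bigr => i _; rewrite gibbs_edgeE// -/(g i) -/G exprMn.
    by rewrite mulrCA.
  rewrite [leRHS]mulrCA ler_wpM2l ?expR_ge0//.
  by apply: le_trans (sqr_sum_le _) _; rewrite card_ord.
apply: le_trans up _.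
set M := ((2 * r + 2) / eps) ^+ d.
have M0 : 0 <= M by rewrite exprn_ge0// divr_ge0// ?(ltW e0)// addr_ge0// mulr_ge0// ltW.
have bnd : \sum_k \sum_i a i ^+ 2 * lsum (edge_energy (gibbs_ratio f eps) (phi i) k) <=
    d%:R * (M * expR (D - eta / eps) * \sum_i w i).
  rewrite -sum_const_ord; apply: ler_sum => k _; rewrite mulr_sumr; apply: ler_sum => i _.
  apply: (@le_trans _ _ (a i ^+ 2 * (M * expR (- (f ms`_i + eta) / eps)))).
    by rewrite ler_wpM2l ?sqr_ge0//; exact: edge_phi.
  rewrite /w mulrCA -mulrA [expR _ * (_ * _)]mulrCA -expRD.
  rewrite le_eqVlt; apply/orP; left; apply/eqP; congr (_ * (_ * expR _)).
  by field; rewrite gt_eqF.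
have w0 : 0 <= \sum_i w i.
  by apply: sumr_ge0 => i _; rewrite mulr_ge0 ?sqr_ge0 ?expR_ge0.
apply: (@le_trans _ _ ((size ms)%:R * (d%:R * (M * expR (D - eta / eps) * \sum_i w i)))).
  by rewrite ler_wpM2l.
apply: (@le_trans _ _ (expR (- (eta / 2) / eps) * \sum_i w i)); last first.
  by rewrite ler_wpM2l ?expR_ge0.
have -> : (size ms)%:R * (d%:R * (M * expR (D - eta / eps) * \sum_i w i)) =
   (size ms)%:R * (d%:R * M * expR (D - eta / eps)) * \sum_i w i by ring.
rewrite ler_wpM2r//; apply: le_trans (Heps eps e0 e1).
have -> : expR (D - eta / eps) = expR D * expR (- (2 * (eta / 2)) / eps).
  by rewrite -expRD; congr expR; field; rewrite gt_eqF.
have -> : (size ms)%:R * (d%:R * M * (expR D * expR (- (2 * (eta / 2)) / eps))) =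
  (A - 1) * eps^-1 ^+ d * expR (- (2 * (eta / 2)) / eps).
  by rewrite /A addrK /M exprMn; ring.
by rewrite ler_wpM2r ?expR_ge0// ler_wpM2r ?exprn_ge0 ?invr_ge0 ?(ltW e0)// gerDl lerN10.
Qed.

End quasimodes.

(** * Choice of the constants and conclusion *)

Lemma expR_weaken (R : realType) (c C eps q m : R) : 0 < eps -> C <= c -> 0 <= m ->
  q <= expR (- c / eps) * m -> q <= expR (- C / eps) * m.
Proof.
move=> e0 Cc m0 qm; apply: le_trans qm _; rewrite ler_wpM2r// ler_expR.
by rewrite ler_pM2r ?invr_gt0// lerN2.
Qed.

Lemma expR_inv_lt (R : realType) (C c eps : R) : 0 < C -> 0 < c -> 0 < eps -> eps <= C * c ->
  expR (- C / eps) < c.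
Proof.
move=> C0 c0 e0 le; rewrite mulNr expRN -[ltRHS]invrK ltf_pV2 ?posrE ?invr_gt0 ?expR_gt0//.
apply: (@lt_le_trans _ _ (1 + C / eps)); last exact: expR_ge1Dx.
apply: (@le_lt_trans _ _ (C / eps)); last by rewrite ltrDr.
by rewrite ler_pdivlMr// ler_pdivrMl// mulrC.
Qed.

Lemma hess_bound (R : realType) (d : nat) (f : 'rV[R]_d -> R) : bounded_fun (hess f) ->
  exists2 K : R, 0 < K & forall k j x, `|partial k (partial j f) x| <= K.
Proof.
move=> [M [_ HM]]; exists (`|M| + 1); first by rewrite ltr_wpDl.
move=> k j x; have : `|hess f x| <= `|M| + 1.
  by apply: HM => //; rewrite (le_lt_trans (ler_norm M))// ltrDl.
apply: le_trans; have -> : partial k (partial j f) x = hess f x k j by rewrite mxE.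
rewrite [Num.norm (hess f x)]mx_normrE.
exact: (@le_bigmax _ _ _ _ (fun ij => `|hess f x ij.1 ij.2|) (k, j)).
Qed.

Theorem theorem2p2 (R : realType) (d : nat) (d_gt0 : (0 < d)%N)
    (f : 'rV[R]_d -> R)
    (f_C3 : Ck 3 f)
    (f_nondeg : nondegenerate_critical_points f)
    (f_grad : (0 < limf_einf (fun x => (enorm (grad f x))%:E)
                             (@at_infinity R d))%E)
    (f_hess : bounded_fun (hess f)) :
  finite_set (local_minima f) /\
  forall N0 : nat, local_minima f #= `I_N0 ->
  exists eps0 C : R, [/\ 0 < eps0, eps0 < 1, 0 < C &
    forall eps : R, 0 < eps -> eps <= eps0 ->
      let H := hamiltonian f eps in
      [/\ essential_spectrum eps H `<=` [set lam | C <= lam],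
          discrete_spectrum eps H `&` [set lam | 0 <= lam <= C * eps]
            #<= `I_N0,
          at_least_eigenvalues H setT N0 &
          N0 <> 0%N -> exists lam : R,
            nth_eigenvalue H N0 lam /\ 0 <= lam <= expR (- C / eps)]].
Proof.
have [cf f1] := f_C3.
have Df k x : derivable f x (basis_vec R k) by have [] := f1 k.
have cdf k : continuous (partial k f) by have [_ []] := f1 k.
have Ddf k j x : derivable (partial j f) x (basis_vec R k).
  by have [_ [_ f2]] := f1 j; have [] := f2 k.
have cddf k j : continuous (partial k (partial j f)).
  by have [_ [_ f2]] := f1 j; have [_ []] := f2 k.
have [K K0 hessK] := hess_bound f_hess.
have [ps [ups psE]] := finite_critical (@cdf) (@Ddf) (@cddf) f_nondeg f_grad.
have minps p : local_minima f p -> p \in ps.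
  by move=> mp; rewrite psE; apply/eqP; exact: (local_min_grad Df mp).
split; first by apply: (sub_finite_set _ (finite_seq ps)) => p /minps.
move=> N0 cardN.
pose ms := [seq p <- ps | `[< local_minima f p >]].
pose ss := [seq p <- ps | ~~ `[< local_minima f p >]].
have msP p : p \in ms <-> local_minima f p.
  rewrite mem_filter; split => [/andP[/asboolP]//|mp]; rewrite minps// andbT; exact/asboolP.
have ums : uniq ms by exact: filter_uniq.
have sN : N0 = size ms.
  have minE : local_minima f = [set` [fset p in ms]%fset].
    by apply/seteqP; split => p; rewrite /= !inE => /msP.
  by move: cardN; rewrite minE => /card_eq_fsetP <-; rewrite card_fseq undup_id.
subst N0.
have [cg [eg [cg0 eg0 gap]]] : exists c eps1 : R, [/\ 0 < c, 0 < eps1 &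
    forall eps, 0 < eps -> eps <= eps1 -> exists s : 'I_(size ms) -> seq 'rV[int]_d,
      forall psi, schr_dom (fun n => potential f eps (lattice_point eps n) + (2 * d)%:R) psi ->
      (forall i, \sum_(n <- s i) expR (f (lattice_point eps n) / (2 * eps)) * psi n = 0) ->
      c * eps * nrm2 psi <=
        dot psi (schr (fun n => potential f eps (lattice_point eps n) + (2 * d)%:R) psi)].
  apply: (spectral_gap (@Df) (@cdf) (@Ddf) (@cddf) f_nondeg f_grad K0 hessK ups psE (ss := ss)).
  - move=> p pps; rewrite !mem_filter pps !andbT; case: `[< _ >]; [by left|by right].
  - by move=> p; rewrite mem_filter psE => /andP[_ /eqP].
  - by move=> p; rewrite mem_filter psE => /andP[/negP np /eqP gp]; split => // /asboolP.
  - exact: filter_uniq.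
have [ci [ei [ci0 ei0 inf]]] := potential_infinity (@Df) (@Ddf) f_grad K0 hessK.
have [cq [eq [cq0 eq0 quasi]]] := quasimodes_exist (@Df) (@Ddf) K0 hessK ums
  (fun p => (msP p).1) (local_min_annulus cf (@Df) (@Ddf) (@cddf) f_nondeg).
(* [cg / 2] instead of [cg] because [codim_bound] needs eigenvalues strictly below cg eps, while the
   interval [0, C eps] is closed. *)
pose C := Num.min ci (Num.min (cg / 2) cq).
have C0 : 0 < C by rewrite !lt_min ci0 cq0 divr_gt0.
have Cci : C <= ci by rewrite ge_min lexx.
have Ccg : C <= cg / 2 by rewrite !ge_min lexx orbT.
have Ccq : C <= cq by rewrite !ge_min lexx !orbT.
(* The entry [C * ci] ensures exp(- C / eps) < ci, so the bound given by the quasimodes lies in the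
   range where the spectrum is known to be discrete. *)
exists (Num.min (1 / 2) (Num.min eg (Num.min ei (Num.min eq (C * ci))))), C; split => //.
- by rewrite !lt_min divr_gt0// eg0 ei0 eq0 mulr_gt0.
- by rewrite gt_min ltr_pdivrMr// mul1r ltr1n.
move=> eps e0; rewrite !le_min => /and5P[_ e1 e2 e3 e4]; rewrite /= hamiltonianE ?gt_eqF//.
set V := (fun n => _).
have [F [uF FV]] := inf eps e0 e2.
have WF n : n \notin F -> (2 * d)%:R + ci <= V n by move=> /FV; rewrite /V addrC lerD2r.
have [phi [phi_dom phi_free phi_mu]] := quasi eps e0 e3.
have muc : expR (- C / eps) < ci by exact: expR_inv_lt.
have V_ge0 psi : schr_dom V psi -> 0 <= dot psi (schr V psi) by exact: gibbs_ge0.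
have phi_mu' (a : 'I_(size ms) -> R) : let u n := \sum_i a i * phi i n in
    dot u (schr V u) <= expR (- C / eps) * nrm2 u.
  exact: (expR_weaken e0 Ccq (nrm2_ge0 _) (phi_mu a)).
split.
- by move=> lam /(essential_spectrum_ge uF WF (ltW e0)) /=; exact: le_trans.
- have [s Hs] := gap eps e0 e1.
  apply: card_le_of_inj => k lam inj Hlam.
  apply: (@codim_bound _ _ V (cg * eps) _
    (fun i psi => \sum_(n <- s i) expR (f (lattice_point eps n) / (2 * eps)) * psi n)
    _ _ k lam inj).
  + move=> i j a G; under eq_bigr do rewrite mulr_sumr; rewrite exchange_big/=.
    apply: eq_bigr => l _; rewrite mulr_sumr; apply: eq_bigr => n _; exact: mulrCA.
  + exact: Hs.
  + move=> i; have [[_ ev _] /andP[_ le]] := Hlam i; split => //.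
    apply: le_lt_trans le _; rewrite ltr_pM2r//; apply: le_lt_trans Ccg _.
    by rewrite ltr_pdivrMr// ltr_pMr// ltr1n.
- have [lam [psi [li H]]] := exists_low_eigenvalues uF WF muc V_ge0 phi_dom phi_free phi_mu'.
  by exists lam, psi; split => // i; have [_] := H i.
- exact: (exists_nth_eigenvalue uF WF muc V_ge0 phi_dom phi_free phi_mu').
Qed.
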